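(* Let $p\ge2$ and let $T=(T^{(N)})_{N\ge1}$ be a sequence of heavy-Wigner tensors of order $p$ with i.i.d. entries (up to symmetry) and parameters $(M_k)_{k\ge2}$, $M_2>0$. Let $$(\tilde A_N)_{a,b}=\frac{1}{\sqrt{M_2(p-2)!}}\sum_{j_1,\dots,j_{p-2}=1}^N T^{(N)}_{a,b,j_1,\dots,j_{p-2}},\qquad 1\le a,b\le N .$$ Then, as $N\to\infty$, the process $$(Z_N(k))_{k\ge1}:=\left(\frac{1}{\sqrt N}\left(\mathrm{Tr}(\tilde A_N^k)-\mathbb{E}\,\mathrm{Tr}(\tilde A_N^k)\right)\right)_{k\ge1}$$ converges (in finite-dimensional distributions) to a centered Gaussian process $(z(k))_{k\ge1}$ with covariance $$\mathbb{E}(z(k_1)z(k_2))=\frac{1}{((p-2)!\,M_2)^{(k_1+k_2)/2}}\sum_{\pi_1,\pi_2}C\left(\mathfrak{h}_{k_1}^{\pi_1},\mathfrak{h}_{k_2}^{\pi_2}\right),$$ where the sum ranges over all partitions $\pi_1$ of the vertex set of $\mathfrak{h}_{k_1}$ and all partitions $\pi_2$ of the vertex set of $\mathfrak{h}_{k_2}$, and $$C(\mathfrak{g}_1,\mathfrak{g}_2)=\sum_{\mathfrak{g}\in\mathcal{P}_\#(\mathfrak{g}_1,\mathfrak{g}_2)}\lim_{N\to\infty}\mathbb{E}\,\frac1N\mathrm{Tr}^0_{\mathfrak{g}}(T^{(N)}).$$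
   Context: Heavy-Wigner tensors with i.i.d. entries: $T^{(N)}=(T_{i_1,\dots,i_p})_{1\le i_1,\dots,i_p\le N}$ is a real random symmetric tensor (invariant under permutation of the indices) whose entries indexed by $i_1\le\cdots\le i_p$ are i.i.d. (with law depending on $N$), centered, with all moments finite, and such that for every $k\ge2$, $N^{p-1}\mathbb{E}[T_{i_1,\dots,i_p}^k]\to M_k$ as $N\to\infty$. Hypergraphs: a $p$-uniform hypergraph $(V,E)$ has a finite vertex set $V$ and a finite multiset $E$ of hyperedges, each hyperedge being a multiset of $p$ vertices. For a partition $\pi$ of $V$, $\mathfrak{h}^\pi$ is obtained by identifying vertices in the same block, keeping all hyperedges with multiplicity. For a symmetric tensor $T$ of order $p$ and dimension $N$, $$\mathrm{Tr}^0_{\mathfrak{h}}(T)=\sum_{\phi:V\to[N]\text{ injective}}\ \prod_{e=\{v_1,\dots,v_p\}\in E}T_{\phi(v_1),\dots,\phi(v_p)}.$$ For $k\ge1$, $\mathfrak{h}_k$ is the hypergraph with $k$ hyperedges forming a cycle: its vertices are $x_1,\dots,x_k$ and $e_t^1,\dots,e_t^{p-2}$ for $1\le t\le k$ (all distinct), and its hyperedges are $\{x_t,x_{t+1},e_t^1,\dots,e_t^{p-2}\}$ for $1\le t\le k$, with $x_{k+1}=x_1$. $\mathcal{P}_\#(\mathfrak{g}_1,\mathfrak{g}_2)$ is the set of hypergraphs obtained by gluing vertices of $\mathfrak{g}_1=(V_1,E_1)$ and $\mathfrak{g}_2=(V_2,E_2)$ together so that they have at least one hyperedge in common. Precisely,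 it is indexed by the partitions $\sigma$ of the disjoint union $V_1\sqcup V_2$ such that each block contains at most one vertex of $V_1$ and at most one vertex of $V_2$, and such that at least one hyperedge of $E_1$ becomes equal (as a multiset of blocks) to a hyperedge of $E_2$; to $\sigma$ corresponds the hypergraph $(\mathfrak{g}_1\sqcup\mathfrak{g}_2)^\sigma$ obtained by identifying vertices in the same block, keeping all hyperedges of $E_1$ and $E_2$ with multiplicity. The sum runs over all such $\sigma$. ($C(\mathfrak{g}_1,\mathfrak{g}_2)$ is the limiting covariance of the fluctuations $N^{-1/2}(\mathrm{Tr}^0_{\mathfrak{g}_i}(T^{(N)})-\mathbb{E}\,\mathrm{Tr}^0_{\mathfrak{g}_i}(T^{(N)}))$.) *)

(* Defs.v *)
From HB Require Import structures.
From mathcomp Require Import all_boot all_order all_algebra all_fingroup.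
From mathcomp Require Import all_classical all_reals all_analysis.
Set Implicit Arguments.
Unset Strict Implicit.
Unset Printing Implicit Defensive.
Import Order.TTheory GRing.Theory Num.Theory.
Import numFieldNormedType.Exports.
Local Open Scope classical_set_scope.
Local Open Scope ring_scope.

(* The [p]-tuple with entries [s].  In every use below [size s = p] (given
   [2 <= p]), so that the default value [x0] is never reached. *)
Definition tuple_of_seq (T : Type) (p : nat) (x0 : T) (s : seq T) : p.-tuple T :=
  [tuple nth x0 s i | i < p].

(** * Hypergraphs *)

(* A multiset of hyperedges is a list, a hyperedge (a multiset of [p] vertices)
   is a [p]-tuple.  The orders are immaterial: hyperedges are compared with
   [perm_eq], and hypergraphs are only evaluated on symmetric tensors. *)
Record hypergraph (p : nat) := Hypergraph {
  hvert : finType;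
  hedges : seq (p.-tuple hvert)
}.

Definition vpartition (V : finType) :=
  {S : {set {set V}} | finset.partition S [set: V]%SET}.

Definition block (V : finType) (pi : vpartition V) :=
  {B : {set V} | B \in val pi}.

Lemma block_of_subproof (V : finType) (pi : vpartition V) (v : V) :
  finset.pblock (val pi) v \in val pi.
Proof.
by apply: finset.pblock_mem; rewrite (finset.cover_partition (valP pi)) finset.in_setT.
Qed.

Definition block_of (V : finType) (pi : vpartition V) (v : V) : block pi :=
  exist _ (finset.pblock (val pi) v) (block_of_subproof pi v).

Section Hypergraphs.
Variable p : nat.

Definition hquotient (g : hypergraph p) (pi : vpartition (hvert g)) :
    hypergraph p :=
  @Hypergraph p (block pi) [seq map_tuple (block_of pi) e | e <- hedges g].

Definition hunion (g1 g2 : hypergraph p) : hypergraph p :=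
  @Hypergraph p (hvert g1 + hvert g2)%type
    ([seq map_tuple inl e | e <- hedges g1] ++
     [seq map_tuple inr e | e <- hedges g2]).

(* The partitions indexing P_#(g1, g2). *)
Definition edge_gluing (g1 g2 : hypergraph p)
    (sigma : vpartition (hvert (hunion g1 g2))) : bool :=
  [forall B in val sigma,
     (#|[set v : hvert g1 | inl v \in B]%SET| <= 1)%N &&
     (#|[set v : hvert g2 | inr v \in B]%SET| <= 1)%N] &&
  has (fun e1 : p.-tuple (hvert g1) =>
    has (fun e2 : p.-tuple (hvert g2) =>
      perm_eq (map_tuple (fun v => block_of sigma (inl v)) e1)
              (map_tuple (fun v => block_of sigma (inr v)) e2))
      (hedges g2))
    (hedges g1).

(* The vertex [x_t] is [inl t], the vertex [e_t^s] is [inr (t, s)], and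
   [ordS t] is [t + 1] modulo [k]. *)
Definition hcycle (k : nat) : hypergraph p :=
  @Hypergraph p ('I_k + 'I_k * 'I_(p.-2))%type
    [seq tuple_of_seq p (inl t)
       [:: inl t, inl (ordS t) & [seq inr (t, s) | s <- enum 'I_(p.-2)]]
    | t <- enum 'I_k].

End Hypergraphs.

(** * Tensors *)

Section Tensors.
Variables (R : realType) (p N : nat).
Implicit Type T : p.-tuple 'I_N -> R.

Definition trace0 (g : hypergraph p) T : R :=
  \sum_(phi : {ffun hvert g -> 'I_N} | injectiveb phi)
    \prod_(e <- hedges g) T (map_tuple phi e).

Definition tildeA (M2 : R) T : 'M[R]_N :=
  \matrix_(a, b) ((Num.sqrt (M2 * (p.-2)`!%:R))^-1 *
    \sum_(j : (p.-2).-tuple 'I_N) T (tuple_of_seq p a [:: a, b & j])).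

End Tensors.

(** * Probability *)

Definition mutually_independent d (Om : measurableType d) (R : realType)
    (P : probability Om R) (I : finType) (A : {set I}) (X : I -> Om -> R) :=
  forall (J : {set I}) (B : I -> set R), J \subset A ->
    (forall i, i \in J -> measurable (B i)) ->
    P (\bigcap_(i in [set` J]) X i @^-1` B i) =
    (\prod_(i in J) fine (P (X i @^-1` B i)))%:E.

(* [normal_prob m 0] is by convention the uniform law on [0, 1], hence the
   separate treatment of degenerate Gaussian laws. *)
Definition gaussian_law (R : realType) (m s : R) (B : set R) : \bar R :=
  if s == 0 then dirac m B else normal_prob m s B.

Definition gaussian d (Om : measurableType d) (R : realType)
    (P : probability Om R) (X : Om -> R) :=
  measurable_fun setT X /\
  exists m s : R, forall B : set R, measurable B ->
    P (X @^-1` B) = gaussian_law m s B.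

Definition gaussian_process d (Om : measurableType d) (R : realType)
    (P : probability Om R) (I : Type) (z : I -> Om -> R) :=
  forall (n : nat) (i : 'I_n -> I) (c : 'I_n -> R),
    gaussian P (fun w => \sum_(j < n) c j * z (i j) w).

(* Convergence in law of every vector [(Z N i_1, ..., Z N i_n)]. *)
Definition fdd_cvg (R : realType) (d : nat -> measure_display)
    (Om : forall N, measurableType (d N)) (P : forall N, probability (Om N) R)
    d' (Om' : measurableType d') (Q : probability Om' R) (I : Type)
    (Z : forall N, I -> Om N -> R) (z : I -> Om' -> R) :=
  forall (n : nat) (i : 'I_n -> I) (f : 'rV[R]_n -> R),
    continuous f -> (exists C : R, forall x, `|f x| <= C) ->
    ('E_(P N)[fun w => f (\row_j Z N (i j) w)])%E @[N --> \oo] -->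
    ('E_Q[fun w => f (\row_j z (i j) w)])%E.

(** * Heavy-Wigner tensors *)

Section HeavyWigner.
Variables (R : realType) (p : nat).
Variables (d : nat -> measure_display) (Om : forall N, measurableType (d N)).
Variable P : forall N, probability (Om N) R.
Variable T : forall N, p.-tuple 'I_N -> {RV (P N) >-> R}.

Definition nondecreasing_indices (N : nat) : {set p.-tuple 'I_N} :=
  [set i : p.-tuple 'I_N | sorted leq (map val i)]%SET.

Record heavy_wigner (M : nat -> R) : Prop := HeavyWigner {
  hw_symmetric : forall N (s : 'S_p) (i : p.-tuple 'I_N) (w : Om N),
    T [tuple tnth i (s j) | j < p] w = T i w;
  hw_independent : forall N,
    mutually_independent (P N) (nondecreasing_indices N)
      (fun i => T i : Om N -> R);
  hw_identically_distributed : forall N (i j : p.-tuple 'I_N),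
    i \in nondecreasing_indices N -> j \in nondecreasing_indices N ->
    forall B : set R, measurable B ->
      distribution (P N) (T i) B = distribution (P N) (T j) B;
  hw_moments_finite : forall N (i : p.-tuple 'I_N) (k : nat),
    (P N).-integrable setT (fun w => ((T i w) ^+ k)%:E);
  hw_centered : forall N (i : p.-tuple 'I_N), ('E_(P N)[T i] = 0)%E;
  (* Dimension [N.+1] rather than [N], for index tuples to exist. *)
  hw_moments : forall (i : forall N, p.-tuple 'I_N.+1) (k : nat), (2 <= k)%N ->
    N.+1%:R ^+ (p.-1) * fine 'E_(P N.+1)[fun w => (T (i N) w) ^+ k]
      @[N --> \oo] --> M k
}.

Definition mean_trace0 (g : hypergraph p) (N : nat) : R :=
  fine 'E_(P N)[fun w => N%:R^-1 * trace0 g (fun i => T i w)].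

Definition limit_covariance (g1 g2 : hypergraph p) : R :=
  \sum_(sigma : vpartition (hvert (hunion g1 g2)) | edge_gluing sigma)
    lim (mean_trace0 (hquotient sigma) N @[N --> \oo]).

Definition cycle_covariance (M2 : R) (k1 k2 : nat) : R :=
  (((p.-2)`!%:R * M2) `^ ((k1 + k2)%:R / 2))^-1 *
  \sum_(pi1 : vpartition (hvert (hcycle p k1)))
    \sum_(pi2 : vpartition (hvert (hcycle p k2)))
      limit_covariance (hquotient pi1) (hquotient pi2).

Definition trace_power (M2 : R) (N k : nat) (w : Om N) : R :=
  \tr (tildeA M2 (fun i => T i w) ^+ k).

Definition trace_fluctuation (M2 : R) (N k : nat) (w : Om N) : R :=
  (Num.sqrt N%:R)^-1 *
  (trace_power M2 k w - fine 'E_(P N)[@trace_power M2 N k]).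

End HeavyWigner.

Definition posnat := {k : nat | (0 < k)%N}.

(* Main.v *)
Require Import Defs.
From HB Require Import structures.
From mathcomp Require Import all_boot all_order all_algebra all_fingroup.
From mathcomp Require Import all_classical all_reals all_analysis.
From mathcomp Require Import measurable_realfun ring lra zify.
Set Implicit Arguments.
Unset Strict Implicit.
Unset Printing Implicit Defensive.
Import Order.TTheory GRing.Theory Num.Theory.
Import numFieldNormedType.Exports.
Local Open Scope classical_set_scope.
Local Open Scope ring_scope.

(* Method of moments.  Let W be a linear combination of the fluctuations.  It is
   N^{-1/2} times a sum of centred monomials Y_a in the entries, indexed by maps
   from the vertices of a cycle to [N].  In E W^{m+2} - (m+1) E W^2 E W^m the
   (m+2)-tuples of monomials contribute
     E[Y_0 ... Y_{m+1}] - sum_{j > 0} E[Y_0 Y_j] E[prod of the others],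
   which by independence vanishes unless every monomial shares an edge with
   another one and the tuple does not pair up around the index 0.  Such tuples
   have 2 #vertices + 1 <= m + 2 + 2 (p-1) #edges, so that they contribute
   O(N^{-1/2}); hence all moments of W converge to those of a centred Gaussian
   variable.  In E W^2 only pairs of maps sharing an edge survive; sorting them
   by the partitions that they induce gives the sum over gluings.

   Moments control E cos(W + b) by Taylor expansion, and Bernstein polynomials in
   (1 + sin(x/L))/2 approximate a bounded continuous function on a cube by
   trigonometric polynomials obeying the same bound, so that convergence in law
   follows from the bounded second moments.

   The covariance kernel is positive as a limit of covariances.  Its Cholesky
   factor, applied to a sequence of independent normal variables built from the
   binary digits of a uniform number, is the limiting process. *)

(** * Means and independence *)

(** A monomial with E distinct edges has mean O(N^{-(p-1)E}) whatever the multiplicities, because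
    all moments of order at least two have the same size and the first one vanishes; hence the
    estimates only see sets of distinct edges. The tuples of monomials covering V vertices number
    O(N^V), so that with the factor N^{-(m+2)/2} the inequality between exponents is exactly what
    leaves N^{-1/2}. The relation E W^{m+2} = (m+1) E W^2 E W^m determines the moments of a centred
    Gaussian variable; singling out the partner of index 0 avoids any expansion over pair
    partitions. A trace is a sum over all vertex maps, so the bounds do not involve partitions;
    injective maps appear only when the limit of the covariances is identified. A limiting variance
    may be zero, hence degenerate combinations are kept throughout and receive a Dirac law at the
    end. Bounds on second moments stand in for tightness, and uniqueness of laws follows from the
    convergence statement applied to constant sequences. *)

Section Density.
Context d d' (Om : measurableType d) (T' : measurableType d') (R : realType).
Variables (mu : {measure set Om -> \bar R}) (nu : {measure set T' -> \bar R}).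
Variables (X : Om -> T') (Y : Om -> R).
Hypotheses (mX : measurable_fun setT X) (mY : measurable_fun setT Y).
Hypothesis Y_ge0 : forall w, 0 <= Y w.
Hypothesis nuE : forall B, measurable B ->
  (\int[mu]_w (\1_B (X w) * Y w)%:E = nu B)%E.

Import HBNNSimple.

Let density_nnsfun (f : {nnsfun T' >-> R}) :
  (\int[mu]_w ((f (X w) * Y w)%R)%:E = \int[nu]_x (f x)%:E)%E.
Proof.
have mi r : measurable_fun setT (fun w => \1_(f @^-1` [set r]) (X w) : R).
  by apply: (measurableT_comp _ mX); exact: measurable_indic.
transitivity (\int[mu]_w (\sum_(r \in range f)
    (r * (\1_(f @^-1` [set r]) (X w) * Y w))%:E))%E.
  apply: eq_integral => w _; rewrite fsumEFin//; congr (_%:E).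
  by rewrite {1}fimfunE mulr_fsuml; apply: eq_fsbigr => r _; rewrite mulrA.
have pos r w : (0 <= (r * (\1_(f @^-1` [set r]) (X w) * Y w))%:E)%E.
  rewrite lee_fin mulrA mulr_ge0//; have := nnfun_muleindic_ge0 f r (X w).
  by rewrite -EFinM lee_fin.
rewrite ge0_integral_fsum//; last first.
  by move=> r; apply/measurable_EFinP; do 2!apply: measurable_funM => //.
under [RHS]eq_integral do rewrite fimfunE -fsumEFin//.
rewrite [RHS]ge0_integral_fsum//; last 2 first.
  - by move=> r; exact/measurable_EFinP/measurableT_comp.
  - by move=> n x _; rewrite EFinM nnfun_muleindic_ge0.
apply: eq_fsbigr => r /set_mem [x _ <-].
have fx : (0 <= f x) by [].
under eq_integral do rewrite EFinM.
rewrite ge0_integralZl//; last 2 first.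
- by apply/measurable_EFinP; apply: measurable_funM => //; exact: mi.
- by move=> w _; rewrite lee_fin mulr_ge0.
rewrite nuE//; under [RHS]eq_integral do rewrite EFinM.
by rewrite integralZl_indic_nnsfun//= integral_indic// setIT.
Qed.

(** Simple functions and monotone convergence extend [nuE] from indicators to non-negative
    functions. It serves twice: to factor one variable out of a product of independent ones, [nu]
    being a multiple of its law, and to pass from a normal law to Lebesgue measure, [X] being the
    identity and [Y] the density. *)
Lemma ge0_integral_density (h : T' -> R) : measurable_fun setT h ->
  (forall x, 0 <= h x) ->
  (\int[mu]_w ((h (X w) * Y w)%R)%:E = \int[nu]_x (h x)%:E)%E.
Proof.
move=> mh h0; have mh' := (measurable_EFinP _ _).2 mh.
pose f_ := nnsfun_approx measurableT mh'.
have cf x : ((f_ n x)%:E @[n --> \oo] --> (h x)%:E)%E.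
  by apply: (cvg_nnsfun_approx measurableT mh') => // y; rewrite lee_fin.
transitivity (lim (\int[mu]_w (f_ n (X w) * Y w)%:E @[n --> \oo])%E).
  rewrite -monotone_convergence//=.
  - apply: eq_integral => w _; apply/esym/cvg_lim => //=.
    under eq_fun do rewrite EFinM.
    by rewrite EFinM; apply: cvgeZr => //; exact: cf.
  - move=> n; apply/measurable_EFinP; apply: measurable_funM => //.
    exact: measurableT_comp.
  - by move=> n w _; rewrite lee_fin mulr_ge0.
  - move=> w _ m n mn; rewrite lee_fin ler_wpM2r//.
    exact/lefP/nd_nnsfun_approx.
transitivity (lim (\int[nu]_x (f_ n x)%:E @[n --> \oo])%E).
  by apply: congr_lim; apply/funext => n /=; rewrite density_nnsfun.
rewrite -monotone_convergence//=.
- by apply: eq_integral => x _; apply/cvg_lim => //; exact: cf.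
- by move=> n; exact/measurable_EFinP/measurable_funTS.
- by move=> n ? _; rewrite lee_fin.
- by move=> ? _ ? ? mn; rewrite lee_fin; exact/lefP/nd_nnsfun_approx.
Qed.

End Density.

Definition integr d (Om : measurableType d) (R : realType)
  (P : probability Om R) (F : Om -> R) := P.-integrable setT (EFin \o F).

Definition mean d (Om : measurableType d) (R : realType)
  (P : probability Om R) (F : Om -> R) : R := fine (\int[P]_w (F w)%:E)%E.

Section Mean.
Context d (Om : measurableType d) (R : realType) (P : probability Om R).
Implicit Types F G : Om -> R.
Local Notation integr := (integr P).
Local Notation mean := (mean P).

Lemma mean_expectation F : fine ('E_P[F])%E = mean F.
Proof. by rewrite unlock. Qed.

Lemma meanE F : integr F -> (\int[P]_w (F w)%:E)%E = (mean F)%:E.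
Proof. by move=> iF; rewrite /mean fineK//; exact: integrable_fin_num. Qed.

Lemma expectation_mean F : integr F -> ('E_P[F] = (mean F)%:E)%E.
Proof. by move=> iF; rewrite unlock meanE. Qed.

Lemma integr_measurable F : integr F -> measurable_fun setT F.
Proof. by move=> /measurable_int/measurable_EFinP. Qed.

Lemma integr_cst c : integr (fun=> c).
Proof. exact: finite_measure_integrable_cst. Qed.

Lemma integrD F G : integr F -> integr G -> integr (fun w => F w + G w).
Proof. by move=> iF iG; have := integrableD measurableT iF iG. Qed.

Lemma integrZ c F : integr F -> integr (fun w => c * F w).
Proof. by move=> iF; have := integrableZl measurableT c iF. Qed.

Lemma integrB F G : integr F -> integr G -> integr (fun w => F w - G w).
Proof. by move=> iF iG; have := integrableB measurableT iF iG. Qed.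

Lemma integr_norm F : integr F -> integr (fun w => `|F w|).
Proof. by move=> iF; have := integrable_norm iF. Qed.

Lemma integr_sum (I : Type) (s : seq I) (Q : pred I) (F : I -> Om -> R) :
  (forall i, Q i -> integr (F i)) -> integr (fun w => \sum_(i <- s | Q i) F i w).
Proof.
move=> iF; elim: s => [|i s IHs].
  apply: eq_integrable (integr_cst 0) => // w _ /=; by rewrite big_nil.
case: (boolP (Q i)) => Qi; last first.
  by apply: eq_integrable IHs => // w _ /=; rewrite big_cons (negbTE Qi).
apply: eq_integrable (integrD (iF _ Qi) IHs) => // w _ /=.
by rewrite big_cons Qi.
Qed.

Lemma mean_cst c : mean (fun=> c) = c.
Proof. by rewrite /mean integral_cst//= probability_setT mule1. Qed.

Lemma meanD F G : integr F -> integr G ->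
  mean (fun w => F w + G w) = mean F + mean G.
Proof. by move=> iF iG; rewrite /mean -RintegralD. Qed.

Lemma meanZ c F : integr F -> mean (fun w => c * F w) = c * mean F.
Proof. by move=> iF; rewrite /mean -RintegralZl. Qed.

Lemma meanB F G : integr F -> integr G ->
  mean (fun w => F w - G w) = mean F - mean G.
Proof. by move=> iF iG; rewrite /mean -RintegralB. Qed.

Lemma mean_sum (I : Type) (s : seq I) (Q : pred I) (F : I -> Om -> R) :
  (forall i, Q i -> integr (F i)) ->
  mean (fun w => \sum_(i <- s | Q i) F i w) = \sum_(i <- s | Q i) mean (F i).
Proof.
move=> iF; elim: s => [|i s IHs].
  by rewrite big_nil -[RHS](mean_cst 0); congr mean; apply/funext => w; rewrite big_nil.
under [in LHS]eq_fun do rewrite big_cons; rewrite big_cons.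
case: (boolP (Q i)) => Qi //.
by rewrite meanD ?IHs//; [exact: iF|exact: integr_sum].
Qed.

Lemma le_mean F G : integr F -> integr G -> (forall w, F w <= G w) ->
  mean F <= mean G.
Proof. by move=> iF iG FG; apply: le_Rintegral. Qed.

Lemma mean_ge0 F : (forall w, 0 <= F w) -> 0 <= mean F.
Proof. by move=> F0; apply: Rintegral_ge0. Qed.

Lemma le_norm_mean F : integr F -> `|mean F| <= mean (fun w => `|F w|).
Proof. by move=> iF; apply: le_normr_Rintegral. Qed.

Lemma le_integr F G : measurable_fun setT F -> integr G ->
  (forall w, `|F w| <= `|G w|) -> integr F.
Proof.
move=> mF iG FG; apply: le_integrable iG => //; first exact/measurable_EFinP.
by move=> w _; rewrite /= lee_fin.
Qed.

Lemma integr_bounded F C : measurable_fun setT F ->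
  (forall w, `|F w| <= C) -> integr F.
Proof.
move=> mF FC; apply: (le_integr mF (integr_cst C)) => w.
by rewrite (le_trans (FC w))// ler_norm.
Qed.

Lemma mean_indic (A : set Om) : measurable A -> mean (\1_A) = fine (P A).
Proof. by move=> mA; rewrite /mean integral_indic// setIT. Qed.

End Mean.

Section Independence.
Context d (Om : measurableType d) (R : realType) (P : probability Om R).
Variables (I : finType) (A : {set I}) (X : I -> {RV P >-> R}).
Hypothesis indX : mutually_independent P A (fun i => X i : Om -> R).

Let measurable_prodX (Q : pred I) (h : I -> R -> R) :
  (forall i, measurable_fun setT (h i)) ->
  measurable_fun setT (fun w => \prod_(i | Q i) h i (X i w)).
Proof.
move=> mh; move: (index_enum _) => r; elim: r => [|i s IHs].
  rewrite (_ : (fun w => _) = cst 1); first exact: measurable_cst.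
  by apply/funext => w; rewrite big_nil.
under eq_fun do rewrite big_cons.
by case: (Q i) => //; apply: measurable_funM => //; exact: measurableT_comp.
Qed.

(** Induction on the list [s] of indices whose factor is not yet an indicator. For empty [s] this is
    the independence hypothesis; each further index is released by [ge0_integral_density]. *)
Let nonneg_prod (s : seq I) (h : I -> R -> R) :
  (forall i, measurable_fun setT (h i)) -> (forall i x, 0 <= h i x) ->
  (forall i, integr P (fun w => h i (X i w))) ->
  (forall i, i \in A -> i \notin s -> exists2 B, measurable B & h i = \1_B) ->
  (\int[P]_w (\prod_(i in A) h i (X i w))%:E =
   (\prod_(i in A) mean P (fun w => h i (X i w)))%:E)%E.
Proof.
elim: s h => [|j s IHs] h mh h0 ih hB.
  have /choice [B BP] i : exists B : set R,
      measurable B /\ (i \in A -> h i = \1_B).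
    case: (boolP (i \in A)) => iA; last by exists setT.
    by have [B mB ->] := hB i iA isT; exists B.
  have mXB i : measurable (X i @^-1` B i).
    by rewrite -[Y in measurable Y]setTI; apply: measurable_funPT => //; apply: (BP i).1.
  transitivity (\int[P]_w (\1_(\bigcap_(i in [set` A]) X i @^-1` B i) w : R)%:E)%E.
    apply: eq_integral => w _; congr (_%:E).
    rewrite [RHS]indicE; have [wB|] := boolP (w \in _).
      rewrite big1// => i iA; rewrite (BP i).2// indicE mem_set//.
      exact: (set_mem wB).
    rewrite notin_setE => wB.
    have [i iA wBi] : exists2 i, i \in A & ~ B i (X i w).
      apply: contrapT => h'; apply: wB => i iA /=.
      by apply: contrapT => h''; apply: h'; exists i.
    by rewrite (bigD1 i)//= (BP i).2// indicE memNset// mul0r.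
  rewrite integral_indic ?setIT//; last first.
    by apply: fin_bigcap_measurable => // i _; exact: mXB.
  apply: (etrans (indX (subxx A) (fun i _ => (BP i).1))).
  congr (_%:E); apply: eq_bigr => i iA; rewrite -mean_indic//.
  by congr mean; apply/funext => w; rewrite (BP i).2// !indicE.
case: (boolP (j \in A)) => jA; last first.
  apply: IHs => // i iA is'; apply: hB => //; rewrite inE negb_or is' andbT.
  by apply: contra jA => /eqP <-.
pose Y w := \prod_(i in A | i != j) h i (X i w).
pose c := \prod_(i in A | i != j) mean P (fun w => h i (X i w)).
have c0 : 0 <= c by apply: prodr_ge0 => i _; apply: mean_ge0 => w; exact: h0.
(* The image under [X j] of the measure with density [Y] should be [c] times the law of [X j].
   Testing this on a set [B] means replacing [h j] by [\1_B], a case covered by the induction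
   hypothesis. *)
pose nu := mscale (NngNum c0) (distribution P (X j)).
transitivity (\int[P]_w ((h j (X j w) * Y w)%R)%:E)%E.
  by apply: eq_integral => w _; rewrite (bigD1 j).
rewrite (@ge0_integral_density _ _ _ _ _ P nu)//.
- rewrite ge0_integral_mscale//; last by move=> x _; rewrite lee_fin.
  rewrite ge0_integral_distribution; last 2 first.
  - exact/measurable_EFinP.
  - by move=> y; rewrite lee_fin.
  by rewrite (meanE (ih j)) (bigD1 j)//= -EFinM mulrC.
- exact/measurable_EFinP.
- exact: (measurable_prodX (fun i => (i \in A) && (i != j)) mh).
- by move=> w; apply: prodr_ge0 => i _; exact: h0.
move=> B mB.
pose h' i := if i == j then \1_B else h i.
have h'E w : \prod_(i in A) h' i (X i w) = \1_B (X j w) * Y w.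
  rewrite (bigD1 j)//= /h' eqxx; congr (_ * _).
  by apply: eq_bigr => i /andP[_ /negbTE ->].
under eq_integral do rewrite -h'E.
rewrite IHs.
- rewrite (bigD1 j)//= {1}/h' eqxx /nu /mscale/= muleC -/c.
  rewrite (_ : \prod_(i in A | i != j) _ = c); last first.
    by apply: eq_bigr => i /andP[_ /negbTE ij]; rewrite /h' ij.
  rewrite EFinM; congr (_ * _)%E.
  rewrite (_ : mean P _ = mean P (\1_(X j @^-1` B))); last first.
    by congr mean; apply/funext => w; rewrite !indicE.
  have mXB : measurable (X j @^-1` B).
    by rewrite -[Z in measurable Z]setTI; exact: measurable_funPT.
  by rewrite mean_indic// fineK// fin_num_measure.
- by move=> i; rewrite /h'; case: ifP => // _; exact: measurable_indic.
- by move=> i x; rewrite /h'; case: ifP => // _; rewrite indicE.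
- move=> i; rewrite /h'; case: ifP => // _.
  apply: (@integr_bounded _ _ _ _ _ 1).
    have mB1 : measurable_fun setT (\1_B : R -> R) by exact: measurable_indic.
    exact: (measurableT_comp mB1).
  by move=> w; rewrite indicE; case: (_ \in _); rewrite ?normr1 ?normr0.
- move=> i iA is'; rewrite /h'; case: eqP => [_|/eqP ij]; first by exists B.
  by apply: hB => //; rewrite inE negb_or ij.
Qed.

Lemma independent_mean_prod (h : I -> R -> R) :
  (forall i, measurable_fun setT (h i)) ->
  (forall i, integr P (fun w => h i (X i w))) ->
  integr P (fun w => \prod_(i in A) h i (X i w)) /\
  mean P (fun w => \prod_(i in A) h i (X i w)) =
  \prod_(i in A) mean P (fun w => h i (X i w)).
Proof.
move=> mh ih; have intgr h' : (forall i, measurable_fun setT (h' i)) ->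
    (forall i, integr P (fun w => h' i (X i w))) ->
    integr P (fun w => \prod_(i in A) h' i (X i w)).
  move=> mh' ih'; apply/integrableP; split.
    by apply/measurable_EFinP; exact: measurable_prodX.
  rewrite (eq_integral (fun w => (\prod_(i in A) `|h' i (X i w)|)%:E)); last first.
    by move=> w _; rewrite /= normr_prod.
  rewrite (@nonneg_prod (enum I) (fun i x => `|h' i x|)) ?ltry//.
  - by move=> i; apply: measurableT_comp.
  - by move=> i; exact: integr_norm.
  - by move=> i _; rewrite mem_enum.
split; first exact: intgr.
(* [s] lists the indices whose factor may change sign; each is removed by splitting its factor into
   positive and negative parts, the product being linear in every factor. *)
suff main (s : seq I) : forall h, (forall i, measurable_fun setT (h i)) ->
    (forall i, integr P (fun w => h i (X i w))) ->
    (forall i, i \notin s -> forall x, 0 <= h i x) ->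
    mean P (fun w => \prod_(i in A) h i (X i w)) =
    \prod_(i in A) mean P (fun w => h i (X i w)).
  by apply: (main (enum I)) => // i; rewrite mem_enum.
elim: s {h mh ih} => [|j s IHs] h mh ih h0.
  rewrite /mean (nonneg_prod (s := enum I))//=; first by move=> i x; exact: h0.
  by move=> i _; rewrite mem_enum.
case: (boolP (j \in A)) => jA; last first.
  (* Factors outside [A] do not enter the product; setting them to 0 provides the sign condition at
     [j], which leaves the list. *)
  pose h' i := if i \in A then h i else cst 0.
  have eh w : \prod_(i in A) h i (X i w) = \prod_(i in A) h' i (X i w).
    by apply: eq_bigr => i; rewrite /h' => ->.
  under eq_fun do rewrite eh; rewrite IHs.
  - by apply: eq_bigr => i; rewrite /h' => ->.
  - by move=> i; rewrite /h'; case: ifP.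
  - by move=> i; rewrite /h'; case: ifP => // _; exact: integr_cst.
  - move=> i is' x; rewrite /h'; case: ifP => // iA; apply: h0.
    by rewrite inE negb_or is' andbT; apply: contraTneq iA => ->.
pose hs (g : R -> R) i := if i == j then g else h i.
have hsE g w : \prod_(i in A) hs g i (X i w) =
    g (X j w) * \prod_(i in A | i != j) h i (X i w).
  rewrite (bigD1 j)//= /hs eqxx; congr (_ * _).
  by apply: eq_bigr => i /andP[_ /negbTE ->].
have step g : measurable_fun setT g -> integr P (fun w => g (X j w)) ->
    (forall x, 0 <= g x) ->
    integr P (fun w => g (X j w) * \prod_(i in A | i != j) h i (X i w)) /\
    mean P (fun w => g (X j w) * \prod_(i in A | i != j) h i (X i w)) =
    mean P (fun w => g (X j w)) *
    \prod_(i in A | i != j) mean P (fun w => h i (X i w)).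
  move=> mg ig g0; under eq_fun do rewrite -hsE.
  have mhs i : measurable_fun setT (hs g i) by rewrite /hs; case: ifP.
  have ihs i : integr P (fun w => hs g i (X i w)) by rewrite /hs; case: ifP => // /eqP ->.
  split; first exact: intgr.
  rewrite IHs//.
    rewrite (bigD1 j)//= /hs eqxx; congr (_ * _).
    by apply: eq_bigr => i /andP[_ /negbTE ->].
  move=> i is' x; rewrite /hs; case: eqP => // /eqP ij; apply: h0.
  by rewrite inE negb_or ij.
have mp : measurable_fun setT (h j)^\+ by exact: measurable_funrpos.
have mn : measurable_fun setT (h j)^\- by exact: measurable_funrneg.
have le_pos x : `|(h j)^\+ x| <= `|h j x|.
  by rewrite ger0_norm// /funrpos ge_max ler_norm normr_ge0.
have le_neg x : `|(h j)^\- x| <= `|h j x|.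
  by rewrite ger0_norm// /funrneg ge_max -normrN ler_norm normr_ge0.
have ip : integr P (fun w => (h j)^\+ (X j w)).
  apply: (le_integr _ (ih j)) => [|w]; last exact: le_pos.
  exact: measurableT_comp.
have iN : integr P (fun w => (h j)^\- (X j w)).
  apply: (le_integr _ (ih j)) => [|w]; last exact: le_neg.
  exact: measurableT_comp.
have [iP eP] := step _ mp ip (funrpos_ge0 _).
have [iN' eN] := step _ mn iN (funrneg_ge0 _).
have hE x : h j x = (h j)^\+ x - (h j)^\- x
  by rewrite /funrpos /funrneg /= !maxEle; case: leP => ?; case: leP => ?; lra.
rewrite (_ : (fun w => _) = fun w =>
   (h j)^\+ (X j w) * \prod_(i in A | i != j) h i (X i w) -
   (h j)^\- (X j w) * \prod_(i in A | i != j) h i (X i w)); last first.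
  by apply/funext => w; rewrite -mulrBl -hE (bigD1 j).
rewrite (meanB iP iN') eP eN -mulrBl -(meanB ip iN) [RHS](bigD1 j)//=.
by congr (_ * _); congr mean; apply/funext => w; rewrite -hE.
Qed.

End Independence.

(** * Clusters of overlapping monomials *)

Section Clusters.
Import mathcomp.boot.finset.
Local Close Scope classical_set_scope.
Local Open Scope set_scope.
Variables (R : numDomainType) (D : finType) (vtx : {set D} -> nat) (r m : nat).
Variables (e : 'I_m.+2 -> {set D}) (v : {set 'I_m.+2} -> R).

Let ES (S : {set 'I_m.+2}) := \bigcup_(i in S) e i.

Hypothesis vtx0 : vtx set0 = 0%N.
Hypothesis vtx_step : forall (E : {set D}) i, (vtx (E :|: e i) + r * #|E| <= vtx E + r * #|E :|: e i| + 1)%N.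
Hypothesis vtx_meet : forall (E : {set D}) i, ~~ [disjoint E & e i] ->
  (vtx (E :|: e i) + r * #|E| <= vtx E + r * #|E :|: e i|)%N.
Hypothesis v1 : forall i, v [set i] = 0.
Hypothesis vM : forall S1 S2 : {set _}, [disjoint S1 & S2] -> [disjoint ES S1 & ES S2] ->
  v (S1 :|: S2) = v S1 * v S2.

(* A set [S] of indices can be enlarged by an index meeting its edges, or by two
   indices meeting each other: [vtx - r #|edges|] grows by at most one for a new
   index, and not at all when its edges meet the old ones, so that [good] is
   preserved.  The induction starts from a connected triple of indices. *)
Let good (S : {set _}) := (2 * vtx (ES S) + 1 <= #|S| + 2 * (r * #|ES S|))%N.

Let ESU1 (S : {set _}) i : ES (i |: S) = ES S :|: e i.
Proof.
have [iS|iS] := boolP (i \in S); last by rewrite /ES big_setU1//= setUC.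
by rewrite (setUidPr _) ?sub1set// (setUidPl _)//; apply: bigcup_sup.
Qed.

Let disjES (S1 S2 : {set _}) : reflect (forall i j, i \in S1 -> j \in S2 -> [disjoint e i & e j])
  [disjoint ES S1 & ES S2].
Proof.
apply: (iffP idP) => [dis i j iS jS|dis].
  apply: disjointWl (_ : _ \subset ES S1) _; first exact: bigcup_sup.
  by apply: disjointWr dis; exact: bigcup_sup.
apply/bigcup_disjointP => j jS; rewrite disjoint_sym.
by apply/bigcup_disjointP => i iS; rewrite disjoint_sym; exact: dis.
Qed.

Let grow_total (S : {set _}) : (forall i, exists2 j, j != i & ~~ [disjoint e i & e j]) ->
  good S -> (2 * vtx (\bigcup_i e i) + 1 <= m.+2 + 2 * (r * #|\bigcup_i e i|))%N.
Proof.
move=> noniso; have [k] := ubnP #|~: S|; elim: k S => // k IHk S ltk gS.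
have [ST|] := eqVneq S setT.
  move: gS; rewrite /good ST cardsT card_ord.
  by rewrite (_ : ES setT = \bigcup_i e i)//; apply: eq_bigl => i; rewrite inE.
rewrite -subTset => /subsetPn [i _ iS].
have cU (S' : {set 'I_m.+2}) x : x \notin S' -> (#|~: (x |: S')| < #|~: S'|)%N.
  by move=> xS'; rewrite proper_card// properC properUr// sub1set.
have gU x (S' : {set 'I_m.+2}) : x \notin S' -> #|x |: S'| = #|S'|.+1 by move=> H; rewrite cardsU1 H.
have [si|si] := boolP [disjoint ES S & e i]; last first.
  apply: (IHk (i |: S)); first by have := cU _ _ iS; lia.
  have := vtx_meet si; move: gS; rewrite /good ESU1 gU//; lia.
have [j ji eij] := noniso i.
have jS : j \notin S.
  apply: contra eij => jS; rewrite disjoint_sym; apply: disjointWl si.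
  exact: bigcup_sup.
have jiS : j \notin i |: S by rewrite !inE negb_or ji.
apply: (IHk (j |: (i |: S))).
  by apply: (leq_trans (cU _ _ jiS)); apply: (leq_trans (ltnW (cU _ _ iS))).
have eij' : ~~ [disjoint ES (i |: S) & e j].
  by apply: contra eij; rewrite ESU1; apply: disjointWl; exact: subsetUr.
have := vtx_meet eij'; have := vtx_step (ES S) i.
move: gS; rewrite /good !ESU1 gU// gU//; lia.
Qed.

Let ES1 i : ES [set i] = e i.
Proof. by rewrite /ES big_set1. Qed.

Let v2_disjoint i j : i != j -> [disjoint e i & e j] -> v [set i; j] = 0.
Proof.
move=> ij dij; rewrite vM ?v1 ?mul0r//.
  by rewrite disjoints1 inE.
by rewrite !ES1.
Qed.

(** If some index meets no other, [v1] and [vM] kill every term. Otherwise index 0 meets some [j1].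
    When this pair is disjoint from all the rest, [v setT] factors and cancels the term of [j1], and
    the other terms vanish because index 0 meets only [j1]. When it is not, some [k] meets the pair,
    and this triple starts the growth argument. *)
Lemma cluster_disc :
  v setT - \sum_(j | j != ord0) v [set ord0; j] * v (~: [set ord0; j]) = 0 \/
  (2 * vtx (\bigcup_i e i) + 1 <= m.+2 + 2 * (r * #|\bigcup_i e i|))%N.
Proof.
have [/existsP[i /forallP iso]|] := boolP [exists i, forall j, (j != i) ==> [disjoint e i & e j]].
  left.
  have isoS (S : {set 'I_m.+2}) : i \in S -> v S = 0.
    move=> iS; rewrite -(setD1K iS) vM ?v1 ?mul0r//.
      by rewrite disjoints1 !inE eqxx.
    apply/disjES => x j; rewrite !inE => /eqP -> /andP[ji _].
    by have := iso j; rewrite ji.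
  rewrite isoS ?inE// sub0r big1 ?oppr0// => j j0.
  have [iS|iS] := boolP (i \in [set ord0; j]); first by rewrite isoS ?mul0r.
  by rewrite [X in _ * X]isoS ?mulr0// inE.
rewrite negb_exists => /forallP noniso'.
have noniso i : exists2 j, j != i & ~~ [disjoint e i & e j].
  have := noniso' i; rewrite negb_forall => /existsP[j]; rewrite negb_imply.
  by move=> /andP[]; exists j.
have [j1 j10 e0j1] := noniso ord0.
set S0 := [set ord0; j1].
have [dis|] := boolP [disjoint ES S0 & ES (~: S0)].
  left; rewrite -(setUCr S0) vM//; last by rewrite disjoints_subset setCK.
  rewrite (bigD1 j1)//= big1 ?addr0 ?subrr// => j /andP[j0 jj1].
  rewrite v2_disjoint ?mul0r 1?eq_sym//.
  by move/disjES: dis; apply; rewrite !inE ?eqxx// negb_or j0.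
rewrite disjoint_sym => H; right.
have [k kS0 ek] : exists2 k, k \in ~: S0 & ~~ [disjoint ES S0 & e k].
  apply/exists_inP; apply: contraR H; rewrite negb_exists_in.
  move=> /forall_inP H; rewrite disjoint_sym; apply/bigcup_disjointP => i iS.
  by have := H i iS; rewrite negbK.
apply: (grow_total (S := k |: S0)) => //.
(* Index 0 costs one and the two others nothing, so [vtx] exceeds [r] times the number of edges by
   at most one, and 2 + 1 is the size of the triple. A pair alone would miss the bound by one. *)
rewrite /good ESU1 cardsU1 -in_setC kS0 /S0 cards2 eq_sym j10.
have := vtx_meet ek.
have E0 : ES S0 = e ord0 :|: e j1 by rewrite /S0 setUC ESU1 ES1.
have := vtx_meet e0j1; have := vtx_step set0 ord0.
by rewrite set0U vtx0 cards0 -E0 -/S0; lia.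
Qed.

End Clusters.

(** * Counting tuples, weighted by the number of points they cover *)

Section Counting.
Import mathcomp.boot.finset.
Local Close Scope classical_set_scope.
Local Open Scope set_scope.
Variables (R : realFieldType) (X : finType) (h : R).
Hypothesis h_ge0 : 0 <= h.

Lemma sum_tuple_cons (V : nmodType) (A : finType) k (F : k.+1.-tuple A -> V) :
  (\sum_(t : k.+1.-tuple A) F t =
   \sum_(a : A) \sum_(t : k.-tuple A) F [tuple of a :: t])%R.
Proof.
rewrite pair_big /=.
rewrite (reindex (fun x : A * k.-tuple A => [tuple of x.1 :: x.2])) //=.
exists (fun t : k.+1.-tuple A => (thead t, [tuple of behead t])) => [[a t] _|t _] /=.
  by rewrite theadE; congr pair; apply: val_inj.
by rewrite -tuple_eta.
Qed.

(** Summing over one more index costs a factor [c] of the number of points already covered. That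
    number stays below [#|U| + k * L], and monotonicity of [c] gives one constant for all steps. *)
Lemma sum_tuple_cover (A : finType) (vs : A -> {set X}) (L : nat) (c : nat -> R)
    (k : nat) (U : {set X}) :
  (forall a, #|vs a| <= L)%N -> {homo c : i j / (i <= j)%N >-> i <= j} ->
  (forall i, 0 <= c i) ->
  (forall V : {set X}, \sum_a h ^+ #|V :|: vs a| <= c #|V| * h ^+ #|V|) ->
  \sum_(t : k.-tuple A) h ^+ #|U :|: \bigcup_(a <- t) vs a| <=
    c (#|U| + k * L)%N ^+ k * h ^+ #|U|.
Proof.
move=> vsL c_mono c_ge0 step; elim: k U => [|k IHk] U.
  rewrite (big_pred1 [tuple]) => [|t]; last by apply/esym/eqP; rewrite [t]tuple0.
  by rewrite /= big_nil setU0 mul1r.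
rewrite sum_tuple_cons.
apply: (@le_trans _ _ (\sum_a c (#|U| + k.+1 * L)%N ^+ k * h ^+ #|U :|: vs a|)).
  apply: ler_sum => a _.
  under eq_bigr do rewrite /= big_cons setUA.
  apply: (le_trans (IHk _)); apply: ler_wpM2r; first exact: exprn_ge0.
  apply: lerXn2r; rewrite ?nnegrE//; apply: c_mono.
  by rewrite mulSn addnA leq_add2r (leq_trans (leq_card_setU _ _))// leq_add2l.
rewrite -mulr_sumr exprSr -mulrA; apply: ler_wpM2l; first exact: exprn_ge0.
apply: (le_trans (step U)); apply: ler_wpM2r; first exact: exprn_ge0.
by apply: c_mono; rewrite leq_addr.
Qed.

(** The [#|U|] points of [U] leave the weight unchanged; a point outside gains a factor [h], which
    compensates for the at most [#|X|] choices. *)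
Lemma sum_point_cover (U : {set X}) : h = #|X|%:R^-1 -> (0 < #|X|)%N ->
  \sum_(x : X) h ^+ #|U :|: [set x]| <= (#|U|%:R + 1) * h ^+ #|U|.
Proof.
move=> hE X_gt0; rewrite (bigID (mem U)) /= mulrDl mul1r lerD//.
  rewrite (eq_bigr (fun=> h ^+ #|U|)) => [|x xU]; last first.
    by rewrite (setUidPl _)// sub1set.
  by rewrite sumr_const mulr_natl.
rewrite (eq_bigr (fun=> h ^+ #|U|.+1)) => [|x xU]; last first.
  by rewrite setUC cardsU1 xU.
rewrite sumr_const exprS -mulrnAl ler_piMl ?exprn_ge0//.
rewrite -mulr_natr hE ler_pdivrMl ?ltr0n// mulr1 ler_nat.
exact: max_card.
Qed.

Lemma sum_ffun_cover (W : finType) (U : {set X}) : h = #|X|%:R^-1 -> (0 < #|X|)%N ->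
  \sum_(phi : {ffun W -> X}) h ^+ #|U :|: [set phi w | w in W]| <=
  (#|U| + #|W|).+1%:R ^+ #|W| * h ^+ #|U|.
Proof.
move=> hE X_gt0.
have := @sum_tuple_cover X (fun x => [set x]) 1 (fun i => i.+1%:R) #|W| U.
rewrite muln1 => H; apply: le_trans (H _ _ _ _) => {H}.
- rewrite le_eqVlt; apply/orP; left; apply/eqP.
  rewrite [RHS](reindex (fun phi : {ffun W -> X} => fgraph phi))/=; last first.
    exists (fun t => Finfun t) => t _; first exact: fgraphK.
    by rewrite FinfunK.
  apply: eq_bigr => phi _; congr (_ ^+ #|U :|: _|).
  apply/setP => x; rewrite bigcup_seq; apply/imsetP/bigcupP.
    by move=> [w _ ->]; exists (phi w); rewrite ?inE//; exact: codom_f.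
  by move=> [y /codomP[w ->]]; rewrite inE => /eqP ->; exists w.
- by move=> x; rewrite cards1.
- by move=> i j ij; rewrite ler_nat.
- by move=> i.
- by move=> V; rewrite -natr1; exact: sum_point_cover.
Qed.

End Counting.

(** * Centred monomials in the entries *)

Section Representative.
Variables (p N : nat).
Implicit Types i j : p.-tuple 'I_N.

(** Independence is assumed for nondecreasing indices only; by symmetry of the tensor an entry may
    be moved to the sorted tuple of its index. *)
Definition rep i : p.-tuple 'I_N :=
  [tuple of sort (fun a b : 'I_N => (val a <= val b)%N) i].

Lemma rep_perm i : perm_eq (rep i) i.
Proof. by rewrite /rep /= perm_sort. Qed.

Lemma rep_nondecreasing i : rep i \in nondecreasing_indices p N.
Proof.
by rewrite !inE sorted_map sort_sorted// => a b; exact: leq_total.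
Qed.

Lemma rep_eq i j : (rep i == rep j) = perm_eq i j.
Proof.
apply/eqP/idP => [ij|].
  by rewrite -(perm_sort (fun a b : 'I_N => (val a <= val b)%N)) -[sort _ i]/(tval (rep i)) ij rep_perm.
move=> /perm_sortP H; apply: val_inj; rewrite /rep /=; apply: H.
- by move=> a b; exact: leq_total.
- by move=> a b c; exact: leq_trans.
- by move=> a b /anti_leq; exact: val_inj.
Qed.

(** Multiplicities are forgotten: the bounds on means depend on the number of distinct edges
    only. *)
Definition edge_set (s : seq (p.-tuple 'I_N)) : {set p.-tuple 'I_N} :=
  [set e in map rep s]%SET.

Lemma edge_set_cat s1 s2 :
  edge_set (s1 ++ s2) = (edge_set s1 :|: edge_set s2)%SET.
Proof. by apply/setP => e; rewrite !inE map_cat mem_cat. Qed.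

Lemma card_edge_set s : (#|edge_set s| <= size s)%N.
Proof. by rewrite cardsE (leq_trans (card_size _))// size_map. Qed.

End Representative.

Section Monomials.
Variables (R : realType) (p : nat).
Variables (d : nat -> measure_display) (Om : forall N, measurableType (d N)).
Variable P : forall N, probability (Om N) R.
Variable T : forall N, p.-tuple 'I_N -> {RV (P N) >-> R}.
Variable M : nat -> R.
Hypothesis hT : heavy_wigner T M.

(** Any nondecreasing index would do, the entries being identically distributed. The dimension is
    [N.+1] so that an index exists. *)
Definition moment N k :=
  mean (P N.+1) (fun w => T [tuple ord0 | _ < p] w ^+ k).

Section FixedDimension.
Local Close Scope classical_set_scope.
Variable N : nat.
Local Notation D := (p.-tuple 'I_N.+1).
Local Notation EE := (mean (P N.+1)).

Definition monomial (s : seq D) (w : Om N.+1) := \prod_(i <- s) T i w.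

Lemma T_rep (i : D) w : T (rep i) w = T i w.
Proof.
have /tuple_permP[s sE] := rep_perm i.
by rewrite -(hw_symmetric hT s i); congr (T _ w); apply: val_inj; exact: sE.
Qed.

Lemma mean_power (e : D) k : e \in nondecreasing_indices p N.+1 ->
  EE (fun w => T e w ^+ k) = moment N k.
Proof.
move=> nde; have mX : measurable_fun setT (fun x : R => (x ^+ k)%:E).
  by apply/measurable_EFinP; exact: measurable_funX.
have nd0 : [tuple ord0 | _ < p] \in nondecreasing_indices p N.+1.
  rewrite inE (_ : map val _ = nseq p 0%N).
    by have H n : sorted leq (nseq n 0%N) by elim: n => // -[|n] //= ->.
  apply: (@eq_from_nth _ 0%N) => [|i]; rewrite size_map size_tuple ?size_nseq// => ip.
  by rewrite nth_nseq ip (nth_map ord0) ?size_tuple// -(tnth_nth _ _ (Ordinal ip)) tnth_mktuple.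
rewrite /moment /mean; congr fine.
have E (i : D) : (\int[P N.+1]_w (T i w ^+ k)%:E =
    \int[distribution (P N.+1) (T i)]_x (x ^+ k)%:E)%E.
  by rewrite integral_distribution//; exact: (hw_moments_finite hT).
rewrite !E; apply: eq_measure_integral => B mB _.
exact: (hw_identically_distributed hT).
Qed.

Lemma monomialE s w : monomial s w =
  \prod_(e in nondecreasing_indices p N.+1) T e w ^+ count_mem e (map (@rep p N.+1) s).
Proof.
rewrite /monomial; elim: s => [|i s IHs].
  by rewrite big_nil big1.
rewrite big_cons IHs /= (bigD1 (rep i)) ?rep_nondecreasing//=.
rewrite [in RHS](bigD1 (rep i)) ?rep_nondecreasing//= eqxx exprD expr1 T_rep mulrA.
congr (_ * _); apply: eq_bigr => e /andP[_ ei].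
by rewrite eq_sym (negbTE ei).
Qed.

Lemma integr_mean_monomial s :
  integr (P N.+1) (monomial s) /\
  EE (monomial s) = \prod_(e in nondecreasing_indices p N.+1)
     moment N (count_mem e (map (@rep p N.+1) s)).
Proof.
pose h (e : D) (x : R) := x ^+ count_mem e (map (@rep p N.+1) s).
have [] := @independent_mean_prod _ _ _ _ _ (nondecreasing_indices p N.+1) _
  (@hw_independent _ _ _ _ _ _ _ hT N.+1) h.
- by move=> e; exact: measurable_funX.
- by move=> e; exact: (hw_moments_finite hT).
move=> ih eh.
have mE : monomial s = fun w => \prod_(e in nondecreasing_indices p N.+1) h e (T e w).
  by apply/funext => w; rewrite monomialE.
rewrite mE eh; split=> //; apply: eq_bigr => e nde; exact: mean_power.
Qed.

Lemma integr_monomial s : integr (P N.+1) (monomial s).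
Proof. exact: (integr_mean_monomial s).1. Qed.

Lemma mean_monomial s : EE (monomial s) =
  \prod_(e in nondecreasing_indices p N.+1)
     moment N (count_mem e (map (@rep p N.+1) s)).
Proof. exact: (integr_mean_monomial s).2. Qed.

Lemma moment0 : moment N 0 = 1.
Proof. by rewrite /moment; under eq_fun do rewrite expr0; rewrite mean_cst. Qed.

Lemma moment1 : moment N 1 = 0.
Proof.
rewrite /moment; under eq_fun do rewrite expr1.
by rewrite -mean_expectation (hw_centered hT).
Qed.

Lemma monomial_cat s1 s2 w :
  monomial (s1 ++ s2) w = monomial s1 w * monomial s2 w.
Proof. by rewrite /monomial big_cat. Qed.

Lemma mean_monomial_cat s1 s2 : [disjoint edge_set s1 & edge_set s2] ->
  EE (monomial (s1 ++ s2)) = EE (monomial s1) * EE (monomial s2).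
Proof.
move=> dis; rewrite !mean_monomial -big_split /=; apply: eq_bigr => e _.
rewrite map_cat count_cat.
have [es1|] := boolP (e \in map (@rep p N.+1) s1); last first.
  by move=> /count_memPn ->; rewrite add0n moment0 mul1r.
have : e \notin map (@rep p N.+1) s2.
  have /pred0P/(_ e) /= := dis; rewrite !inE es1 /= => H; exact/negbT.
by move=> /count_memPn ->; rewrite addn0 moment0 mulr1.
Qed.

(** Each distinct edge contributes a moment of order between 1 and [L], hence a factor at most
    [kappa * q]; every other index contributes a moment of order 0, equal to 1. As [kappa] is at
    least 1, its exponent may be raised to [L]. *)
Lemma norm_mean_monomial (kappa q : R) (L : nat) s :
  1 <= kappa -> 0 <= q -> (size s <= L)%N ->
  (forall k, (0 < k <= L)%N -> `|moment N k| <= kappa * q) ->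
  `|EE (monomial s)| <= kappa ^+ L * q ^+ #|edge_set s|.
Proof.
move=> k1 q0 sL mk.
have k0 : 0 <= kappa by exact: le_trans k1.
apply: (@le_trans _ _ ((kappa * q) ^+ #|edge_set s|)); last first.
  rewrite exprMn ler_wpM2r ?exprn_ge0// ler_weXn2l//.
  exact: leq_trans (card_edge_set _) sL.
rewrite mean_monomial normr_prod.
rewrite (bigID (mem (edge_set s))) /= [X in _ * X]big1 ?mulr1; last first.
  move=> e /andP[_]; rewrite inE => /count_memPn ->.
  by rewrite moment0 normr1.
apply: (@le_trans _ _ (\prod_(e in edge_set s) (kappa * q))); last first.
  by rewrite prodr_const.
rewrite [leLHS](eq_bigl (mem (edge_set s))) => [|e]; last first.
  rewrite /= andb_idl// !inE => /mapP[i _ ->].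
  by have := rep_nondecreasing i; rewrite inE.
apply: ler_prod => e; rewrite /= inE => es; rewrite normr_ge0/=; apply: mk.
rewrite -has_count has_pred1 es (leq_trans (count_size _ _))//.
by rewrite size_map.
Qed.

(** A concrete substitute for measurability with respect to the entries indexed by [A]: it contains
    the products of centred monomials, and means factor over disjoint index sets by expansion into
    monomials. *)
Definition poly_in (A : {set D}) (F : Om N.+1 -> R) :=
  exists2 l : seq (R * seq D), all (fun x => edge_set x.2 \subset A) l &
    F = fun w => \sum_(x <- l) x.1 * monomial x.2 w.

Lemma poly_in_integr A F : poly_in A F -> integr (P N.+1) F.
Proof.
move=> [l _ ->]; apply: integr_sum => x _; apply: integrZ.
exact: integr_monomial.
Qed.

Lemma poly_in_cst A c : poly_in A (fun=> c).
Proof.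
exists [:: (c, [::])].
  by rewrite /= andbT; apply/fintype.subsetP => e; rewrite inE.
by apply/funext => w; rewrite big_seq1 /= /monomial big_nil mulr1.
Qed.

Lemma poly_in_monomial s : poly_in (edge_set s) (monomial s).
Proof.
exists [:: (1, s)]; first by rewrite /= andbT.
by apply/funext => w; rewrite big_seq1 mul1r.
Qed.

Lemma poly_inB A F G : poly_in A F -> poly_in A G -> poly_in A (fun w => F w - G w).
Proof.
move=> [l lA ->] [l' l'A ->].
exists (l ++ [seq (- x.1, x.2) | x <- l']).
  by rewrite all_cat lA all_map.
apply/funext => w; rewrite big_cat big_map /=; congr (_ + _).
by rewrite -sumrN; apply: eq_bigr => x _; rewrite mulNr.
Qed.

Lemma poly_inM A B F G : poly_in A F -> poly_in B G ->
  poly_in (A :|: B)%SET (fun w => F w * G w).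
Proof.
move=> [l /allP lA ->] [l' /allP l'A ->].
exists [seq (x.1 * y.1, x.2 ++ y.2) | x <- l, y <- l'].
  apply/allP => z /allpairsP[[x y] /= [xl yl ->]] /=.
  by rewrite edge_set_cat finset.setUSS ?lA ?l'A.
apply/funext => w; rewrite big_allpairs_dep /= mulr_suml; apply: eq_bigr => x _.
rewrite mulr_sumr; apply: eq_bigr => y _.
by rewrite monomial_cat mulrACA.
Qed.

Lemma mean_poly_inM (A B : {set D}) F G : [disjoint A & B] -> poly_in A F -> poly_in B G ->
  EE (fun w => F w * G w) = EE F * EE G.
Proof.
move=> dis [l /allP lA ->] [l' /allP l'A ->].
rewrite (_ : (fun w => _) = fun w => \sum_(x <- l) \sum_(y <- l')
    (x.1 * y.1) * monomial (x.2 ++ y.2) w); last first.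
  apply/funext => w; rewrite mulr_suml; apply: eq_bigr => x _.
  rewrite mulr_sumr; apply: eq_bigr => y _.
  by rewrite monomial_cat mulrACA.
have im c s : integr (P N.+1) (fun w => c * monomial s w).
  by apply: integrZ; exact: integr_monomial.
rewrite !mean_sum => [|y _|x _|x _]; [|exact: im|exact: im|by apply: integr_sum].
rewrite mulr_suml big_seq [RHS]big_seq; apply: eq_bigr => x xl.
rewrite mean_sum// mulr_sumr big_seq [RHS]big_seq; apply: eq_bigr => y yl'.
rewrite !meanZ; try exact: integr_monomial.
rewrite mean_monomial_cat; first by rewrite mulrACA.
exact: disjointWl (lA _ xl) (disjointWr (l'A _ yl') dis).
Qed.

Definition centered s w := monomial s w - EE (monomial s).

Definition centered_prod (ss : seq (seq D)) w := \prod_(s <- ss) centered s w.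

Lemma poly_in_centered s : poly_in (edge_set s) (centered s).
Proof. apply: poly_inB; [exact: poly_in_monomial|exact: poly_in_cst]. Qed.

Lemma mean_centered s : EE (centered s) = 0.
Proof.
rewrite /centered meanB ?mean_cst ?subrr//; first exact: integr_monomial.
exact: integr_cst.
Qed.

Lemma poly_in_centered_prod ss :
  poly_in (edge_set (flatten ss)) (centered_prod ss).
Proof.
elim: ss => [|s ss IHss].
  by rewrite /centered_prod; under eq_fun do rewrite big_nil; exact: poly_in_cst.
rewrite /centered_prod; under eq_fun do rewrite big_cons.
by rewrite /= edge_set_cat; apply: poly_inM => //; exact: poly_in_centered.
Qed.

(** The uncentred [s0] is there for the induction: expanding one centred factor either appends its
    monomial to [s0] or pulls out its mean. Both terms obey the bound, the second because [q <= 1]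
    and a union has at most as many edges as the two sets together; hence the factor 2 per step. *)
Lemma norm_mean_centered_prod (kappa q : R) (L : nat) ss s0 :
  1 <= kappa -> 0 <= q <= 1 -> (size (flatten ss ++ s0) <= L)%N ->
  (forall s, (size s <= L)%N ->
    `|EE (monomial s)| <= kappa * q ^+ #|edge_set s|) ->
  `|EE (fun w => centered_prod ss w * monomial s0 w)| <=
     (2 * kappa) ^+ size ss * kappa * q ^+ #|edge_set (flatten ss ++ s0)|.
Proof.
move=> k1 /andP[q0 q1] + mk; have k0 : 0 <= kappa by exact: le_trans k1.
elim: ss s0 => [|s ss IHss] s0 sL.
  rewrite /centered_prod; under eq_fun do rewrite big_nil mul1r.
  by rewrite mul1r; exact: mk.
have im F t : poly_in (edge_set F) t -> integr (P N.+1) t by exact: poly_in_integr.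
have i1 t : integr (P N.+1) (fun w => centered_prod ss w * monomial t w).
  apply: poly_in_integr; apply: poly_inM; [exact: poly_in_centered_prod|].
  exact: poly_in_monomial.
rewrite (_ : (fun w => _) = fun w =>
    centered_prod ss w * monomial (s ++ s0) w -
    EE (monomial s) * (centered_prod ss w * monomial s0 w)); last first.
  apply/funext => w; rewrite /centered_prod big_cons monomial_cat /centered; ring.
rewrite meanB//; last exact: integrZ.
rewrite meanZ// (le_trans (ler_normB _ _))//.
set E := edge_set _.
have e1 : edge_set (flatten ss ++ (s ++ s0)) = E.
  by rewrite /E /= !edge_set_cat finset.setUCA finset.setUA.
have e2 : (#|E| <= #|edge_set s| + #|edge_set (flatten ss ++ s0)|)%N.
  by rewrite /E /= -catA edge_set_cat (leq_trans (leq_card_setU _ _)).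
have sL' : (size (flatten ss ++ (s ++ s0)) <= L)%N.
  by rewrite (leq_trans _ sL)// /= !size_cat; lia.
have sL2 : (size (flatten ss ++ s0) <= L)%N.
  by rewrite (leq_trans _ sL)// /= !size_cat; lia.
have sL3 : (size s <= L)%N.
  by rewrite (leq_trans _ sL)// /= !size_cat; lia.
have H1 := IHss _ sL'; rewrite e1 in H1.
have H2 := IHss _ sL2.
set K := (2 * kappa) ^+ size ss * kappa in H1 H2.
have K0 : 0 <= K by rewrite mulr_ge0// exprn_ge0// mulr_ge0.
have H3 : `|EE (monomial s) * EE (fun w => centered_prod ss w * monomial s0 w)| <=
    kappa * K * q ^+ #|E|.
  rewrite normrM; apply: (le_trans (ler_pM _ _ (mk _ sL3) H2)) => //.
  rewrite mulrACA -exprD; apply: ler_wpM2l; first exact: mulr_ge0.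
  by apply: ler_wiXn2l.
have qE : 0 <= q ^+ #|E| by exact: exprn_ge0.
apply: (le_trans (lerD H1 H3)).
rewrite (_ : _ ^+ _ * kappa * _ = 2 * (kappa * (K * q ^+ #|E|))); last first.
  by rewrite /= exprS /K; ring.
rewrite -[kappa * K * _]mulrA.
have : K * q ^+ #|E| <= kappa * (K * q ^+ #|E|) by rewrite ler_peMl// mulr_ge0.
lra.
Qed.

End FixedDimension.
End Monomials.

(** * Recursion for the moments of the fluctuations *)

Section EdgeVertices.
Import mathcomp.boot.finset.
Local Close Scope classical_set_scope.
Local Open Scope set_scope.
Variables (p N : nat).

Definition vertices (E : {set p.-tuple 'I_N}) : {set 'I_N} :=
  \bigcup_(e in E) [set x in e].

Lemma verticesU (E F : {set p.-tuple 'I_N}) :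
  vertices (E :|: F) = vertices E :|: vertices F.
Proof. exact: bigcup_setU. Qed.

Lemma vertices_bigcup (I : finType) (F : I -> {set p.-tuple 'I_N}) :
  vertices (\bigcup_i F i) = \bigcup_i vertices (F i).
Proof.
apply/setP => x; apply/bigcupP/bigcupP => [[e /bigcupP[i _ eF] xe]|[i _ /bigcupP[e eF xe]]].
  by exists i => //; apply/bigcupP; exists e.
by exists e => //; apply/bigcupP; exists i.
Qed.

End EdgeVertices.

Section MomentRecursion.
Variables (R : realType) (p : nat).
Variables (d : nat -> measure_display) (Om : forall N, measurableType (d N)).
Variable P : forall N, probability (Om N) R.
Variable T : forall N, p.-tuple 'I_N -> {RV (P N) >-> R}.
Variable M : nat -> R.
Hypothesis hT : heavy_wigner T M.
Variable N : nat.
Local Notation D := (p.-tuple 'I_N.+1).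
Local Notation EE := (mean (P N.+1)).
Local Notation h := (N.+1%:R^-1 : R).
Local Notation r := (Num.sqrt h).
Import mathcomp.boot.finset.
Local Close Scope classical_set_scope.
Local Open Scope set_scope.

Variables (A : finType) (es : A -> seq D) (cf : A -> R).

Definition fluct (w : Om N.+1) := r * \sum_a cf a * centered T (es a) w.

Let cprod k (f : {ffun 'I_k -> A}) (S : {set 'I_k}) w :=
  \prod_(i in S) centered T (es (f i)) w.
Let v k (f : {ffun 'I_k -> A}) (S : {set 'I_k}) := EE (cprod f S).

Let cprodE k (f : {ffun 'I_k -> A}) (S : {set 'I_k}) :
  cprod f S = centered_prod T [seq es (f i) | i <- enum S].
Proof.
by apply/funext => w; rewrite /cprod /centered_prod big_map big_enum.
Qed.

Let ES k (f : {ffun 'I_k -> A}) (S : {set 'I_k}) :=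
  \bigcup_(i in S) edge_set (es (f i)).

Let edge_set_flatten k (f : {ffun 'I_k -> A}) (S : {set 'I_k}) :
  edge_set (flatten [seq es (f i) | i <- enum S]) = ES f S.
Proof.
rewrite /ES -big_enum; elim: (enum S) => [|i s IHs].
  by rewrite big_nil; apply/setP => e; rewrite !inE.
by rewrite big_cons /= edge_set_cat IHs.
Qed.

Let poly_cprod k (f : {ffun 'I_k -> A}) (S : {set 'I_k}) :
  poly_in T (ES f S) (cprod f S).
Proof. by rewrite cprodE -edge_set_flatten; exact: poly_in_centered_prod. Qed.

Let integr_cprod k (f : {ffun 'I_k -> A}) (S : {set 'I_k}) :
  integr (P N.+1) (cprod f S).
Proof. exact: (poly_in_integr hT (poly_cprod f S)). Qed.

Let vM k (f : {ffun 'I_k -> A}) (S1 S2 : {set 'I_k}) : [disjoint S1 & S2] ->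
  [disjoint ES f S1 & ES f S2] -> v f (S1 :|: S2) = v f S1 * v f S2.
Proof.
move=> dS dE; rewrite /v -(mean_poly_inM hT dE (poly_cprod f S1) (poly_cprod f S2)).
congr mean; apply/funext => w; rewrite /cprod -bigU//=.
by apply: eq_bigl => i; rewrite !inE.
Qed.

Let v1 k (f : {ffun 'I_k -> A}) i : v f [set i] = 0.
Proof.
rewrite /v -(mean_centered hT (es (f i))); congr mean.
by apply/funext => w; rewrite /cprod big_set1.
Qed.

(** With two sample points, a product of means of two powers expands into one sum over index maps,
    [S] and its complement carrying the two powers. *)
Let fluct_prod k (S : {set 'I_k}) w w' :
  fluct w ^+ #|S| * fluct w' ^+ #|~: S| =
  \sum_(f : {ffun 'I_k -> A}) (r ^+ k * \prod_i cf (f i)) * (cprod f S w * cprod f (~: S) w').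
Proof.
pose x i := if i \in S then w else w'.
transitivity (\prod_(i < k) fluct (x i)).
  rewrite (bigID (mem S)) /=; congr (_ * _).
    rewrite (eq_bigr (fun=> fluct w)) => [|i]; first by rewrite prodr_const.
    by rewrite /x => ->.
  rewrite (eq_bigl (mem (~: S))) => [|i]; last by rewrite /= inE.
  rewrite (eq_bigr (fun=> fluct w')) => [|i]; first by rewrite prodr_const.
  by rewrite /x /= inE => /negbTE ->.
rewrite /fluct big_split /= prodr_const card_ord bigA_distr_bigA /= mulr_sumr.
apply: eq_bigr => f _; rewrite -mulrA; congr (_ * _).
rewrite big_split /=; congr (_ * _); rewrite (bigID (mem S)) /=; congr (_ * _).
  by apply: eq_bigr => i iS; rewrite /x iS.
rewrite (eq_bigl (mem (~: S))) => [|i]; last by rewrite /= inE.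
by apply: eq_bigr => i; rewrite /= inE /x => /negbTE ->.
Qed.

Lemma integr_fluct k : integr (P N.+1) (fun w => fluct w ^+ k).
Proof.
rewrite (_ : (fun w => _) = fun w => \sum_(f : {ffun 'I_k -> A})
    (r ^+ k * \prod_i cf (f i)) * cprod f setT w); last first.
  apply/funext => w; have := fluct_prod (setT : {set 'I_k}) w w.
  rewrite cardsT card_ord setCT cards0 expr0 mulr1 => ->.
  by apply: eq_bigr => f _; rewrite {2}/cprod big_set0 mulr1.
by apply: integr_sum => f _; apply: integrZ.
Qed.

Let mean_fluct_split k (S : {set 'I_k}) :
  EE (fun w => fluct w ^+ #|S|) * EE (fun w => fluct w ^+ #|~: S|) =
  \sum_(f : {ffun 'I_k -> A}) (r ^+ k * \prod_i cf (f i)) * (v f S * v f (~: S)).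
Proof.
transitivity (EE (fun w => EE (fun w' => fluct w ^+ #|S| * fluct w' ^+ #|~: S|))).
  rewrite mulrC -meanZ; last exact: integr_fluct.
  congr mean; apply/funext => w; rewrite mulrC -meanZ//; exact: integr_fluct.
transitivity (EE (fun w => \sum_(f : {ffun 'I_k -> A})
    (r ^+ k * \prod_i cf (f i) * v f (~: S)) * cprod f S w)).
  congr mean; apply/funext => w.
  under eq_fun do rewrite fluct_prod.
  rewrite mean_sum => [|f _]; last by apply: integrZ; apply: integrZ.
  apply: eq_bigr => f _; rewrite meanZ; last exact: integrZ.
  by rewrite meanZ// -/(v f _) -!mulrA; congr (_ * (_ * _)); rewrite mulrC.
rewrite mean_sum => [|f _]; last exact: integrZ.
by apply: eq_bigr => f _; rewrite meanZ// -/(v f _) -!mulrA [v f S * _]mulrC.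
Qed.

Variables (C kappa : R) (L L' m : nat) (c : nat -> R).
Let q := h ^+ p.-1.
Hypothesis size_es : forall a, (size (es a) <= L)%N.
Hypothesis C_ge0 : 0 <= C.
Hypothesis norm_cf : forall a, `|cf a| <= C.
Hypothesis kappa_ge1 : 1 <= kappa.
Hypothesis moment_bound : forall k, (0 < k <= m.+2 * L)%N ->
  `|moment T N k| <= kappa * q.
Let Ea a := edge_set (es a).
Hypothesis vertices_step : forall (E : {set D}) a,
  (#|vertices (E :|: Ea a)| + p.-1 * #|E| <=
   #|vertices E| + p.-1 * #|E :|: Ea a| + 1)%N.
Hypothesis vertices_meet : forall (E : {set D}) a, ~~ [disjoint E & Ea a] ->
  (#|vertices (E :|: Ea a)| + p.-1 * #|E| <=
   #|vertices E| + p.-1 * #|E :|: Ea a|)%N.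
Hypothesis card_vertices : forall a, (#|vertices (Ea a)| <= L')%N.
Hypothesis c_homo : {homo c : i j / (i <= j)%N >-> i <= j}.
Hypothesis c_ge0 : forall i, 0 <= c i.
Hypothesis cover_sum : forall V : {set 'I_N.+1},
  \sum_a h ^+ #|V :|: vertices (Ea a)| <= c #|V| * h ^+ #|V|.

Let kappa' := kappa ^+ (m.+2 * L).
Let B := (2 * kappa') ^+ m.+2 * kappa'.

(** [C] bounds the coefficients; [disc] has [m.+2] terms, each at most [B * B] times a power of [q]
    ([B >= 1] covers the term with a single mean); the last factor comes from [sum_tuple_cover]
    started at the empty set. *)
Definition recursion_constant :=
  C ^+ m.+2 * (m.+2%:R * (B * B)) * c (m.+2 * L')%N ^+ m.+2.

Let h_ge0 : 0 <= h. Proof. by rewrite invr_ge0. Qed.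
Let h_le1 : h <= 1. Proof. by rewrite invf_le1// ler1n. Qed.
Let q_ge0 : 0 <= q. Proof. exact: exprn_ge0. Qed.
Let q_le1 : q <= 1. Proof. exact: exprn_ile1. Qed.
Let q01 : 0 <= q <= 1. Proof. by rewrite q_ge0. Qed.
Let kappa'_ge1 : 1 <= kappa'. Proof. by rewrite exprn_ege1. Qed.

Let norm_v (f : {ffun 'I_m.+2 -> A}) S : `|v f S| <= B * q ^+ #|ES f S|.
Proof.
have k0 : 0 <= kappa' by exact: le_trans kappa'_ge1.
have k21 : 1 <= 2 * kappa' by have := kappa'_ge1; lra.
set ss := [seq es (f i) | i <- enum S].
have szS : (size ss <= m.+2)%N.
  by rewrite size_map -cardE (leq_trans (max_card _))// card_ord.
have szF (s : seq 'I_m.+2) : (size (flatten [seq es (f i) | i <- s]) <= size s * L)%N.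
  by elim: s => // i s IHs; rewrite /= size_cat mulSn leq_add.
have sz : (size (flatten ss ++ [::]) <= m.+2 * L)%N.
  rewrite cats0 (leq_trans (szF _))// leq_mul2r; apply/orP; right.
  by rewrite -cardE (leq_trans (max_card _))// card_ord.
have := norm_mean_centered_prod hT kappa'_ge1 q01 sz.
move=> /(_ _)/le_trans H.
rewrite (_ : v f S = EE (fun w => centered_prod T ss w * monomial T [::] w)); last first.
  rewrite /v cprodE; congr mean; apply/funext => w.
  by rewrite /monomial big_nil mulr1.
apply: H => [s sL|].
  by apply: (norm_mean_monomial hT kappa_ge1 _ sL moment_bound).
rewrite cats0 edge_set_flatten /B ler_wpM2r ?exprn_ge0//.
by rewrite ler_wpM2r// ler_weXn2l.
Qed.

Let disc (f : {ffun 'I_m.+2 -> A}) :=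
  v f setT - \sum_(j | j != ord0) v f [set ord0; j] * v f (~: [set ord0; j]).

Let B_ge1 : 1 <= B.
Proof. by rewrite mulr_ege1// exprn_ege1//; have := kappa'_ge1; lra. Qed.

Let B_ge0 : 0 <= B. Proof. exact: le_trans B_ge1. Qed.

(** Either the discrepancy vanishes or, since [h] is the square of [r] and [q] is [h ^+ p.-1], the
    total exponent of [r] is at least twice the number of vertices plus one. *)
Let norm_disc f : r ^+ m.+2 * `|disc f| <=
  m.+2%:R * (B * B) * (r * h ^+ #|vertices (\bigcup_i Ea (f i))|).
Proof.
have r0 : 0 <= r by exact: sqrtr_ge0.
have r1 : r <= 1 by rewrite -[leRHS]sqrtr1 ler_wsqrtr.
have rr : r ^+ 2 = h by rewrite sqr_sqrtr.
have q0 := q_ge0.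
have ET : ES f setT = \bigcup_i Ea (f i).
  by apply: eq_bigl => i; rewrite inE.
have vt0 : #|vertices (set0 : {set D})| = 0%N by rewrite /vertices big_set0 cards0.
have [d0|ineq] := @cluster_disc R D (fun E => #|vertices E|) p.-1 m (fun i => Ea (f i))
  (v f) vt0 (fun E i => vertices_step E (f i)) (fun E i => @vertices_meet E (f i))
  (v1 f) (@vM _ f).
  rewrite /disc d0 normr0 mulr0.
  by do 3?[apply: mulr_ge0 => //]; exact: exprn_ge0.
set Et := \bigcup_i Ea (f i) in ET ineq *.
have bd : `|disc f| <= m.+2%:R * (B * B) * q ^+ #|Et|.
  apply: (le_trans (ler_normB _ _)).
  have K0 : 0 <= B * B by exact: mulr_ge0.
  have q1 := q_le1.
  rewrite -natr1 mulrDl mulrDl mul1r [X in _ <= X]addrC; apply: lerD.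
    apply: (le_trans (norm_v _ _)); rewrite ET.
    by rewrite ler_wpM2r ?exprn_ge0// ler_peMl.
  apply: (le_trans (ler_norm_sum _ _ _)).
  apply: (@le_trans _ _ (\sum_(j < m.+2 | j != ord0) B * B * q ^+ #|Et|)).
    apply: ler_sum => j _; rewrite normrM.
    apply: (le_trans (ler_pM _ _ (norm_v _ _) (norm_v _ _))) => //.
    rewrite mulrACA -exprD; apply: ler_wpM2l => //; apply: ler_wiXn2l => //.
    rewrite -ET -[setT](setUCr [set ord0; j]) /ES bigcup_setU.
    exact: leq_card_setU.
  by rewrite sumr_const cardC1 card_ord -[leLHS]mulr_natl [leLHS]mulrA.
apply: (@le_trans _ _ (r ^+ m.+2 * (m.+2%:R * (B * B) * q ^+ #|Et|))).
  by rewrite ler_wpM2l ?exprn_ge0.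
rewrite mulrCA; apply: ler_wpM2l; first by do 2?[apply: mulr_ge0 => //].
rewrite /q; move: rr r0 r1; move: (Num.sqrt _) => s <- s0 s1.
rewrite -!exprM -exprD -exprS.
apply: ler_wiXn2l => //; by move: ineq; rewrite addn1.
Qed.

(** Gaussian integration by parts, up to an error. Summing [norm_disc] over all index maps costs
    only a constant, since the powers of [h] balance the number of maps covering given vertices. *)
Lemma moment_recursion :
  `|EE (fun w => fluct w ^+ m.+2) -
    m.+1%:R * EE (fun w => fluct w ^+ 2) * EE (fun w => fluct w ^+ m)| <=
  recursion_constant * r.
Proof.
have -> : EE (fun w => fluct w ^+ m.+2) -
    m.+1%:R * EE (fun w => fluct w ^+ 2) * EE (fun w => fluct w ^+ m) =
    \sum_(f : {ffun 'I_m.+2 -> A}) (r ^+ m.+2 * \prod_i cf (f i)) * disc f.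
  (* The factor [v f (~: setT)], the mean of an empty product, is inserted so that
     [mean_fluct_split] applies to the first term too. *)
  rewrite [RHS](eq_bigr (fun f : {ffun 'I_m.+2 -> A} => (r ^+ m.+2 * \prod_i cf (f i)) * (v f setT * v f (~: [set: 'I_m.+2])) -
    \sum_(j | j != ord0) (r ^+ m.+2 * \prod_i cf (f i)) *
        (v f [set ord0; j] * v f (~: [set ord0; j])))); last first.
    move=> f _; rewrite -mulr_sumr -mulrBr; congr (_ * (_ - _)).
    rewrite [v f (~: [set: 'I_m.+2])](_ : _ = 1) ?mulr1// /v setCT -[RHS](mean_cst (P N.+1)).
    by congr mean; apply/funext => w; rewrite /cprod big_set0.
  rewrite sumrB -mean_fluct_split exchange_big /= -sumrN; congr (_ + _).
    rewrite setCT cardsT card_ord cards0.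
    rewrite [X in _ * X](_ : _ = 1) ?mulr1// -[RHS](mean_cst (P N.+1)).
    by congr mean; apply/funext => w; rewrite expr0.
  (* After summation over [f], each of the [m.+1] values of [j] gives the same product of means. *)
  rewrite (eq_bigr (fun=> - (EE (fun w => fluct w ^+ 2) * EE (fun w => fluct w ^+ m)))).
    by rewrite sumr_const cardC1 card_ord /= mulNrn -[in RHS]mulr_natl -mulrA.
  move=> j j0; rewrite -mean_fluct_split; congr (- (_ * _)).
    by rewrite cards2 eq_sym j0.
  have := cardsC [set ord0; j]; rewrite cards2 eq_sym j0 card_ord /= add2n => /eqP.
  by rewrite !eqSS => /eqP ->.
have r0 : 0 <= r by exact: sqrtr_ge0.
apply: (le_trans (ler_norm_sum _ _ _)).
apply: (@le_trans _ _ (\sum_(f : {ffun 'I_m.+2 -> A})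
   C ^+ m.+2 * (m.+2%:R * (B * B)) * r * h ^+ #|set0 :|: \bigcup_(a <- [tuple f i | i < m.+2]) vertices (Ea a)|)).
  apply: ler_sum => f _.
  have cfC : `|\prod_i cf (f i)| <= C ^+ m.+2.
    apply: (@le_trans _ _ (\prod_(i < m.+2) C)).
      by rewrite normr_prod; apply: ler_prod => i _; rewrite normr_ge0 norm_cf.
    by rewrite prodr_const card_ord.
  rewrite normrM normrM (ger0_norm (exprn_ge0 _ r0)) mulrAC.
  apply: (le_trans (ler_pM _ _ (norm_disc f) cfC)).
  - by rewrite mulr_ge0// exprn_ge0.
  - by [].
  rewrite [leLHS]mulrC [leLHS]mulrA [leLHS]mulrA.
  rewrite set0U vertices_bigcup le_eqVlt; apply/orP; left; apply/eqP.
  by rewrite big_map big_enum.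
rewrite -mulr_sumr /recursion_constant.
have := @sum_tuple_cover R 'I_N.+1 h h_ge0 A (fun a => vertices (Ea a)) L' c m.+2 set0.
move=> /(_ card_vertices c_homo c_ge0 cover_sum).
rewrite cards0 add0n mulr1 => H.
rewrite [leRHS](_ : _ = C ^+ m.+2 * (m.+2%:R * (B * B)) * r * c (m.+2 * L')%N ^+ m.+2); last first.
  by rewrite /B; ring.
apply: ler_wpM2l.
  apply: mulr_ge0 => //; apply: mulr_ge0; first exact: exprn_ge0.
  by apply: mulr_ge0 => //; exact: mulr_ge0.
apply: le_trans H.
rewrite [leRHS](reindex (fun f : {ffun 'I_m.+2 -> A} => [tuple f i | i < m.+2]))//=.
exists (fun t : m.+2.-tuple A => [ffun i => tnth t i]) => [f _|t _].
  by apply/ffunP => i; rewrite ffunE tnth_mktuple.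
by apply: eq_from_tnth => i; rewrite tnth_mktuple ffunE.
Qed.

End MomentRecursion.

(** * Traces of powers as sums over vertex maps *)

Section EdgeGrowth.
Import mathcomp.boot.finset.
Local Close Scope classical_set_scope.
Local Open Scope set_scope.
Variables (p N : nat).
Hypothesis p_gt0 : (0 < p)%N.
Implicit Types (e : p.-tuple 'I_N) (E : {set p.-tuple 'I_N}).

Lemma vertices1 e : vertices [set e] = [set x in e].
Proof. exact: big_set1. Qed.

Lemma mem_vertices E e x : e \in E -> x \in e -> x \in vertices E.
Proof. by move=> eE xe; apply/bigcupP; exists e => //; rewrite inE. Qed.

(** A new edge brings at most [p] vertices, and at most [p.-1] when it contains a vertex of [E]; the
    extra unit is paid only for an edge that opens a new component. *)
Lemma vertices_add_edge E e :
  (#|vertices (E :|: [set e])| + p.-1 * #|E| <=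
   #|vertices E| + p.-1 * #|E :|: [set e]| + ~~ has (mem (vertices E)) e)%N.
Proof.
have [eE|eE] := boolP (e \in E).
  by rewrite (setUidPl _) ?sub1set// leq_addr.
have -> : #|E :|: [set e]| = #|E|.+1 by rewrite setUC cardsU1 eE.
rewrite verticesU vertices1 cardsU.
have : (#|[set x in e]| <= p)%N.
  by rewrite cardsE (leq_trans (card_size _))// size_tuple.
have : (has (mem (vertices E)) e <= #|vertices E :&: [set x in e]|)%N.
  have [/hasP[x xe xE]|] := boolP (has _ _); last by [].
  by rewrite card_gt0; apply/set0Pn; exists x; rewrite !inE; apply/andP.
have : (#|vertices E :&: [set x in e]| <= #|[set x in e]|)%N.
  by rewrite subset_leq_card// subsetIr.
have p0 := p_gt0.
set x1 := #|_ :&: _|; set x2 := #|vertices E|; set x3 := #|[set x in e]|.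
rewrite mulnS; move: x1 x2 x3 (p.-1 * #|E|)%N => x1 x2 x3 y.
by case: (has _ _) => /=; lia.
Qed.

(** Each edge of the path contains a vertex of its predecessor, so no edge after [e] opens a
    component. *)
Lemma vertices_path E e s : path (fun a b : p.-tuple 'I_N => has (mem a) b) e s ->
  (#|vertices ((E :|: [set e]) :|: [set x in s])| + p.-1 * #|E :|: [set e]| <=
   #|vertices (E :|: [set e])| + p.-1 * #|(E :|: [set e]) :|: [set x in s]|)%N.
Proof.
elim: s E e => [|e' s IHs] E e /=.
  by move=> _; rewrite (_ : [set x in [::]] = set0) ?setU0//; apply/setP => x; rewrite !inE.
move=> /andP[ee' ps].
have := IHs (E :|: [set e]) e' ps.
rewrite -!setUA (_ : [set e'] :|: [set x in s] = [set x in e' :: s]); last first.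
  by apply/setP => x; rewrite !inE.
have := vertices_add_edge (E :|: [set e]) e'.
have -> : has (mem (vertices (E :|: [set e]))) e'.
  apply: sub_has ee' => x /= xe; apply: (mem_vertices (e := e)) => //.
  by rewrite !inE eqxx orbT.
rewrite addn0 -!setUA.
set a := #|vertices _|; set b := #|E :|: [set e]|; set c := #|vertices _|.
set a' := #|_|; set c' := #|vertices _|; set g := #|_|.
move: (p.-1) => r; lia.
Qed.

End EdgeGrowth.

(** * Images of a hypergraph cycle under vertex maps *)

Section CycleImage.
Import mathcomp.boot.finset.
Local Close Scope classical_set_scope.
Local Open Scope set_scope.
Variables (p k N : nat).
Hypothesis hp : (2 <= p)%N.
Hypothesis k_gt0 : (0 < k)%N.

Definition image_edges (g : hypergraph p) (phi : hvert g -> 'I_N) :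
  seq (p.-tuple 'I_N) := [seq map_tuple phi e | e <- hedges g].

Variable phi : hvert (hcycle p k) -> 'I_N.

Definition cycle_edge (t : 'I_k) : p.-tuple (hvert (hcycle p k)) :=
  tuple_of_seq p (inl t)
    [:: inl t, inl (ordS t) & [seq inr (t, s) | s <- enum 'I_(p.-2)]].

Lemma tuple_of_seqE (U : Type) (x0 : U) (s : seq U) : size s = p ->
  tval (tuple_of_seq p x0 s) = s.
Proof.
move=> sp; apply: (@eq_from_nth _ x0); first by rewrite size_tuple.
move=> i; rewrite size_tuple => ip.
by rewrite -(tnth_nth _ _ (Ordinal ip)) tnth_mktuple.
Qed.

Lemma tval_cycle_edge t : tval (cycle_edge t) =
  [:: inl t, inl (ordS t) & [seq inr (t, s) | s <- enum 'I_(p.-2)]].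
Proof.
by apply: tuple_of_seqE; rewrite /= size_map size_enum_ord -subn2 -addn2 subnK.
Qed.

Let c t := rep (map_tuple phi (cycle_edge t)).

Let mem_c t x : (x \in c t) = (x \in map phi (cycle_edge t)).
Proof. by rewrite (perm_mem (rep_perm _)). Qed.

Let edge_set_c : edge_set (image_edges phi) = [set c t | t : 'I_k].
Proof.
apply/setP => e; rewrite inE /image_edges -!map_comp.
by apply/mapP/imsetP => -[t _ ->]; exists t => //; rewrite mem_enum.
Qed.

Let val_iter_ordS j (t : 'I_k) : val (iter j (@ordS k) t) = ((t + j) %% k)%N.
Proof.
elim: j => [|j IHj] /=; first by rewrite addn0 modn_small.
by rewrite IHj -addn1 modnDml addn1 addnS.
Qed.

Let path_c n t : path (fun a b : p.-tuple 'I_N => has (mem a) b) (c t)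
  [seq c u | u <- traject (@ordS k) (ordS t) n].
Proof.
elim: n t => //= n IHn t; rewrite IHn andbT; apply/hasP.
exists (phi (inl (ordS t))).
  by rewrite mem_c tval_cycle_edge /= inE eqxx.
by rewrite /= mem_c tval_cycle_edge /= !inE eqxx orbT.
Qed.

Let all_c t : [set c t] :|: [set x in [seq c u | u <- traject (@ordS k) (ordS t) (k + k)]] =
  [set c u | u : 'I_k].
Proof.
apply/setP => e; rewrite !inE; apply/idP/imsetP.
  by move=> /orP[/eqP ->|/mapP[u _ ->]]; [exists t|exists u].
move=> [u _ ->]; apply/orP; right; apply: map_f; apply/trajectP.
(* Two turns of the cycle leave room for this rank, which needs no reduction modulo [k]: it is the
   number of steps from [ordS t] to [u], possibly with one full turn more. *)
exists (u + k - t.+1)%N.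
  by have := ltn_ord u; have := ltn_ord t; lia.
apply: val_inj; rewrite -iterSr val_iter_ordS.
have -> : (t + (u + k - t.+1).+1 = u + k)%N.
  by have := ltn_ord u; have := ltn_ord t; lia.
by rewrite modnDr modn_small.
Qed.

Lemma image_edges_step (E : {set p.-tuple 'I_N}) :
  (#|vertices (E :|: edge_set (image_edges phi))| + p.-1 * #|E| <=
   #|vertices E| + p.-1 * #|E :|: edge_set (image_edges phi)| + 1)%N.
Proof.
have p_gt0 : (0 < p)%N by exact: ltnW.
have t : 'I_k by exact: Ordinal k_gt0.
have := vertices_path p_gt0 E (path_c (k + k) t).
rewrite -!setUA all_c edge_set_c.
have := vertices_add_edge p_gt0 E (c t).
have : (~~ has (mem (vertices E)) (c t) <= 1)%N by case: has.
have arith (b x1 x2 x3 y1 y2 y3 : nat) : (b <= 1 -> x2 + y1 <= x1 + y2 + b ->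
  x3 + y2 <= x2 + y3 -> x3 + y1 <= x1 + y3 + 1)%N by clear; lia.
exact: arith.
Qed.

(** The walk round the cycle may start at any edge; started at one that already lies in [E], it
    never opens a component. *)
Lemma image_edges_meet (E : {set p.-tuple 'I_N}) :
  ~~ [disjoint E & edge_set (image_edges phi)] ->
  (#|vertices (E :|: edge_set (image_edges phi))| + p.-1 * #|E| <=
   #|vertices E| + p.-1 * #|E :|: edge_set (image_edges phi)|)%N.
Proof.
rewrite edge_set_c => /pred0Pn[e /= /andP[eE /imsetP[t _ et]]].
have p_gt0 : (0 < p)%N by exact: ltnW.
have := vertices_path p_gt0 E (path_c (k + k) t).
rewrite -!setUA all_c (_ : E :|: [set c t] = E)//.
by apply/setUidPl; rewrite sub1set -et.
Qed.

Lemma vertices_image_edges :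
  vertices (edge_set (image_edges phi)) = [set phi v | v in hvert (hcycle p k)].
Proof.
rewrite edge_set_c; apply/setP => x; apply/bigcupP/imsetP.
  move=> [e /imsetP[t _ ->]]; rewrite inE mem_c => /mapP[v _ ->].
  by exists v.
move=> [v _ ->].
have [t vt] : exists t, v \in tval (cycle_edge t).
  case: v => [t|[t s]]; exists t; rewrite tval_cycle_edge !inE ?eqxx//=.
  by apply: map_f; rewrite mem_enum.
by exists (c t); [exact: imset_f|rewrite inE mem_c map_f].
Qed.

End CycleImage.

Section TracePower.
Local Close Scope classical_set_scope.

Lemma trace_expr (R : comPzRingType) n (A : 'M[R]_n) k :
  \tr (A ^+ k.+1) = \sum_(x : {ffun 'I_k.+1 -> 'I_n}) \prod_t A (x t) (x (ordS t)).
Proof.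
(* Weight of the walk from [i] to [j] through the successive vertices of [s]. *)
pose wt := fix wt (i : 'I_n) (s : seq 'I_n) (j : 'I_n) {struct s} :=
  if s is a :: s' then A i a * wt a s' j else A i j.
have powE m i j : (A ^+ m.+1) i j = \sum_(s : m.-tuple 'I_n) wt i s j.
  elim: m i => [|m IHm] i.
    by rewrite expr1 (big_pred1 [tuple]) => [//|t]; apply/esym/eqP; rewrite [t]tuple0.
  rewrite sum_tuple_cons exprS mxE; apply: eq_bigr => a _.
  by rewrite IHm mulr_sumr; apply: eq_bigr.
have wtE (s : seq 'I_n) i j : wt i s j =
    \prod_(t < (size s).+1) A (nth i (i :: s) t) (nth j s t).
  elim: s i => [|a s IHs] i /=; first by rewrite big_ord1.
  rewrite big_ord_recl /= IHs; congr (_ * _); apply: eq_bigr => t _.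
  case: t => -[|t] //= lt; congr (A _ _).
  by apply: set_nth_default.
transitivity (\sum_(x : k.+1.-tuple 'I_n) \prod_t A (tnth x t) (tnth x (ordS t))).
  rewrite sum_tuple_cons; apply: eq_bigr => i _; rewrite powE; apply: eq_bigr => s _.
  rewrite wtE size_tuple; apply: eq_bigr => t _; rewrite !(tnth_nth i) /=; congr (A _ _).
  have [tk|kt] := ltnP t k; first by rewrite modn_small.
  have -> : val t = k by apply/eqP; rewrite eqn_leq kt andbT -ltnS ltn_ord.
  by rewrite modnn /= nth_default// size_tuple.
rewrite (reindex (fun f : {ffun 'I_k.+1 -> 'I_n} => [tuple f i | i < k.+1]))/=.
  by apply: eq_bigr => f _; apply: eq_bigr => t _; rewrite !tnth_mktuple.
exists (fun t : k.+1.-tuple 'I_n => [ffun i => tnth t i]) => [f _|t _].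
  by apply/ffunP => i; rewrite ffunE tnth_mktuple.
by apply: eq_from_tnth => i; rewrite tnth_mktuple ffunE.
Qed.

Lemma map_tuple_of_seq (U V : Type) (f : U -> V) p (x0 : U) (s : seq U) :
  map_tuple f (tuple_of_seq p x0 s) = tuple_of_seq p (f x0) (map f s).
Proof.
apply: eq_from_tnth => i; rewrite tnth_map !tnth_mktuple.
have [ltis|leis] := ltnP i (size s); first by rewrite (nth_map x0).
by rewrite !nth_default ?size_map.
Qed.

Lemma trace_tildeA (R : realType) (p N k : nat) (M2 : R) (T : p.-tuple 'I_N -> R) :
  (0 < k)%N ->
  \tr (tildeA M2 T ^+ k) = (Num.sqrt (M2 * (p.-2)`!%:R))^-1 ^+ k *
    \sum_(phi : {ffun hvert (hcycle p k) -> 'I_N})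
      \prod_(i <- image_edges phi) T i.
Proof.
case: k => // k _; rewrite trace_expr.
set c := _^-1.
(* A map on the vertices of the cycle consists of the matrix indices [x], for the vertices x_t, and
   of the tuples [J] summed over in the entries of [tildeA]. *)
pose F (x : {ffun 'I_k.+1 -> 'I_N}) (J : {ffun 'I_k.+1 -> (p.-2).-tuple 'I_N}) :
    {ffun hvert (hcycle p k.+1) -> 'I_N} :=
  [ffun v => match v with inl t => x t | inr (t, s) => tnth (J t) s end].
transitivity (\sum_(x : {ffun 'I_k.+1 -> 'I_N})
    \sum_(J : {ffun 'I_k.+1 -> (p.-2).-tuple 'I_N})
       c ^+ k.+1 * \prod_(i <- image_edges (F x J)) T i).
  apply: eq_bigr => x _; rewrite -mulr_sumr.
  under eq_bigr do rewrite mxE.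
  rewrite big_split /= prodr_const card_ord -/c; congr (_ * _).
  rewrite bigA_distr_bigA /=; apply: eq_bigr => J _.
  rewrite /image_edges big_map /= big_map big_enum /=; apply: eq_bigr => t _.
  congr (T _); rewrite map_tuple_of_seq /= !ffunE; congr (tuple_of_seq _ _ [:: _, _ & _]).
  rewrite -map_comp -[LHS]map_tnth_enum; apply: eq_map => s /=.
  by rewrite ffunE.
rewrite pair_big /= mulr_sumr.
rewrite [RHS](reindex (fun xJ => F xJ.1 xJ.2)) //=.
exists (fun phi : {ffun hvert (hcycle p k.+1) -> 'I_N} =>
   ([ffun t => phi (inl t)], [ffun t => [tuple phi (inr (t, s)) | s < p.-2]])).
  move=> [x J] _ /=; congr pair; apply/ffunP => t; rewrite !ffunE//.
  by apply: eq_from_tnth => s; rewrite tnth_mktuple ffunE.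
by move=> phi _; apply/ffunP => -[t|[t s]]; rewrite !ffunE//= tnth_mktuple.
Qed.

End TracePower.

(** * Uniform moment bounds and the recursion for linear combinations of fluctuations *)

Section HeavyWignerMoments.
Variables (R : realType) (p : nat).
Hypothesis hp : (2 <= p)%N.
Variables (d : nat -> measure_display) (Om : forall N, measurableType (d N)).
Variable P : forall N, probability (Om N) R.
Variable T : forall N, p.-tuple 'I_N -> {RV (P N) >-> R}.
Variable M : nat -> R.
Hypothesis hT : heavy_wigner T M.

Lemma moment_cvg k : (2 <= k)%N ->
  N.+1%:R ^+ p.-1 * moment T N k @[N --> \oo] --> M k.
Proof.
move=> k2; have := hw_moments hT (fun N => [tuple ord0 | _ < p]) k2.
by under eq_fun do rewrite mean_expectation.
Qed.

(** Order 1 vanishes, and for each order at least 2 the rescaled moments converge, hence are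
    bounded; finitely many orders give one [kappa]. Order 0 is left out, its moment being 1. *)
Lemma moment_uniform_bound L : exists2 kappa : R, 1 <= kappa &
  forall N k, (0 < k <= L)%N -> `|moment T N k| <= kappa * N.+1%:R^-1 ^+ p.-1.
Proof.
have H k : exists B : R, 0 <= B /\
    forall N, (0 < k)%N -> `|moment T N k| <= B * N.+1%:R^-1 ^+ p.-1.
  case: k => [|[|k]]; first by exists 0.
    by exists 0; split=> // N _; rewrite (moment1 hT) normr0 mul0r.
  have /cvg_seq_bounded : cvg (N.+1%:R ^+ p.-1 * moment T N k.+2 @[N --> \oo]).
    by apply: cvgP; exact: moment_cvg.
  move=> [B [_ /(_ (B + 1))]]; rewrite ltrDl ltr01 => /(_ isT) HB.
  have B0 : 0 <= B + 1 by apply: le_trans (HB 0%N I).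
  exists (B + 1); split=> // N _.
  have := HB N I; rewrite /= normrM ger0_norm ?exprn_ge0// => HN.
  by rewrite exprVn ler_pdivlMr ?exprn_gt0// mulrC.
have [B HB] := choice H.
exists (1 + \sum_(k < L.+1) B k).
  by rewrite lerDl sumr_ge0// => k _; have [] := HB k.
move=> N k /andP[k0 kL]; have [_ Hk] := HB k.
apply: (le_trans (Hk N k0)); apply: ler_wpM2r; first by rewrite exprn_ge0// invr_ge0.
rewrite (bigD1 (Ordinal (kL : (k < L.+1)%N)))//= addrCA lerDl addr_ge0//.
by rewrite sumr_ge0// => i _; have [] := HB i.
Qed.

Variable M2 : R.
Let c := (Num.sqrt (M2 * (p.-2)`!%:R))^-1.

Lemma trace_powerE N k w : (0 < k)%N ->
  trace_power T M2 k w = c ^+ k *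
    \sum_(phi : {ffun hvert (hcycle p k) -> 'I_N.+1}) monomial T (image_edges phi) w.
Proof. by move=> k0; rewrite /trace_power trace_tildeA. Qed.

Lemma trace_fluctuationE N k w : (0 < k)%N ->
  trace_fluctuation T M2 k w = Num.sqrt (N.+1%:R^-1) * (c ^+ k *
    \sum_(phi : {ffun hvert (hcycle p k) -> 'I_N.+1}) centered T (image_edges phi) w).
Proof.
move=> k0; rewrite /trace_fluctuation sqrtrV//; congr (_ * _).
rewrite mean_expectation trace_powerE//.
rewrite (_ : @trace_power _ _ _ _ _ T M2 N.+1 k = fun w => c ^+ k *
    \sum_(phi : {ffun hvert (hcycle p k) -> 'I_N.+1}) monomial T (image_edges phi) w); last first.
  by apply/funext => v; rewrite trace_powerE.
have im phi : integr (P N.+1) (monomial T (@image_edges p N.+1 (hcycle p k) phi)).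
  exact: (integr_monomial hT).
rewrite meanZ; last by apply: integr_sum => phi _; exact: im.
rewrite mean_sum => [|phi _]; last exact: im.
by rewrite -mulrBr -sumrB.
Qed.

Section LinearCombination.
Variables (J : nat) (k : 'I_J -> nat) (tc : 'I_J -> R).
Hypothesis k_gt0 : forall j, (0 < k j)%N.

Definition fluctuation_comb N (w : Om N) :=
  \sum_j tc j * trace_fluctuation T M2 (k j) w.

(** Cycles of different lengths are pooled into one index type, each map carrying the coefficient of
    its cycle, so that the recursion for a single [fluct] covers linear combinations. *)
Let A N : finType := {j : 'I_J & {ffun hvert (hcycle p (k j)) -> 'I_N.+1}}.
Let es N (a : A N) := @image_edges p N.+1 (hcycle p (k (tag a))) (tagged a).
Let cf N (a : A N) : R := tc (tag a) * c ^+ k (tag a).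

Let combE N : @fluctuation_comb N.+1 = fluct T (@es N) (@cf N).
Proof.
apply/funext => w; rewrite /fluctuation_comb /fluct mulr_sumr.
rewrite (eq_bigr (fun j => \sum_(phi : {ffun hvert (hcycle p (k j)) -> 'I_N.+1})
   Num.sqrt N.+1%:R^-1 * (tc j * c ^+ k j * centered T (image_edges phi) w))).
  by rewrite sig_big_dep /=; apply: eq_bigr => a _.
move=> j _; rewrite trace_fluctuationE// 2!mulr_sumr mulr_sumr.
by apply: eq_bigr => phi _; ring.
Qed.

Lemma integr_fluctuation_comb N m :
  integr (P N.+1) (fun w => fluctuation_comb w ^+ m).
Proof. by rewrite combE; exact: (integr_fluct hT). Qed.

Lemma mean_fluctuation_comb N : mean (P N.+1) (@fluctuation_comb N.+1) = 0.
Proof.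
rewrite combE /fluct.
have ic (a : A N) : integr (P N.+1) (centered T (es a)).
  exact: (poly_in_integr hT (poly_in_centered T (es a))).
rewrite meanZ; last by apply: integr_sum => a _; exact: integrZ.
rewrite mean_sum => [|a _]; last exact: integrZ.
by rewrite big1 ?mulr0// => a _; rewrite meanZ// (mean_centered hT) mulr0.
Qed.

Lemma cvg_sqrt_invn : Num.sqrt (N.+1%:R^-1 : R) @[N --> \oo] --> (0 : R).
Proof.
rewrite -[X in _ --> X]sqrtr0.
by apply: (continuous_cvg _ (@sqrt_continuous R 0)); exact: cvg_harmonic.
Qed.

Lemma fluctuation_moment_recursion m :
  mean (P N.+1) (fun w => fluctuation_comb w ^+ m.+2) -
  m.+1%:R * mean (P N.+1) (fun w => fluctuation_comb w ^+ 2) *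
  mean (P N.+1) (fun w => fluctuation_comb w ^+ m) @[N --> \oo] --> (0 : R).
Proof.
(* All constants must be uniform in [N]; [cc] adds up the bounds of [sum_ffun_cover] over the
   cycles. *)
pose L := (\sum_j k j)%N.
pose L' := (\sum_j #|hvert (hcycle p (k j))|)%N.
pose C := \sum_j `|tc j * c ^+ k j|.
pose cc i : R := \sum_j (i + #|hvert (hcycle p (k j))|).+1%:R ^+ #|hvert (hcycle p (k j))|.
have [kappa kappa1 mb] := moment_uniform_bound (m.+2 * L).
apply: (@norm_cvg0 _ R^o).
have bound N := @moment_recursion R p d Om P T M hT N (A N) (@es N) (@cf N)
  C kappa L L' m cc.
apply: (@squeeze_cvgr _ _ _ _ (fun=> 0) (fun N =>
   recursion_constant C kappa L L' m cc * Num.sqrt (N.+1%:R^-1 : R))).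
- near=> N; rewrite normr_ge0 /= combE; apply: bound => //.
  + by move=> a; rewrite size_map size_map size_enum_ord /L (bigD1 (tag a))//= leq_addr.
  + by apply: sumr_ge0.
  + by move=> a; rewrite /C (bigD1 (tag a))//= lerDl sumr_ge0.
  + by move=> i; exact: mb.
  + by move=> E a; exact: image_edges_step.
  + by move=> E a; exact: image_edges_meet.
  + move=> a; rewrite vertices_image_edges// (leq_trans (leq_imset_card _ _))//.
    by rewrite /L' (bigD1 (tag a))//= leq_addr.
  + move=> i j ij; apply: ler_sum => l _; apply: lerXn2r; rewrite ?nnegrE//.
    by rewrite ler_nat ltnS leq_add2r.
  + by move=> i; apply: sumr_ge0 => j _; exact: exprn_ge0.
  + move=> V; rewrite (_ : \sum_(a : A N) _ = \sum_j
      \sum_(phi : {ffun hvert (hcycle p (k j)) -> 'I_N.+1})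
        N.+1%:R^-1 ^+ #|(V :|: vertices (edge_set (image_edges phi)))%SET|); last first.
      by rewrite sig_big_dep /=; apply: eq_bigr.
    rewrite mulr_suml; apply: ler_sum => j _.
    under eq_bigr do rewrite vertices_image_edges//.
    apply: sum_ffun_cover; rewrite ?card_ord//.
- exact: cvg_cst.
- rewrite -[X in _ --> X](mulr0 (recursion_constant C kappa L L' m cc)).
  by apply: cvgM; [exact: cvg_cst|exact: cvg_sqrt_invn].
Unshelve. all: by end_near. Qed.

End LinearCombination.
End HeavyWignerMoments.

(** The recursion is integration by parts for the centred normal law of variance [v]; it also makes
    sense for [v = 0]. *)
Fixpoint gaussian_moment (R : realType) (v : R) (m : nat) : R :=
  if m is m'.+1 then
    if m' is m''.+1 then m''.+1%:R * v * gaussian_moment v m'' else 0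
  else 1.

Lemma gaussian_moment_cvg (R : realType) (e : nat -> nat -> R) (v : R) :
  (forall N, e N 0%N = 1) -> (forall N, e N 1%N = 0) ->
  e N 2%N @[N --> \oo] --> v ->
  (forall m, e N m.+2 - m.+1%:R * e N 2%N * e N m @[N --> \oo] --> (0 : R)) ->
  forall m, e N m @[N --> \oo] --> gaussian_moment v m.
Proof.
move=> e0 e1 e2 er m.
suff : (e N m @[N --> \oo] --> gaussian_moment v m) /\
       (e N m.+1 @[N --> \oo] --> gaussian_moment v m.+1) by case.
elim: m => [|m [IH1 IH2]].
  by split; rewrite /= ?(eq_cvg _ _ e0) ?(eq_cvg _ _ e1); exact: cvg_cst.
split=> //=.
rewrite (_ : (fun N => e N m.+2) = fun N => (e N m.+2 - m.+1%:R * e N 2%N * e N m) +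
    m.+1%:R * e N 2%N * e N m); last by apply/funext => N; rewrite subrK.
rewrite -[X in _ --> X]add0r; apply: cvgD; first exact: er.
by apply: cvgM => //; apply: cvgM => //; exact: cvg_cst.
Qed.

(** * Limiting covariance *)

Section PartitionSum.
Import mathcomp.boot.finset.
Local Close Scope classical_set_scope.
Local Open Scope set_scope.
Variables (V X : finType).
Implicit Types (pi : vpartition V) (phi : {ffun V -> X}).

Definition kernel_partition phi : vpartition V :=
  exist _ (preim_partition phi [set: V]) (preim_partitionP phi [set: V]).

Lemma block_repr pi (B : block pi) : exists x, block_of pi x = B.
Proof.
case: B => B Bpi; have [x xB] : exists x, x \in B.
  apply/set0Pn; apply: contraTneq Bpi => ->.
  by have /and3P[] := valP pi.
exists x; apply: val_inj; apply: def_pblock => //.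
by have /and3P[] := valP pi.
Qed.

Lemma block_of_eq pi x y : (block_of pi x == block_of pi y) =
  (y \in pblock (val pi) x).
Proof.
have tI : trivIset (val pi) by have /and3P[] := valP pi.
have mc z : z \in cover (val pi) by rewrite (cover_partition (valP pi)) inE.
rewrite -(inj_eq val_inj) /= eq_pblock//.
Qed.

Lemma kernel_partitionE pi (psi : {ffun block pi -> X}) :
  (kernel_partition [ffun v => psi (block_of pi v)] == pi) = injectiveb psi.
Proof.
have preE (phi : {ffun V -> X}) x y :
    (y \in pblock (preim_partition phi [set: V]) x) = (phi x == phi y).
  rewrite pblock_equivalence_partition ?inE// => a b c _ _ _ /=.
  by split=> // /eqP ->.
apply/eqP/injectiveP => [kE|inj].
  move=> B1 B2; have [x <-] := block_repr B1; have [y <-] := block_repr B2.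
  move=> xy; apply/eqP; rewrite block_of_eq -{1}kE /= preE !ffunE.
  exact/eqP.
apply: val_inj => /=.
rewrite -[RHS](equivalence_partition_pblock (valP pi)).
apply: eq_imset => x; apply/setP => y; rewrite !inE /=.
by rewrite !ffunE (inj_eq inj) block_of_eq.
Qed.

(** A map factors through the blocks of the partition into its fibres, by an injective map on the
    blocks. This turns sums over all vertex maps into injective traces of quotients, for the cycles
    as well as for the gluings. *)
Lemma sum_partition (W : nmodType) (F : {ffun V -> X} -> W) :
  (\sum_phi F phi = \sum_(pi : vpartition V)
    \sum_(psi : {ffun block pi -> X} | injectiveb psi)
      F [ffun v => psi (block_of pi v)])%R.
Proof.
rewrite (partition_big kernel_partition xpredT)//=; apply: eq_bigr => pi _.
have /choice[rep repE] := @block_repr pi.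
rewrite (reindex_onto (fun psi : {ffun block pi -> X} => [ffun v => psi (block_of pi v)])
  (fun phi : {ffun V -> X} => [ffun B => phi (rep B)])) /=; last first.
  move=> phi /eqP kE; apply/ffunP => v; rewrite !ffunE.
  have /eqP := repE (block_of pi v); rewrite eq_sym block_of_eq.
  rewrite (_ : pblock (val pi) v = pblock (preim_partition phi [set: V]) v); last by rewrite -kE.
  rewrite pblock_equivalence_partition ?inE// => [/eqP//|a b c _ _ _ /=].
  by split=> // /eqP ->.
apply: eq_bigl => psi; rewrite kernel_partitionE andb_idr// => _.
by apply/eqP/ffunP => B; rewrite !ffunE repE.
Qed.

End PartitionSum.

Section CountMultiplicities.
Import mathcomp.boot.finset.
Local Close Scope classical_set_scope.
Local Open Scope set_scope.

(** Only the pattern of equalities among the values matters, and [u] picks a preimage for each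
    value. Consequently the mean of a monomial does not depend on the injective labelling of its
    vertices. *)
Lemma prod_count_map (R : comPzRingType) (U : eqType) (D1 D2 : finType)
    (f1 : U -> D1) (f2 : U -> D2) (s : seq U) (F : nat -> R) :
  (forall e e', (f1 e == f1 e') = (f2 e == f2 e')) ->
  (\prod_(x in [set x in map f1 s]) F (count_mem x (map f1 s)) =
   \prod_(x in [set x in map f2 s]) F (count_mem x (map f2 s)))%R.
Proof.
move=> f12; have [->|[e0 _]] : s = [::] \/ exists e0, e0 \in s.
- by case: s => [|e0 s]; [left|right; exists e0; rewrite inE eqxx].
- by rewrite !big1 // => x; rewrite inE.
pose u (r : D2) := nth e0 s (index r (map f2 s)).
have f2u r : r \in map f2 s -> f2 (u r) = r.
  move=> rs; rewrite /u -(nth_map _ (f2 e0)) ?nth_index//.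
  by rewrite -(size_map f2) index_mem.
rewrite (_ : [set x in map f1 s] = [set f1 (u r) | r in [set x in map f2 s]]).
  rewrite big_imset /=; last first.
    move=> r r'; rewrite !inE => rs rs' /eqP; rewrite f12 !f2u//.
    by move/eqP.
  apply: eq_bigr => r; rewrite inE => rs; congr F.
  rewrite !count_map; apply: eq_count => e /=.
  by rewrite f12 f2u.
apply/setP => x; rewrite inE; apply/mapP/imsetP => [[e es ->]|[r]].
  exists (f2 e); first by rewrite inE map_f.
  by apply/eqP; rewrite f12 f2u// map_f.
rewrite inE => rs ->; exists (u r) => //.
by apply: mem_nth; rewrite -(size_map f2) index_mem.
Qed.

End CountMultiplicities.

Section MeanTrace.
Variables (R : realType) (p : nat).
Hypothesis hp : (2 <= p)%N.
Variables (d : nat -> measure_display) (Om : forall N, measurableType (d N)).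
Variable P : forall N, probability (Om N) R.
Variable T : forall N, p.-tuple 'I_N -> {RV (P N) >-> R}.
Variable M : nat -> R.
Hypothesis hT : heavy_wigner T M.

(** A model labelling by ranks, independent of [N]: hyperedges become tuples of ordinals, which
    [rep] can sort. *)
Definition generic_edges (g : hypergraph p) :=
  image_edges (enum_rank : hvert g -> 'I_#|hvert g|).

Lemma mean_monomial_edge_set N (s : seq (p.-tuple 'I_N.+1)) :
  mean (P N.+1) (monomial T s) =
  \prod_(e in [set e in map (@rep p N.+1) s]%SET) moment T N (count_mem e (map (@rep p N.+1) s)).
Proof.
rewrite (mean_monomial hT) (bigID (mem (edge_set s))) /= [X in _ * X]big1 ?mulr1; last first.
  move=> e /andP[_]; rewrite inE => /count_memPn ->.
  by rewrite moment0.
apply: eq_bigl => e; rewrite /= andb_idl// !inE => /mapP[i _ ->].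
by have := rep_nondecreasing i; rewrite inE.
Qed.

Lemma mean_monomial_injective N (g : hypergraph p) (psi : {ffun hvert g -> 'I_N.+1}) :
  injective psi -> mean (P N.+1) (monomial T (image_edges psi)) =
  \prod_(e in edge_set (generic_edges g))
    moment T N (count_mem e (map (@rep p _) (generic_edges g))).
Proof.
move=> inj; rewrite mean_monomial_edge_set /edge_set /generic_edges /image_edges -!map_comp.
apply: (@prod_count_map _ _ _ _ (fun e => rep (map_tuple psi e))
  (fun e => rep (map_tuple enum_rank e))) => e e'.
rewrite !rep_eq /=; apply/idP/idP => /perm_map_inj H; apply: perm_map; exact: H.
Qed.

Lemma mean_trace0_sum N (g : hypergraph p) :
  mean_trace0 T g N.+1 = N.+1%:R^-1 *
    \sum_(psi : {ffun hvert g -> 'I_N.+1} | injectiveb psi)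
       mean (P N.+1) (monomial T (image_edges psi)).
Proof.
rewrite /mean_trace0 mean_expectation /trace0.
rewrite (_ : (fun w => _) = fun w => N.+1%:R^-1 *
   \sum_(psi : {ffun hvert g -> 'I_N.+1} | injectiveb psi)
       monomial T (image_edges psi) w); last first.
  apply/funext => w; congr (_ * _); apply: eq_bigr => psi _.
  by rewrite /monomial big_map.
rewrite meanZ; last by apply: integr_sum => psi _; exact: (integr_monomial hT).
by rewrite mean_sum// => psi _; exact: (integr_monomial hT).
Qed.

Lemma mean_trace0E N (g : hypergraph p) :
  mean_trace0 T g N.+1 = N.+1%:R^-1 * (N.+1 ^_ #|hvert g|)%:R *
    \prod_(e in edge_set (generic_edges g))
      moment T N (count_mem e (map (@rep p _) (generic_edges g))).
Proof.
rewrite mean_trace0_sum -mulrA; congr (_ * _).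
rewrite [LHS](eq_bigr (fun=> \prod_(e in edge_set (generic_edges g))
    moment T N (count_mem e (map (@rep p _) (generic_edges g))))); last first.
  by move=> psi /injectiveP inj; exact: mean_monomial_injective.
rewrite sumr_const mulr_natl; congr (_ *+ _).
have := card_inj_ffuns (hvert g) (fintype.ordinal N.+1); rewrite card_ord => <-.
by rewrite cardsE; apply: eq_card => f; rewrite !unfold_in.
Qed.

Lemma cvg_ffact V : (N.+1 ^_ V)%:R * N.+1%:R^-1 ^+ V @[N --> \oo] --> (1 : R).
Proof.
elim: V => [|V IHV].
  by under eq_fun do rewrite ffactn0 expr0 mulr1; exact: cvg_cst.
rewrite [X in X @ _ --> _](_ : _ = fun N => ((N.+1 ^_ V)%:R * N.+1%:R^-1 ^+ V) *
    ((N.+1 - V)%:R * N.+1%:R^-1 : R)); last first.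
  by apply/funext => N; rewrite ffactnSr natrM exprSr; ring.
rewrite -[X in _ --> X]mulr1; apply: cvgM => //.
rewrite -[X in _ --> X](subr0 (1:R)) -(mulr0 V%:R).
have : (1 - V%:R * N.+1%:R^-1) @[N --> \oo] --> (1 - V%:R * 0 : R).
  apply: cvgB; first exact: cvg_cst.
  by apply: cvgM; [exact: cvg_cst|exact: cvg_harmonic].
apply: cvg_trans; apply: near_eq_cvg; near=> N.
have VN : (V <= N.+1)%N by rewrite leqW//; near: N; exact: nbhs_infty_ge.
by rewrite natrB// mulrBl divff.
Unshelve. all: by end_near. Qed.

(** About N^V injective maps, a factor N^{-(p-1)} for each edge and the normalisation 1/N leave
    N^{-K} times convergent factors; the hypothesis says that the subtraction defining [K] is not
    truncated. *)
Lemma cvg_mean_trace0 (g : hypergraph p) :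
  (#|hvert g| <= 1 + p.-1 * #|edge_set (generic_edges g)|)%N ->
  cvg (mean_trace0 T g N @[N --> \oo]).
Proof.
set V := #|hvert g|; set E := edge_set _ => VE.
pose cnt e := count_mem e (map (@rep p _) (generic_edges g)).
pose K := (1 + p.-1 * #|E| - V)%N.
suff : cvg (mean_trace0 T g N.+1 @[N --> \oo]).
  by move=> /cvg_ex[l Hl]; apply/cvg_ex; exists l; move: Hl; rewrite cvg_shiftS.
rewrite (_ : (fun N => _) = fun N => ((N.+1 ^_ V)%:R * N.+1%:R^-1 ^+ V) *
   (N.+1%:R^-1 ^+ K *
    \prod_(e in E) (N.+1%:R ^+ p.-1 * moment T N (cnt e)))); last first.
  apply/funext => N; rewrite mean_trace0E big_split /= prodr_const -exprM -[RHS]mulrA.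
  have n0 : N.+1%:R != 0 :> R by [].
  have -> : N.+1%:R^-1 ^+ V * (N.+1%:R^-1 ^+ K * (N.+1%:R ^+ (p.-1 * #|E|) *
      \prod_(e in E) moment T N (cnt e))) = N.+1%:R^-1 * \prod_(e in E) moment T N (cnt e) :> R.
    rewrite !mulrA -exprD subnKC// exprD expr1 -[N.+1%:R^-1 * _ * _]mulrA -exprMn.
    by rewrite mulVf// expr1n mulr1.
  by rewrite -/V -/E mulrCA mulrA.
have cvgE (e : p.-tuple 'I_V) : e \in E ->
    cvg ((N.+1%:R ^+ p.-1 * moment T N (cnt e) : R) @[N --> \oo]).
  rewrite inE => eE.
  have : (0 < cnt e)%N by rewrite -has_count has_pred1.
  case: (cnt e) => [|[|m]] // _.
    by apply: cvgP; under eq_fun do rewrite (moment1 hT) mulr0; exact: cvg_cst.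
  by apply: cvgP; exact: (moment_cvg hT).
apply: is_cvgM; first by apply: cvgP; exact: cvg_ffact.
apply: is_cvgM.
  elim: K => [|K IHK]; first by under eq_fun do rewrite expr0; exact: is_cvg_cst.
  by under eq_fun do rewrite exprS; apply: is_cvgM => //; apply: cvgP; exact: cvg_harmonic.
have : {subset enum E <= E} by move=> e; rewrite mem_enum.
under eq_fun do rewrite -big_enum /=.
elim: (enum E) => [|e s IHs] sE.
  by under eq_fun do rewrite big_nil; exact: is_cvg_cst.
under eq_fun do rewrite big_cons; apply: is_cvgM.
  by apply: cvgE; apply: sE; rewrite inE eqxx.
by apply: IHs => e' e's; apply: sE; rewrite inE e's orbT.
Qed.

End MeanTrace.

(** * Gluings of two hypergraphs and pairs of vertex maps *)

Section Gluing.
Import mathcomp.boot.finset.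
Local Close Scope classical_set_scope.
Local Open Scope set_scope.
Variables (p k1 k2 : nat).
Hypotheses (hp : (2 <= p)%N) (k1_gt0 : (0 < k1)%N) (k2_gt0 : (0 < k2)%N).

Lemma image_edges_quotient N (g : hypergraph p) (pi : vpartition (hvert g))
    (psi : block pi -> 'I_N) :
  image_edges (psi : hvert (hquotient pi) -> 'I_N) =
  image_edges (fun v => psi (block_of pi v)).
Proof.
rewrite /image_edges /= -map_comp; apply: eq_map => e /=.
by apply: val_inj; rewrite /= -map_comp.
Qed.

Lemma image_edges_union N (g1 g2 : hypergraph p) (psi : hvert g1 + hvert g2 -> 'I_N) :
  image_edges (psi : hvert (hunion g1 g2) -> 'I_N) =
  image_edges (fun v => psi (inl v)) ++ image_edges (fun v => psi (inr v)).
Proof.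
rewrite /image_edges /= map_cat -!map_comp; congr (_ ++ _); apply: eq_map => e /=;
  by apply: val_inj; rewrite /= -map_comp.
Qed.

Lemma eq_image_edges N (g : hypergraph p) (f f' : hvert g -> 'I_N) :
  f =1 f' -> image_edges f = image_edges f'.
Proof.
by move=> ff'; apply: eq_map => e; apply: val_inj => /=; exact: eq_map.
Qed.

Lemma edge_set_meet N (g1 g2 : hypergraph p) (f1 : hvert g1 -> 'I_N) (f2 : hvert g2 -> 'I_N) :
  ~~ [disjoint edge_set (image_edges f1) & edge_set (image_edges f2)] =
  has (fun e1 : p.-tuple (hvert g1) => has (fun e2 : p.-tuple (hvert g2) =>
     perm_eq (map_tuple f1 e1) (map_tuple f2 e2)) (hedges g2)) (hedges g1).
Proof.
apply/idP/hasP => [/pred0Pn[e /= /andP[]]|[e1 e1g /hasP[e2 e2g pe]]].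
  rewrite !inE -!map_comp => /mapP[e1 e1g ->] /mapP[e2 e2g /eqP].
  by rewrite rep_eq => H; exists e1 => //; apply/hasP; exists e2.
apply/pred0Pn; exists (rep (map_tuple f1 e1)); rewrite /= !inE.
apply/andP; split; first by do 2 apply: map_f.
by move: pe; rewrite -rep_eq => /eqP ->; do 2 apply: map_f.
Qed.

(** Read through an injective labelling of the blocks, the condition on blocks says that the
    labelling is injective on each of the two vertex sets, and a common hyperedge becomes a common
    element of the edge sets. *)
Lemma edge_gluingP N (g1 g2 : hypergraph p)
    (sigma : vpartition (hvert (hunion g1 g2))) (psi : {ffun block sigma -> 'I_N}) :
  injective psi ->
  edge_gluing sigma =
  [&& injectiveb [ffun v => psi (block_of sigma (inl v))],
      injectiveb [ffun v => psi (block_of sigma (inr v))] &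
      ~~ [disjoint edge_set (image_edges (fun v => psi (block_of sigma (inl v))))
        & edge_set (image_edges (fun v => psi (block_of sigma (inr v))))]].
Proof.
move=> inj; rewrite edge_set_meet /edge_gluing andbA; congr andb; last first.
  apply: eq_has => e1; apply: eq_has => e2 /=.
  rewrite [RHS](_ : _ = perm_eq (map psi (map (fun v => block_of sigma (inl v)) e1))
    (map psi (map (fun v => block_of sigma (inr v)) e2))); last by rewrite -!map_comp.
  by apply/idP/idP => [|/perm_map_inj]; [exact: perm_map|exact].
have tI : trivIset (val sigma) by have /and3P[] := valP sigma.
have mc z : z \in cover (val sigma) by rewrite (cover_partition (valP sigma)) inE.
have blk (B : {set _}) x y : B \in val sigma -> x \in B -> y \in B ->
    block_of sigma x = block_of sigma y.
  by move=> Bs xB yB; apply: val_inj; rewrite /= (def_pblock tI Bs xB) (def_pblock tI Bs yB).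
apply/forall_inP/andP => [H|[/injectiveP i1 /injectiveP i2] B Bs].
  split; apply/injectiveP => x y; rewrite !ffunE => /inj /eqP; rewrite block_of_eq => yx.
    have /andP[/card_le1_eqP h _] := H _ (block_of_subproof sigma (inl x)).
    by apply: h; rewrite inE ?mem_pblock ?mc.
  have /andP[_ /card_le1_eqP h] := H _ (block_of_subproof sigma (inr x)).
  by apply: h; rewrite inE ?mem_pblock ?mc.
apply/andP; split; apply/card_le1_eqP => x y; rewrite !inE => xB yB.
  by apply: i1; rewrite !ffunE (blk B (inl x) (inl y)).
by apply: i2; rewrite !ffunE (blk B (inr x) (inr y)).
Qed.

(** The first cycle opens one component and the second, sharing an edge with it, opens none. This
    gives the hypothesis of [cvg_mean_trace0] for glued cycles and the counting bound for linked
    pairs. *)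
Lemma card_vertices_meet N (f1 : hvert (hcycle p k1) -> 'I_N)
    (f2 : hvert (hcycle p k2) -> 'I_N) :
  ~~ [disjoint edge_set (image_edges f1) & edge_set (image_edges f2)] ->
  (#|[set f1 v | v in hvert (hcycle p k1)] :|: [set f2 v | v in hvert (hcycle p k2)]|
   <= 1 + p.-1 * #|edge_set (image_edges f1) :|: edge_set (image_edges f2)|)%N.
Proof.
move=> meet; have := image_edges_meet hp k2_gt0 meet.
have := image_edges_step hp k1_gt0 f1 set0.
rewrite !set0U [vertices set0]big_set0 !cards0 muln0 addn0 add0n.
rewrite verticesU !vertices_image_edges// => h1 h2.
by rewrite -(leq_add2r (p.-1 * #|edge_set (image_edges f1)|)) (leq_trans h2)// addnAC
  leq_add2r addnC.
Qed.

Lemma card_glued (pi1 : vpartition (hvert (hcycle p k1)))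
    (pi2 : vpartition (hvert (hcycle p k2)))
    (sigma : vpartition (hvert (hunion (hquotient pi1) (hquotient pi2)))) :
  edge_gluing sigma ->
  (#|hvert (hquotient sigma)| <=
     1 + p.-1 * #|edge_set (generic_edges (hquotient sigma))|)%N.
Proof.
pose psi : {ffun block sigma -> 'I_#|{: block sigma}|} := [ffun B => enum_rank B].
have inj : injective psi by move=> B B'; rewrite !ffunE => /enum_rank_inj.
rewrite (edge_gluingP inj) => /and3P[_ _].
rewrite !image_edges_quotient => /card_vertices_meet H.
rewrite /generic_edges.
have -> : image_edges (enum_rank : hvert (hquotient sigma) -> _) =
    image_edges (psi : hvert (hquotient sigma) -> _).
  by apply: eq_image_edges => B; rewrite ffunE.
rewrite image_edges_quotient image_edges_union !image_edges_quotient edge_set_cat.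
apply: leq_trans H.
(* Every block contains the class of a vertex of one of the cycles, so the two images cover all
   labels. *)
apply: (@leq_trans #|[set: 'I_#|{: block sigma}|]|); first by rewrite cardsT card_ord.
apply: subset_leq_card; apply/fintype.subsetP => i _; rewrite inE.
have [x xi] := block_repr (enum_val i : block sigma).
have -> : i = psi (block_of sigma x) by rewrite ffunE xi enum_valK.
case: x {xi} => x; have [v <-] := block_repr x; apply/orP; [left|right];
  exact: imset_f.
Qed.

End Gluing.

Lemma cvg_sumr (R : realType) (I : finType) (Q : pred I) (F : I -> nat -> R) (l : I -> R) :
  (forall i, Q i -> F i n @[n --> \oo] --> l i) ->
  \sum_(i | Q i) F i n @[n --> \oo] --> \sum_(i | Q i) l i.
Proof.
by move=> H; apply: cvg_big => //; exact: add_continuous.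
Qed.

(** * Limit of the covariances *)

Section CovarianceLimit.
Variables (R : realType) (p : nat).
Hypothesis hp : (2 <= p)%N.
Variables (d : nat -> measure_display) (Om : forall N, measurableType (d N)).
Variable P : forall N, probability (Om N) R.
Variable T : forall N, p.-tuple 'I_N -> {RV (P N) >-> R}.
Variable M : nat -> R.
Hypothesis hT : heavy_wigner T M.
Local Notation EE N := (mean (P N.+1)).
Local Notation h N := (N.+1%:R^-1 : R).

Lemma glued_mean_trace0_cvg (k1 k2 : nat) (pi1 : vpartition (hvert (hcycle p k1)))
    (pi2 : vpartition (hvert (hcycle p k2)))
    (sigma : vpartition (hvert (hunion (hquotient pi1) (hquotient pi2)))) :
  (0 < k1)%N -> (0 < k2)%N -> edge_gluing sigma ->
  cvg (mean_trace0 T (hquotient sigma) N @[N --> \oo]).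
Proof.
by move=> k10 k20 glue; apply: (cvg_mean_trace0 hT); exact: (card_glued hp).
Qed.

Local Close Scope classical_set_scope.

Definition linked N (g1 g2 : hypergraph p) (f1 : hvert g1 -> 'I_N) (f2 : hvert g2 -> 'I_N) :=
  ~~ [disjoint edge_set (image_edges f1) & edge_set (image_edges f2)].

Let G N (g1 g2 : hypergraph p) (f1 : hvert g1 -> 'I_N.+1) (f2 : hvert g2 -> 'I_N.+1) :=
  if linked f1 f2
  then h N * EE N (monomial T (image_edges f1 ++ image_edges f2)) else 0.

(** A pair of injective maps is a map on the disjoint union with injective restrictions. Grouping
    such maps by the partition into fibres, [edge_gluingP] shows that the linked pairs are those
    whose partition is an edge gluing. *)
Lemma sum_edge_gluing N (g1 g2 : hypergraph p) :
  \sum_(f1 : {ffun hvert g1 -> 'I_N.+1} | injectiveb f1)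
    \sum_(f2 : {ffun hvert g2 -> 'I_N.+1} | injectiveb f2) G f1 f2 =
  \sum_(sigma : vpartition (hvert (hunion g1 g2)) | edge_gluing sigma)
    mean_trace0 T (hquotient sigma) N.+1.
Proof.
pose joined (phi : {ffun hvert g1 + hvert g2 -> 'I_N.+1}) :=
  injectiveb [ffun v => phi (inl v)] && injectiveb [ffun v => phi (inr v)].
transitivity (\sum_(phi : {ffun hvert g1 + hvert g2 -> 'I_N.+1} | joined phi)
    G (g1 := g1) (g2 := g2) (fun v => phi (inl v)) (fun v => phi (inr v))).
  rewrite pair_big_dep /=.
  rewrite [RHS](reindex (fun x : {ffun hvert g1 -> 'I_N.+1} * {ffun hvert g2 -> 'I_N.+1} =>
     [ffun v => match v with inl v => x.1 v | inr v => x.2 v end])) /=; last first.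
    exists (fun phi : {ffun hvert g1 + hvert g2 -> 'I_N.+1} =>
      ([ffun v => phi (inl v)], [ffun v => phi (inr v)])).
      by move=> [f1 f2] _ /=; congr pair; apply/ffunP => v; rewrite !ffunE.
    by move=> phi _; apply/ffunP => -[v|v]; rewrite !ffunE.
  apply: eq_big => [[f1 f2]|[f1 f2] _] /=.
    rewrite /joined; congr andb; congr (injectiveb (fun_of_fin _));
      by apply/ffunP => v; rewrite !ffunE.
  pose f12 : {ffun hvert g1 + hvert g2 -> 'I_N.+1} :=
    [ffun v => match v with inl v => f1 v | inr v => f2 v end].
  have e1 : image_edges f1 = @image_edges p N.+1 g1 (fun v => f12 (inl v)).
    by apply: eq_image_edges => v; rewrite !ffunE.
  have e2 : image_edges f2 = @image_edges p N.+1 g2 (fun v => f12 (inr v)).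
    by apply: eq_image_edges => v; rewrite !ffunE.
  by rewrite /G /linked e1 e2.
rewrite big_mkcond sum_partition [RHS]big_mkcond /=; apply: eq_bigr => sigma _.
transitivity (\sum_(psi : {ffun block sigma -> 'I_N.+1} | injectiveb psi)
  (if @edge_gluing p g1 g2 sigma then
    h N * EE N (monomial T (@image_edges p N.+1 (@hquotient p (hunion g1 g2) sigma) psi))
   else 0)).
  apply: eq_bigr => psi /injectiveP inj.
  rewrite (@edge_gluingP p N.+1 g1 g2 sigma psi inj).
  rewrite (@image_edges_quotient p N.+1 (hunion g1 g2) sigma psi) image_edges_union.
  have el : image_edges (fun v : hvert g1 => [ffun v => psi (block_of sigma v)] (inl v)) =
     image_edges (fun v : hvert g1 => psi (block_of sigma (inl v))).
    by apply: eq_image_edges => v; rewrite ffunE.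
  have er : image_edges (fun v : hvert g2 => [ffun v => psi (block_of sigma v)] (inr v)) =
     image_edges (fun v : hvert g2 => psi (block_of sigma (inr v))).
    by apply: eq_image_edges => v; rewrite ffunE.
  rewrite /G /linked el er andbA /joined.
  have -> : [ffun v : hvert g1 => [ffun v => psi (block_of sigma v)] (inl v)] =
     [ffun v : hvert g1 => psi (block_of sigma (inl v))].
    by apply/ffunP => v; rewrite !ffunE.
  have -> : [ffun v : hvert g2 => [ffun v => psi (block_of sigma v)] (inr v)] =
     [ffun v : hvert g2 => psi (block_of sigma (inr v))].
    by apply/ffunP => v; rewrite !ffunE.
  by case: ifP.
case: ifP => glue; last by rewrite big1.
by rewrite (mean_trace0_sum hT) mulr_sumr.
Qed.

Variables (k1 k2 : nat).
Hypotheses (k1_gt0 : (0 < k1)%N) (k2_gt0 : (0 < k2)%N).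
Let V1 := hvert (hcycle p k1).
Let V2 := hvert (hcycle p k2).

Lemma sum_linked N :
  \sum_(f1 : {ffun V1 -> 'I_N.+1}) \sum_(f2 : {ffun V2 -> 'I_N.+1}
      | @linked _ (hcycle p k1) (hcycle p k2) f1 f2)
    h N * EE N (monomial T (image_edges f1 ++ image_edges f2)) =
  \sum_(pi1 : vpartition V1) \sum_(pi2 : vpartition V2)
    \sum_(sigma : vpartition (hvert (hunion (hquotient pi1) (hquotient pi2)))
       | edge_gluing sigma) mean_trace0 T (hquotient sigma) N.+1.
Proof.
transitivity (\sum_(f1 : {ffun V1 -> 'I_N.+1}) \sum_(f2 : {ffun V2 -> 'I_N.+1})
    G (g1 := hcycle p k1) (g2 := hcycle p k2) f1 f2).
  by apply: eq_bigr => f1 _; rewrite big_mkcond.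
rewrite sum_partition; apply: eq_bigr => pi1 _.
under eq_bigr do rewrite sum_partition.
rewrite exchange_big /=; apply: eq_bigr => pi2 _.
apply: etrans (sum_edge_gluing N (hquotient pi1) (hquotient pi2)).
apply: eq_bigr => f1 _; apply: eq_bigr => f2 _.
have e1 : @image_edges p N.+1 (hcycle p k1) [ffun v => f1 (block_of pi1 v)] =
    @image_edges p N.+1 (hquotient pi1) f1.
  by rewrite image_edges_quotient; apply: eq_image_edges => v; rewrite ffunE.
have e2 : @image_edges p N.+1 (hcycle p k2) [ffun v => f2 (block_of pi2 v)] =
    @image_edges p N.+1 (hquotient pi2) f2.
  by rewrite image_edges_quotient; apply: eq_image_edges => v; rewrite ffunE.
by rewrite /G /linked e1 e2.
Qed.

Local Open Scope classical_set_scope.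

Lemma cvg_sum_linked :
  \sum_(f1 : {ffun V1 -> 'I_N.+1}) \sum_(f2 : {ffun V2 -> 'I_N.+1} | @linked _ (hcycle p k1) (hcycle p k2) f1 f2)
    h N * EE N (monomial T (image_edges f1 ++ image_edges f2)) @[N --> \oo] -->
  \sum_(pi1 : vpartition V1) \sum_(pi2 : vpartition V2)
    limit_covariance T (hquotient pi1) (hquotient pi2).
Proof.
under eq_fun do rewrite sum_linked.
apply: cvg_sumr => pi1 _; apply: cvg_sumr => pi2 _; apply: cvg_sumr => sigma glue.
by move: (glued_mean_trace0_cvg k1_gt0 k2_gt0 glue); rewrite -cvg_shiftS.
Qed.

(** Linked maps share an edge, so their numbers of edges add up to at least one more than the size
    of the union: the product of means carries an extra factor [q], at most [h N] since [p >= 2].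
    With [card_vertices_meet] the whole sum is then of order [h N]. *)
Lemma cvg_sum_linked_product :
  \sum_(f1 : {ffun V1 -> 'I_N.+1}) \sum_(f2 : {ffun V2 -> 'I_N.+1} | @linked _ (hcycle p k1) (hcycle p k2) f1 f2)
    h N * (EE N (monomial T (image_edges f1)) * EE N (monomial T (image_edges f2)))
    @[N --> \oo] --> (0 : R).
Proof.
have [kappa kappa1 mb] := moment_uniform_bound hT (k1 + k2).
pose K := kappa ^+ (k1 + k2); have kappa0 : 0 <= kappa by exact: le_trans kappa1.
have K0 : 0 <= K by exact: exprn_ge0.
pose n1 := #|V1|; pose n2 := #|V2|.
pose B : R := (n1 + n2).+1%:R ^+ n2 * n1.+1%:R ^+ n1.
apply: (@norm_cvg0 _ R^o).
apply: (@squeeze_cvgr _ _ _ _ (fun=> 0) (fun N => K * K * B * h N)); last 2 first.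
- exact: cvg_cst.
- rewrite -[X in _ --> X](mulr0 (K * K * B)).
  by apply: cvgM; [exact: cvg_cst|exact: cvg_harmonic].
near=> N; rewrite normr_ge0 /=.
set q := h N ^+ p.-1.
have h0 : 0 <= h N by rewrite invr_ge0.
have h1 : h N <= 1 by rewrite invf_le1// ler1n.
have q0 : 0 <= q by exact: exprn_ge0.
have q1 : q <= 1 by exact: exprn_ile1.
have qh : q <= h N.
  rewrite /q; case: p hp => [|[|p']] // _; rewrite exprS ler_piMr//; exact: exprn_ile1.
have mono_le k (f : hvert (hcycle p k) -> 'I_N.+1) : (k <= k1 + k2)%N ->
    `|EE N (monomial T (image_edges f))| <= K * q ^+ #|edge_set (image_edges f)|.
  move=> kk; apply: (norm_mean_monomial hT kappa1 q0) => [|j jk]; last exact: mb.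
  by rewrite size_map size_map size_enum_ord.
apply: (le_trans (ler_norm_sum _ _ _)).
apply: (@le_trans _ _ (\sum_(f1 : {ffun V1 -> 'I_N.+1}) \sum_(f2 : {ffun V2 -> 'I_N.+1})
  K * K * h N * h N ^+ #|([set f1 v | v in V1] :|: [set f2 v | v in V2])%SET|)).
  apply: ler_sum => f1 _; apply: (le_trans (ler_norm_sum _ _ _)).
  rewrite big_mkcond; apply: ler_sum => f2 _; case: ifP => [lk|_]; last first.
    by rewrite !mulr_ge0// exprn_ge0.
  rewrite normrM (ger0_norm h0) normrM.
  have H := ler_pM (normr_ge0 _) (normr_ge0 _) (mono_le _ f1 (leq_addr _ _)) (mono_le _ f2 (leq_addl _ _)).
  apply: (le_trans (ler_wpM2l h0 H)).
  set E1 := edge_set (image_edges f1); set E2 := edge_set (image_edges f2).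
  have E12 : (#|(E1 :|: E2)%SET|.+1 <= #|E1| + #|E2|)%N.
    rewrite finset.cardsU -subSn; last first.
      by rewrite (leq_trans (subset_leq_card (finset.subsetIl _ _)))// leq_addr.
    have : (0 < #|(E1 :&: E2)%SET|)%N.
      rewrite lt0n; apply: contra lk; rewrite finset.cards_eq0 => /eqP E0.
      by rewrite -finset.setI_eq0 E0.
    by move=> ?; rewrite leq_subLR -add1n leq_add2r.
  rewrite [X in _ * X]mulrACA [leLHS]mulrCA.
  rewrite -[leRHS]mulrA; apply: ler_wpM2l; first exact: mulr_ge0.
  rewrite -exprD; apply: ler_wpM2l => //.
  apply: (@le_trans _ _ (q * q ^+ #|(E1 :|: E2)%SET|)).
    by rewrite -exprS; apply: ler_wiXn2l.
  apply: (@le_trans _ _ (h N * q ^+ #|(E1 :|: E2)%SET|)).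
    by apply: ler_wpM2r => //; exact: exprn_ge0.
  rewrite /q -exprM -exprS; apply: ler_wiXn2l => //.
  exact: (card_vertices_meet hp).
under eq_bigr do rewrite -mulr_sumr.
rewrite -mulr_sumr -[leRHS]mulrA [B * _]mulrC mulrA.
apply: ler_wpM2l; first by rewrite !mulr_ge0.
have hE : h N = #|{: 'I_N.+1}|%:R^-1 by rewrite card_ord.
have cI : (0 < #|{: 'I_N.+1}|)%N by rewrite card_ord.
apply: (@le_trans _ _ (\sum_(f1 : {ffun V1 -> 'I_N.+1})
   (n1 + n2).+1%:R ^+ n2 * h N ^+ #|([set f1 v | v in V1])%SET|)).
  apply: ler_sum => f1 _; apply: (le_trans (sum_ffun_cover h0 _ _ hE cI)).
  apply: ler_wpM2r; first exact: exprn_ge0.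
  apply: lerXn2r; rewrite ?nnegrE// ler_nat ltnS leq_add2r.
  exact: leq_imset_card.
rewrite -mulr_sumr; apply: ler_wpM2l; first exact: exprn_ge0.
have := sum_ffun_cover h0 V1 finset.set0 hE cI.
rewrite finset.cards0 add0n expr0 mulr1.
by under eq_bigr do rewrite finset.set0U.
Unshelve. all: by end_near. Qed.

Lemma mean_centeredM N (s1 s2 : seq (p.-tuple 'I_N.+1)) :
  EE N (fun w => centered T s1 w * centered T s2 w) =
  EE N (monomial T (s1 ++ s2)) - EE N (monomial T s1) * EE N (monomial T s2).
Proof.
have im s := integr_monomial hT (s : seq (p.-tuple 'I_N.+1)).
rewrite (_ : (fun w => _) = fun w => (monomial T (s1 ++ s2) w - EE N (monomial T s1) * monomial T s2 w)
   - EE N (monomial T s2) * centered T s1 w); last first.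
  by apply/funext => w; rewrite monomial_cat /centered; ring.
have ic := poly_in_integr hT (poly_in_centered T s1).
rewrite meanB ?meanZ ?(mean_centered hT) ?mulr0 ?subr0//; last 2 first.
- by apply: integrB => //; exact: integrZ.
- exact: integrZ.
by rewrite meanB ?meanZ//; exact: integrZ.
Qed.

Variable M2 : R.
Hypothesis M2_gt0 : 0 < M2.
Let c := (Num.sqrt (M2 * (p.-2)`!%:R))^-1.

Lemma cvg_covariance :
  EE N (fun w => trace_fluctuation T M2 k1 w * trace_fluctuation T M2 k2 w)
    @[N --> \oo] --> cycle_covariance T M2 k1 k2.
Proof.
have x0 : 0 < M2 * (p.-2)`!%:R by rewrite mulr_gt0// ltr0n fact_gt0.
have cE : ((((p.-2)`!%:R * M2) `^ ((k1 + k2)%:R / 2))^-1 : R) = c ^+ (k1 + k2).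
  rewrite mulrC /c exprVn; congr (_^-1).
  rewrite -[Num.sqrt _]powR12_sqrt; last exact: ltW.
  by rewrite -powR_mulrn ?powR_ge0// -powRrM [2^-1 * _]mulrC.
rewrite /cycle_covariance cE.
have step N : EE N (fun w => trace_fluctuation T M2 k1 w * trace_fluctuation T M2 k2 w) =
   c ^+ (k1 + k2) * (
  \sum_(f1 : {ffun V1 -> 'I_N.+1}) \sum_(f2 : {ffun V2 -> 'I_N.+1} | @linked _ (hcycle p k1) (hcycle p k2) f1 f2)
    h N * EE N (monomial T (image_edges f1 ++ image_edges f2)) -
  \sum_(f1 : {ffun V1 -> 'I_N.+1}) \sum_(f2 : {ffun V2 -> 'I_N.+1} | @linked _ (hcycle p k1) (hcycle p k2) f1 f2)
    h N * (EE N (monomial T (image_edges f1)) * EE N (monomial T (image_edges f2)))).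
  pose F (f1 : {ffun V1 -> 'I_N.+1}) (f2 : {ffun V2 -> 'I_N.+1}) w :=
     centered T (image_edges f1) w * centered T (image_edges f2) w.
  have iF f1 f2 : integr (P N.+1) (F f1 f2).
    exact: (poly_in_integr hT (poly_inM (poly_in_centered T _) (poly_in_centered T _))).
  rewrite (_ : (fun w => _) = fun w => c ^+ (k1 + k2) *
      \sum_(f1 : {ffun V1 -> 'I_N.+1}) \sum_(f2 : {ffun V2 -> 'I_N.+1}) h N * F f1 f2 w); last first.
    apply/funext => w; rewrite !(trace_fluctuationE hT)// exprD.
    under [in RHS]eq_bigr do rewrite -mulr_sumr.
    rewrite -mulr_sumr; under [in RHS]eq_bigr do rewrite /F -mulr_sumr.
    rewrite -mulr_suml.
    have h0 : 0 <= h N by rewrite invr_ge0.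
    by rewrite -{3}(sqr_sqrtr h0) -/c; ring.
  have iF1 f1 : integr (P N.+1) (fun w => \sum_(f2 : {ffun V2 -> 'I_N.+1}) h N * F f1 f2 w).
    by apply: integr_sum => f2 _; exact: integrZ.
  rewrite meanZ; last exact: integr_sum.
  congr (_ * _); rewrite mean_sum// -sumrB; apply: eq_bigr => f1 _.
  rewrite mean_sum => [|f2 _]; last exact: integrZ.
  rewrite -sumrB [RHS]big_mkcond; apply: eq_bigr => f2 _.
  rewrite meanZ// mean_centeredM mulrBr; case: ifPn => //.
  by rewrite /linked negbK => dis; rewrite (mean_monomial_cat hT dis) subrr.
under eq_fun do rewrite step.
apply: cvgM; first exact: cvg_cst.
rewrite -[X in _ --> X]subr0; apply: cvgB; first exact: cvg_sum_linked.
exact: cvg_sum_linked_product.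
Qed.

End CovarianceLimit.

(** * From moments to weak convergence *)

Section CosTaylor.
Variable R : realType.
Implicit Types x b : R.

(** Taylor polynomial at 0 of [cos (x + b)]: each derivative shifts the phase by [pi / 2], so sines
    need no separate treatment. *)
Definition cos_taylor M b x : R :=
  \sum_(m < M) cos (b + m%:R * (pi / 2)) * (x ^+ m / m`!%:R).

Lemma is_derive_monomial m (c x : R) :
  is_derive x 1 (fun y : R => c * (y ^+ m.+1 / (m.+1)`!%:R)) (c * (x ^+ m / m`!%:R)).
Proof.
rewrite (_ : (fun y => _) = (c / (m.+1)`!%:R) \*: ((@id R) ^+ m.+1)); last first.
  have expE k y : ((@id R) ^+ k) y = y ^+ k by elim: k => // k IHk; rewrite !exprS -IHk.
  apply/funext => y; rewrite /= expE -[RHS]/(_ * _); ring.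
apply: is_derive_eq; rewrite /GRing.scale /= mulr1 factS natrM.
have f0 : m`!%:R != 0 :> R by rewrite pnatr_eq0 -lt0n fact_gt0.
by field; rewrite f0 /= -(natrD _ 1) pnatr_eq0.
Qed.

Lemma is_derive_cos_taylor M b x :
  is_derive x 1 (cos_taylor M.+1 b) (cos_taylor M (b + pi / 2) x).
Proof.
elim: M => [|M IHM].
  rewrite /cos_taylor big_ord0 (_ : (fun _ => _) = cst (cos b)).
    exact: is_derive_cst.
  by apply/funext => y; rewrite big_ord1 expr0 fact0 divr1 mulr1 mul0r addr0.
rewrite (_ : cos_taylor M.+2 b = cos_taylor M.+1 b +
   (fun y => cos (b + M.+1%:R * (pi / 2)) * (y ^+ M.+1 / (M.+1)`!%:R))); last first.
  by apply/funext => y; rewrite /cos_taylor big_ord_recr.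
rewrite /cos_taylor big_ord_recr /=; apply: is_deriveD.
rewrite (_ : b + pi / 2 + _ = b + M.+1%:R * (pi / 2)); last first.
  by rewrite -[in RHS]natr1; ring.
exact: is_derive_monomial.
Qed.

Lemma is_derive_cosD b x : is_derive x 1 (fun y => cos (y + b)) (- sin (x + b)).
Proof.
have H : is_derive x 1 (fun y : R => y + b) 1.
  by rewrite -[X in is_derive _ _ _ X]addr0; apply: is_deriveD.
have := @is_derive1_comp R cos (fun y : R => y + b) x (- sin (x + b)) 1 (is_derive_cos _) H.
by rewrite mulr1.
Qed.

(** The derivative of the remainder is the remainder of one order less with phase [b + pi / 2]. The
    mean value theorem then bounds it by the primitive of the previous bound, the sign [s] giving
    both sides. *)
Let nonneg_taylor M : forall b x, 0 <= x ->
  `|cos (x + b) - cos_taylor M b x| <= x ^+ M / M`!%:R.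
Proof.
elim: M => [|M IHM] b x x0.
  by rewrite /cos_taylor big_ord0 subr0 expr0 fact0 divr1; exact: cos_max.
pose rest (y : R) : R := cos (y + b) - cos_taylor M.+1 b y.
have dr (y : R) : is_derive y 1 rest (cos (y + (b + pi / 2)) - cos_taylor M (b + pi / 2) y).
  have d1 := is_derive_cosD b y; have d2 := is_derive_cos_taylor M b y.
  rewrite addrA cosDpihalf; exact: is_deriveB.
have rest0 : rest 0 = 0.
  rewrite /rest /cos_taylor big_ord_recl /= big1 => [|i _]; last by rewrite exprS !mul0r mulr0.
  by rewrite add0r mul0r addr0 expr0 fact0 divr1 mulr1 addr0 subrr.
have main (s : R) : s = 1 \/ s = -1 -> s * rest x <= x ^+ M.+1 / (M.+1)`!%:R.
  move=> s1; pose g (y : R) : R := 1 * (y ^+ M.+1 / (M.+1)`!%:R) - s * rest y.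
  have dg (y : R) : is_derive y 1 g (1 * (y ^+ M / M`!%:R) -
      s * (cos (y + (b + pi / 2)) - cos_taylor M (b + pi / 2) y)).
    have d1 := is_derive_monomial M 1 y; have d2 := is_deriveZ s (dr y).
    exact: is_deriveB.
  have cg : {within `[0, x], continuous g}.
    apply: continuous_subspaceT => y; apply: differentiable_continuous.
    by apply/derivable1_diffP; have [] := dg y.
  have [c /[!in_itv]/= /andP[c0 cx]] := MVT_segment x0 (fun y _ => dg y) cg.
  have -> : g 0 = 0 by rewrite /g exprS rest0; ring.
  rewrite !subr0 => gx.
  suff : 0 <= g x by rewrite /g mul1r subr_ge0.
  rewrite gx mulr_ge0// mul1r subr_ge0 (le_trans _ (IHM (b + pi / 2) c c0))//.
  by case: s1 => ->; rewrite ?mul1r ?mulN1r ?ler_norm// -normrN ler_norm.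
rewrite ler_norml -/(rest x); apply/andP; split.
  by rewrite lerNl -mulN1r main//; right.
by rewrite -[leLHS]mul1r main//; left.
Qed.

Lemma norm_cos_taylor M b x :
  `|cos (x + b) - cos_taylor M b x| <= `|x| ^+ M / M`!%:R.
Proof.
have [x0|x0] := lerP 0 x; first by rewrite (ger0_norm x0); exact: nonneg_taylor.
have nx0 : 0 <= - x by rewrite oppr_ge0 ltW.
(* Parity: [cos] is even, and in the Taylor polynomial the signs of the powers of [- x] are
   compensated by the change of phase from [b] to [- b]. *)
have := nonneg_taylor M (- b) nx0.
rewrite -opprD cosN (ltr0_norm x0).
rewrite (_ : cos_taylor M (- b) (- x) = cos_taylor M b x)//.
apply: eq_bigr => m _; rewrite exprNn.
suff -> : cos (- b + m%:R * (pi / 2)) = (-1) ^+ m * cos (b + m%:R * (pi / 2)).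
  have s2 : (-1) ^+ m * (-1) ^+ m = 1 :> R by rewrite -exprMn mulrNN mulr1 expr1n.
  rewrite [LHS](_ : _ = (-1) ^+ m * (-1) ^+ m * (cos (b + m%:R * (pi / 2)) * (x ^+ m / m`!%:R))).
    by rewrite s2 mul1r.
  by rewrite -[X in _ * X = _]mulrA mulrACA.
rewrite -cosN opprD opprK.
have cosBpi n (y : R) : cos (y - n%:R * pi) = (-1) ^+ n * cos y.
  elim: n => [|n IHn]; first by rewrite mul0r subr0 expr0 mul1r.
  rewrite exprS -mulrA -IHn mulN1r.
  rewrite (_ : y - n%:R * pi = y - n.+1%:R * pi + pi); last by rewrite -natr1; ring.
  by rewrite cosDpi opprK.
by rewrite -cosBpi; congr cos; lra.
Qed.

End CosTaylor.

Lemma measurable_cos_comp d (Om : measurableType d) (R : realType) (F : Om -> R) :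
  measurable_fun setT F -> measurable_fun setT (fun w => cos (F w)).
Proof.
move=> mF; have mc : measurable_fun setT (@cos R).
  by apply: continuous_measurable_fun; exact: continuous_cos.
exact: (measurableT_comp mc mF).
Qed.

Lemma gaussian_momentSS (R : realType) (v : R) m :
  gaussian_moment v m.+2 = m.+1%:R * v * gaussian_moment v m.
Proof. by []. Qed.

Arguments gaussian_moment : simpl never.

(** * Convergence of moments implies convergence of cosine means *)

Section MomentsToCosine.
Variables (R : realType) (v : R).

Lemma gaussian_moment_even l :
  gaussian_moment v (2 * l) / (2 * l)`!%:R = exp_coeff (v / 2) l.
Proof.
rewrite /exp_coeff /=; elim: l => [|l IHl]; first by rewrite muln0 expr0.
have -> : (2 * l.+1 = (2 * l).+2)%N by rewrite mulnS.
have f0 n : n`!%:R != 0 :> R by rewrite pnatr_eq0 -lt0n fact_gt0.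
rewrite gaussian_momentSS !factS !natrM exprS.
have -> : gaussian_moment v (2 * l) = (v / 2) ^+ l / l`!%:R * (2 * l)`!%:R.
  by rewrite -IHl divfK.
have n1 : (2 * l).+1%:R != 0 :> R by [].
have -> : (2 * l).+2%:R = 2 * l.+1%:R :> R by rewrite -natrM mulnS.
have n2 : l.+1%:R != 0 :> R by [].
move: (f0 l) (f0 (2 * l)%N) n1 n2; move: (l`!%:R) ((2 * l)`!%:R) ((2 * l).+1%:R) (l.+1%:R) ((v / 2) ^+ l) => a b c e y a0 b0 c0 e0.
by field; rewrite a0 b0 c0 e0.
Qed.

Lemma gaussian_moment_odd l : gaussian_moment v (2 * l).+1 = 0.
Proof.
elim: l => [|l IHl]; first by rewrite muln0.
by rewrite mulnS add2n gaussian_momentSS IHl mulr0.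
Qed.

Lemma cos_taylor_gaussian b l :
  \sum_(m < 2 * l) cos (b + m%:R * (pi / 2)) * (gaussian_moment v m / m`!%:R) =
  cos b * series (exp_coeff (- v / 2)) l.
Proof.
elim: l => [|l IHl]; first by rewrite muln0 big_ord0 /series /= big_geq// mulr0.
have -> : (2 * l.+1 = (2 * l).+2)%N by rewrite mulnS.
rewrite !big_ord_recr /= IHl gaussian_moment_odd mul0r mulr0 addr0.
rewrite seriesSr mulrDr; congr (_ + _).
rewrite gaussian_moment_even /exp_coeff /= natrM.
have -> : cos (b + 2 * l%:R * (pi / 2)) = (-1) ^+ l * cos b.
  elim: l {IHl} => [|l IHl]; first by rewrite mulr0 mul0r addr0 mul1r.
  rewrite exprS -[RHS]mulrA -IHl mulN1r -cosDpi; congr cos.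
  by rewrite -[in LHS]natr1; field.
have -> : (- v / 2) ^+ l = (-1) ^+ l * (v / 2) ^+ l by rewrite -exprMn mulN1r mulNr.
by rewrite -!mulrA; ring.
Qed.

Variables (d : nat -> measure_display) (Om : forall N, measurableType (d N)).
Variables (P : forall N, probability (Om N) R) (X : forall N, Om N -> R).
Hypothesis integr_X : forall N m, integr (P N) (fun w => X w ^+ m).
Hypothesis moments_X : forall m,
  mean (P N) (fun w => X w ^+ m) @[N --> \oo] --> gaussian_moment v m.

(** The order is even so that the remainder, a power of the absolute value, is itself a moment. *)
Lemma mean_cos_taylor N b l :
  `|mean (P N) (fun w => cos (X w + b)) -
    \sum_(m < 2 * l) cos (b + m%:R * (pi / 2)) * (mean (P N) (fun w => X w ^+ m) / m`!%:R)| <=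
  mean (P N) (fun w => X w ^+ (2 * l)) / (2 * l)`!%:R.
Proof.
have mX : measurable_fun setT (@X N).
  by have := integr_measurable (integr_X N 1); under eq_fun do rewrite expr1.
have icos : integr (P N) (fun w => cos (X w + b)).
  apply: (@integr_bounded _ _ _ _ _ 1) => [|w]; last exact: cos_max.
  by apply: measurable_cos_comp; exact: measurable_funD.
have im m : integr (P N) (fun w => cos (b + m%:R * (pi / 2)) * (X w ^+ m / m`!%:R)).
  apply: integrZ; under eq_fun do rewrite mulrC; exact: integrZ.
have eT : mean (P N) (fun w => cos_taylor (2 * l) b (X w)) =
    \sum_(m < 2 * l) cos (b + m%:R * (pi / 2)) * (mean (P N) (fun w => X w ^+ m) / m`!%:R).
  rewrite /cos_taylor mean_sum => [|m _]; last exact: im.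
  apply: eq_bigr => m _; rewrite meanZ; last by under eq_fun do rewrite mulrC; exact: integrZ.
  by congr (_ * _); rewrite mulrC -meanZ//; congr mean; apply/funext => w; rewrite mulrC.
have iT : integr (P N) (fun w => cos_taylor (2 * l) b (X w)).
  by apply: integr_sum => m _; exact: im.
rewrite -eT -meanB//; apply: (le_trans (le_norm_mean (integrB icos iT))).
rewrite mulrC -meanZ//; apply: le_mean.
- exact/integr_norm/integrB.
- exact: integrZ.
move=> w; apply: (le_trans (norm_cos_taylor _ _ _)).
by rewrite mulrC !exprM real_normK ?num_real.
Qed.

Lemma cvg_mean_cos b :
  mean (P N) (fun w => cos (X w + b)) @[N --> \oo] --> cos b * expR (- v / 2).
Proof.
apply/cvgrPdist_lt => e e0.
(* Four errors: the tail of the exponential series, the distance of finitely many moments from their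
   limits, the limiting Taylor remainder, and its approximation at [N]. The order [l] is fixed
   before [N]. *)
have e4 : 0 < e / 4 by rewrite divr_gt0.
have c1 : cos b * series (exp_coeff (- v / 2)) l @[l --> \oo] --> cos b * expR (- v / 2).
  by apply: cvgM; [exact: cvg_cst|exact: is_cvg_series_exp_coeff].
have c2 : exp_coeff (v / 2) l @[l --> \oo] --> (0 : R) by exact: cvg_exp_coeff.
have [l [l1 l2]] : exists l, `|cos b * expR (- v / 2) - cos b * series (exp_coeff (- v / 2)) l| < e / 4 /\
    `|0 - exp_coeff (v / 2) l| < e / 4.
  have : \forall l \near \oo, `|cos b * expR (- v / 2) - cos b * series (exp_coeff (- v / 2)) l| < e / 4 /\
    `|0 - exp_coeff (v / 2) l| < e / 4.
    near=> l; split; near: l.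
      exact: (cvgrPdist_lt _ _).1 c1 _ e4.
    exact: (cvgrPdist_lt _ _).1 c2 _ e4.
  by move=> [l _ Hl]; exists l; apply: Hl => /=.
have c3 : \sum_(m < 2 * l) cos (b + m%:R * (pi / 2)) *
    (mean (P N) (fun w => X w ^+ m) / m`!%:R) @[N --> \oo] -->
    cos b * series (exp_coeff (- v / 2)) l.
  rewrite -cos_taylor_gaussian; apply: cvg_big => [|m _].
    exact: add_continuous.
  apply: cvgM; first exact: cvg_cst.
  by apply: cvgM; [exact: moments_X|exact: cvg_cst].
have c4 : mean (P N) (fun w => X w ^+ (2 * l)) / (2 * l)`!%:R @[N --> \oo] -->
    exp_coeff (v / 2) l.
  rewrite -gaussian_moment_even; apply: cvgM; [exact: moments_X|exact: cvg_cst].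
near=> N.
have H3 : `|cos b * series (exp_coeff (- v / 2)) l - \sum_(m < 2 * l) cos (b + m%:R * (pi / 2)) *
    (mean (P N) (fun w => X w ^+ m) / m`!%:R)| < e / 4.
  by near: N; exact: (cvgrPdist_lt _ _).1 c3 _ e4.
have H4 : `|exp_coeff (v / 2) l - mean (P N) (fun w => X w ^+ (2 * l)) / (2 * l)`!%:R| < e / 4.
  by near: N; exact: (cvgrPdist_lt _ _).1 c4 _ e4.
have := mean_cos_taylor N b l; move: l1 l2 H3 H4.
move: (mean _ _) (\sum_(m < _) _) (cos b * _) (cos b * _) (exp_coeff _ _) (mean _ _ / _).
move=> a1 a2 a3 a4 a5 a6; rewrite !ltr_norml !ler_norml.
move=> /andP[? ?] /andP[? ?] /andP[? ?] /andP[? ?] /andP[? ?]; lra.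
Unshelve. all: by end_near. Qed.

End MomentsToCosine.

(** * Bernstein operators and trigonometric polynomials *)

Section Bernstein.
Variable R : realType.
Implicit Types (y : R) (F G : nat -> R).

(* The mean of [F] under the binomial law with parameters [m] and [y]. *)
Fixpoint bernstein m y F : R :=
  if m is m'.+1 then y * bernstein m' y (fun k => F k.+1) + (1 - y) * bernstein m' y F
  else F 0%N.

Lemma le_bernstein m y F G : 0 <= y <= 1 -> (forall k, F k <= G k) ->
  bernstein m y F <= bernstein m y G.
Proof.
move=> /andP[y0 y1]; elim: m F G => [|m IHm] F G FG //=.
by rewrite lerD// ler_wpM2l ?subr_ge0//; apply: IHm.
Qed.

Lemma bernstein_square m y (a b c : R) :
  bernstein m y (fun k => a + b * (k%:R + c) ^+ 2) =
  a + b * (m%:R * y * (1 - y) + (m%:R * y + c) ^+ 2).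
Proof.
elim: m c => [|m IHm] c /=; first by ring.
rewrite IHm [X in y * X](_ : _ = a + b * (m%:R * y * (1 - y) + (m%:R * y + (1 + c)) ^+ 2)).
  by rewrite -[m.+1%:R]natr1; ring.
rewrite -IHm; congr bernstein; apply/funext => k.
by rewrite -[k.+1%:R]natr1 addrA.
Qed.

Lemma bernstein_cst m y (a : R) : bernstein m y (fun=> a) = a.
Proof. by elim: m => //= m ->; ring. Qed.

(** Under the binomial law k/m has mean [y] and variance y (1 - y) / m, at most 1/m; integrating a
    quadratic majorant of the error plays the role of Chebyshev's inequality. *)
Lemma norm_bernstein m y F (a A B : R) : (0 < m)%N -> 0 <= y <= 1 -> 0 <= B ->
  (forall k, `|F k - a| <= A + B * (k%:R / m%:R - y) ^+ 2) ->
  `|bernstein m y F - a| <= A + B / m%:R.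
Proof.
move=> m0 y01 B0 HF; have m0' : m%:R != 0 :> R by rewrite pnatr_eq0 -lt0n.
have mE (s : R) : bernstein m y (fun k => a + s * A + s * B * (k%:R / m%:R - y) ^+ 2) =
    a + s * A + s * B * (y * (1 - y) / m%:R).
  rewrite (_ : (fun k => _) = fun k : nat => a + s * A + s * B / m%:R ^+ 2 * (k%:R + (- (m%:R * y))) ^+ 2).
    by rewrite bernstein_square addrN; field.
  by apply/funext => k; field.
have yb : B * (y * (1 - y) / m%:R) <= B / m%:R.
  rewrite ler_wpM2l// ler_piMl ?invr_ge0//.
  by case/andP: y01 => y0 y1; rewrite -[leRHS]mulr1 ler_pM// ?subr_ge0// lerBlDr lerDl.
have up : bernstein m y F <= a + A + B / m%:R.
  apply: (@le_trans _ _ (bernstein m y (fun k => a + 1 * A + 1 * B * (k%:R / m%:R - y) ^+ 2))).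
    apply: le_bernstein => // k; have := HF k; rewrite ler_norml => /andP[_]; lra.
  by rewrite mE !mul1r; lra.
have lo : a - A - B / m%:R <= bernstein m y F.
  apply: (@le_trans _ _ (bernstein m y (fun k => a + -1 * A + -1 * B * (k%:R / m%:R - y) ^+ 2))).
    by rewrite mE; lra.
  apply: le_bernstein => // k; have := HF k; rewrite ler_norml => /andP[]; lra.
by rewrite ler_norml; apply/andP; split; lra.
Qed.

Variable n : nat.

Definition update (k : 'I_n -> nat) j i : 'I_n -> nat := fun l => if l == j then i else k l.

Fixpoint multi_bernstein (s : seq 'I_n) m (y : 'I_n -> R) (F : ('I_n -> nat) -> R) (k : 'I_n -> nat) : R :=
  if s is j :: s' then bernstein m (y j) (fun i => multi_bernstein s' m y F (update k j i)) else F k.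

(** Averaging over one coordinate trades its quadratic term for the variance bound [B / m%:R]; the
    coordinates not yet averaged keep theirs. *)
Lemma norm_multi_bernstein s m (y : 'I_n -> R) (F : ('I_n -> nat) -> R) (k : 'I_n -> nat) (a A B : R) : (0 < m)%N ->
  (forall j, 0 <= y j <= 1) -> 0 <= B -> uniq s ->
  (forall k, `|F k - a| <= A + B * \sum_j ((k j)%:R / m%:R - y j) ^+ 2) ->
  `|multi_bernstein s m y F k - a| <=
    A + (size s)%:R * (B / m%:R) + B * \sum_(j | j \notin s) ((k j)%:R / m%:R - y j) ^+ 2.
Proof.
move=> m0 y01 B0 us HF; elim: s us k => [|j s IHs] /=.
  move=> _ k; rewrite mul0r addr0 (eq_bigl xpredT) => [|j]; first exact: HF.
  by [].

move=> /andP[js us] k.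
set rest := \sum_(l | l \notin j :: s) _.
rewrite [leRHS](_ : _ = (A + (size s)%:R * (B / m%:R) + B * rest) + B / m%:R); last first.
  by rewrite -natr1; ring.
apply: norm_bernstein => // i; apply: (le_trans (IHs us _)).
rewrite (bigD1 j)//= {1}/update eqxx.
rewrite (_ : \sum_(l | _) _ = rest); first by rewrite le_eqVlt; apply/orP; left; apply/eqP; ring.
rewrite /rest; apply: eq_big => [l|l /andP[_ lj]]; first by rewrite inE negb_or andbC.
by rewrite /update (negbTE lj).
Qed.

(** Each step is an average, so the bound persists whenever [y] lies in the unit interval; for the
    trigonometric polynomials below this means on the whole space, also off the cube of
    approximation. *)
Lemma norm_multi_bernstein_le s m (y : 'I_n -> R) (F : ('I_n -> nat) -> R) (k : 'I_n -> nat) (C : R) :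
  (forall j, 0 <= y j <= 1) -> (forall k, `|F k| <= C) ->
  `|multi_bernstein s m y F k| <= C.
Proof.
move=> y01 FC; elim: s k => [|j s IHs] k //=.
have H i := IHs (update k j i); rewrite ler_norml; apply/andP; split.
  rewrite -[leLHS](bernstein_cst m (y j)); apply: le_bernstein => // i.
  by have := H i; rewrite ler_norml => /andP[].
rewrite -[leRHS](bernstein_cst m (y j)); apply: le_bernstein => // i.
by have := H i; rewrite ler_norml => /andP[].
Qed.

(** The free phase [b] includes sines; closure under the products that occur is [trig_mul_sin]. *)
Inductive trigpoly : ('rV[R]_n -> R) -> Prop :=
| trig_cos (t : 'I_n -> R) b : trigpoly (fun x => cos (\sum_j t j * x 0 j + b))
| trig_add f g : trigpoly f -> trigpoly g -> trigpoly (fun x => f x + g x)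
| trig_scale c f : trigpoly f -> trigpoly (fun x => c * f x).

(** A sine times a cosine is half a sum of two sines: the frequency in coordinate [j] moves by
    [theta] either way, and a phase shift of [pi / 2] writes the sines as cosines. *)
Lemma trig_mul_sin theta j f : trigpoly f ->
  trigpoly (fun x => sin (theta * x 0 j) * f x).
Proof.
elim=> [t b|g h _ IHg _ IHh|c g _ IHg].
- pose tp (s : R) i := t i + (if i == j then s * theta else 0).
  have tpE s (x : 'rV[R]_n) : \sum_i tp s i * x 0 i = \sum_i t i * x 0 i + s * (theta * x 0 j).
    rewrite (eq_bigr (fun i => t i * x 0 i + (if i == j then s * theta * x 0 i else 0))).
      by rewrite big_split /= -big_mkcond big_pred1_eq mulrA.
    by move=> i _; rewrite /tp; case: ifP => _; rewrite mulrDl// mul0r.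
  rewrite (_ : (fun x => _) = fun x : 'rV[R]_n =>
     2^-1 * cos (\sum_i tp 1 i * x 0 i + (b - pi / 2)) +
     (- 2^-1) * cos (\sum_i tp (-1) i * x 0 i + (b - pi / 2))).
    apply: trig_add; apply: trig_scale; exact: trig_cos.
  apply/funext => x; rewrite !tpE !addrA !cosBpihalf.
  set u := theta * _; set v := \sum_i _.
  rewrite (_ : v + 1 * u + b = u + (v + b)); last by ring.
  rewrite (_ : v + -1 * u + b = (v + b) - u); last by ring.
  by rewrite sinD sinB; field.
- by under eq_fun do rewrite mulrDr; exact: trig_add.
- by under eq_fun do rewrite mulrCA; exact: trig_scale.
Qed.

Lemma trig_multi_bernstein theta s m (F : ('I_n -> nat) -> R) (k : 'I_n -> nat) :
  trigpoly (fun x => multi_bernstein s m (fun j => (1 + sin (theta * x 0 j)) / 2) F k).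
Proof.
elim: s k => [|j s IHs] k /=.
  rewrite (_ : (fun x => _) = fun x : 'rV[R]_n => F k * cos (\sum_j 0 * x 0 j + 0)).
    by apply: trig_scale; exact: trig_cos.
  by apply/funext => x; rewrite big1 ?addr0 ?cos0 ?mulr1// => j _; rewrite mul0r.
have : forall i, trigpoly (fun x => multi_bernstein s m (fun j => (1 + sin (theta * x 0 j)) / 2) F (update k j i)).
  by move=> i; exact: IHs.
suff H m' (G : nat -> 'rV[R]_n -> R) : (forall i, trigpoly (G i)) ->
    trigpoly (fun x => bernstein m' ((1 + sin (theta * x 0 j)) / 2) (fun i => G i x)) by exact: H.
elim: m' G => [|m' IHm] G tG /=; first exact: tG.
have t1 := IHm (fun i => G i.+1) (fun i => tG i.+1); have t2 := IHm G tG.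
pose B1 (x : 'rV[R]_n) := bernstein m' ((1 + sin (theta * x 0 j)) / 2) (fun i => G i.+1 x).
pose B2 (x : 'rV[R]_n) := bernstein m' ((1 + sin (theta * x 0 j)) / 2) (fun i => G i x).
rewrite (_ : (fun x => _) = fun x : 'rV[R]_n => (2^-1 * B1 x + 2^-1 * (sin (theta * x 0 j) * B1 x)) +
   (2^-1 * B2 x + (- 2^-1) * (sin (theta * x 0 j) * B2 x))).
  by do !apply: trig_add; apply: trig_scale => //; exact: trig_mul_sin.
by apply/funext => x; rewrite /B1 /B2; field.
Qed.

End Bernstein.

Section TrigApproximation.
Variable R : realType.

Lemma cos_ge_half (x : R) : `|x| <= 1 -> 2^-1 <= cos x.
Proof.
move=> x1; have := norm_cos_taylor 2 0 x; rewrite addr0.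
have -> : cos_taylor 2 0 x = 1.
  rewrite /cos_taylor 2!big_ord_recr big_ord0 /= mul0r !add0r !mul1r.
  by rewrite cos_pihalf mul0r addr0 cos0 fact0 divr1.
have x2 : `|x| ^+ 2 <= 1 by rewrite exprn_ile1.
have f2 : (2)`!%:R = 2 :> R by [].
rewrite f2 ler_norml => /andP[H _].
by move: H x2; move: (cos x) (`|x| ^+ 2) => a b; lra.
Qed.

Lemma sin_expanding (u v : R) : `|u| <= 1 -> `|v| <= 1 ->
  `|u - v| <= 2 * `|sin u - sin v|.
Proof.
wlog uv : u v / u <= v.
  move=> H u1 v1; have [|/ltW] := leP u v; first by move=> ?; apply: H.
  by move=> vu; rewrite distrC [X in 2 * X]distrC; apply: H.
move=> u1 v1.
have cs : {within `[u, v], continuous (@sin R)}.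
  by apply: continuous_subspaceT; exact: continuous_sin.
have [c /[!in_itv]/= /andP[uc cv] sE] := MVT_segment uv (fun x _ => is_derive_sin x) cs.
rewrite distrC [X in _ <= 2 * X]distrC sE normrM.
have c1 : `|c| <= 1.
  by move: u1 v1; rewrite !ler_norml => /andP[? ?] /andP[? ?]; apply/andP; split; lra.
have := cos_ge_half c1 => c2; rewrite mulrA ler_peMl//.
rewrite ger0_norm; lra.
Qed.

(** [v] is the arcsine of [w] clamped between [sin (-1)] and [sin 1]. Clamping is forced by the
    Bernstein nodes, which fill [-1, 1], more than the range of [sin] on [-1, 1], where its slope is
    at least 1/2. *)
Lemma sin_projection (w : R) : exists2 v : R, `|v| <= 1 &
  forall u, `|u| <= 1 -> `|u - v| <= 2 * `|sin u - w|.
Proof.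
have n1 : `|1 : R| <= 1 by rewrite normr1.
have n1' : `|-1 : R| <= 1 by rewrite normrN normr1.
have cs : {within `[(-1 : R), 1], continuous (@sin R)}.
  by apply: continuous_subspaceT; exact: continuous_sin.
have mono (u v : R) : `|u| <= 1 -> `|v| <= 1 -> u <= v -> sin u <= sin v.
  move=> u1 v1 uv.
  have csuv : {within `[u, v], continuous (@sin R)}.
    by apply: continuous_subspaceT; exact: continuous_sin.
  have [c /[!in_itv]/= /andP[uc cv] sE] := MVT_segment uv (fun x _ => is_derive_sin x) csuv.
  rewrite -subr_ge0 sE mulr_ge0 ?subr_ge0// (le_trans _ (cos_ge_half _))//.
  by move: u1 v1; rewrite !ler_norml => /andP[? ?] /andP[? ?]; apply/andP; split; lra.
have le11 : (-1 : R) <= 1 by lra.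
have s11 := mono _ _ n1' n1 le11.
have [w1|w1] := leP w (sin (-1)).
  exists (-1) => // u u1; apply: (le_trans (sin_expanding u1 n1')).
  rewrite ler_wpM2l//; have : sin (-1) <= sin u.
    by apply: mono => //; move: u1; rewrite ler_norml => /andP[].
  by move=> su; rewrite !ger0_norm; lra.
have [w2|w2] := leP (sin 1) w.
  exists 1 => // u u1; apply: (le_trans (sin_expanding u1 n1)).
  rewrite ler_wpM2l//; have : sin u <= sin 1.
    by apply: mono => //; move: u1; rewrite ler_norml => /andP[].
  by move=> su; rewrite !ler0_norm; lra.
have [|v /[!in_itv]/= v1 <-] := @IVT R (@sin R) (-1) 1 w le11 cs.
  by rewrite (min_idPl s11) (max_idPr s11) !ltW.
have v1' : `|v| <= 1 by rewrite ler_norml.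
by exists v => // u u1; exact: sin_expanding.
Qed.

Variable n : nat.
Implicit Types f : 'rV[R]_n -> R.

Lemma uniform_continuous_cube f (L e : R) : continuous f -> 0 < e ->
  exists2 dl, 0 < dl & forall x y : 'rV[R]_n,
    (forall j, `|x 0 j| <= L) -> (forall j, `|x 0 j - y 0 j| < dl) -> `|f x - f y| < e.
Proof.
move=> cf e0.
have cK : compact [set v : 'rV[R]_n | forall j, `[- L, L]%classic (v ord0 j)].
  by apply: (@rV_compact R n (fun=> `[- L, L]%classic)) => j; exact: segment_compact.
have := (compact_near_coveringP _).1 cK R 0^'+
  (fun dl (x : 'rV[R]_n) => forall y : 'rV[R]_n,
     (forall j, `|x 0 j - y 0 j| < dl) -> `|f x - f y| < e).
move=> /(_ _)[|].
  move=> x _.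
  have e2 : 0 < e / 2 by rewrite divr_gt0.
  have /cvgrPdist_lt/(_ _ e2)/nbhs_ballP[r /= r0 Hr] := cf x.
  have r2 : 0 < r / 2 by rewrite divr_gt0.
  exists (ball x (r / 2), [set dl | dl < r / 2]) => /=.
    split; first exact: nbhsx_ballx.
    by exists (r / 2) => // z /=; rewrite sub0r normrN => /ltr_normlW.
  move=> [x' dl] [/= xx' dlr] y x'y.
  have xx'2 : `|f x - f x'| < e / 2.
    by apply: Hr; apply: le_ball xx'; rewrite ler_pdivrMr//; lra.
  have xy : `|f x - f y| < e / 2.
    apply: Hr; rewrite -[r](@divfK _ 2)// mulr_natr mulr2n.
    apply: ball_triangle xx' _; split=> // i j.
    by rewrite ord1; apply: lt_trans dlr; exact: x'y.
  by rewrite (le_lt_trans (ler_distD (f x) _ _))// [X in X + _]distrC; lra.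
move=> dl0 /= d00 Hd; exists (dl0 / 2); first by rewrite divr_gt0.
move=> x y xL xy; apply: (Hd (dl0 / 2)) => //=.
- by rewrite sub0r normrN gtr0_norm ?divr_gt0// ltr_pdivrMr//; lra.
- by rewrite divr_gt0.
- by move=> j; rewrite in_itv/= -ler_norml.
Qed.

Lemma trig_approx f (C L e : R) : continuous f -> (forall x, `|f x| <= C) ->
  0 < L -> 0 < e ->
  exists g, [/\ trigpoly g, forall x, `|g x| <= C &
    forall x : 'rV[R]_n, (forall j, `|x 0 j| <= L) -> `|g x - f x| <= e].
Proof.
move=> cf fC L0 e0; have e2 : 0 < e / 2 by rewrite divr_gt0.
have C0 : 0 <= C by exact: le_trans (fC 0).
have [dl dl0 Hdl] := uniform_continuous_cube L cf e2.
have [sp spP] := choice (fun w => let: ex_intro2 v v1 H := sin_projection w in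
  ex_intro (fun v => `|v| <= 1 /\ forall u, `|u| <= 1 -> `|u - v| <= 2 * `|sin u - w|) v (conj v1 H)).
(* If some coordinate of the node is at distance at least [dl] from [x], then [4 * L / dl] times the
   error of that node is at least 1, so that [B] times the squared error dominates the trivial bound
   [2 * C]. *)
pose B := 2 * C * (4 * L / dl) ^+ 2.
have B0 : 0 <= B by apply: mulr_ge0; [exact: mulr_ge0|exact: sqr_ge0].
pose m := (Num.trunc (2 * n%:R * B / e)).+1.
have mE : n%:R * (B / m%:R) <= e / 2.
  rewrite mulrA ler_pdivrMr ?ltr0n//.
  have : 2 * n%:R * B / e <= m%:R by rewrite ltW// truncnS_gt.
  by rewrite ler_pdivrMr// ; lra.
(* The node k/m stands for a value of (1 + sin (x/L)) / 2; [sp] recovers from it a point of the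
   cube. *)
pose F (k : 'I_n -> nat) := f (\row_j (L * sp (2 * ((k j)%:R / m%:R) - 1))).
pose th := L^-1.
pose y (x : 'rV[R]_n) j := (1 + sin (th * x 0 j)) / 2.
have y01 x j : 0 <= y x j <= 1.
  by have := sin_max (th * x 0 j); rewrite ler_norml /y => /andP[? ?]; apply/andP; split; lra.
exists (fun x => multi_bernstein (enum 'I_n) m (y x) F (fun=> 0%N)); split.
- exact: trig_multi_bernstein.
- by move=> x; apply: norm_multi_bernstein_le => // k; exact: fC.
move=> x xL.
have H (k : 'I_n -> nat) : `|F k - f x| <= e / 2 + B * \sum_j ((k j)%:R / m%:R - y x j) ^+ 2.
  have S0 : 0 <= B * \sum_j ((k j)%:R / m%:R - y x j) ^+ 2.
    by rewrite mulr_ge0// sumr_ge0// => j _; exact: sqr_ge0.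
  pose x' := \row_j (L * sp (2 * ((k j)%:R / m%:R) - 1)).
  have xx' j : `|x 0 j - x' 0 j| <= 4 * L * `|(k j)%:R / m%:R - y x j|.
    rewrite mxE; set w := 2 * _ - 1; have [_ /(_ (th * x 0 j))] := spP w.
    rewrite normrM gtr0_norm ?invr_gt0// mulrC ler_pdivrMr// mul1r => /(_ (xL j)) Hw.
    have -> : x 0 j - L * sp w = L * (th * x 0 j - sp w).
      by rewrite mulrBr mulrA divff ?gt_eqF// mul1r.
    rewrite normrM gtr0_norm//.
    have -> : `|(k j)%:R / m%:R - y x j| = 2^-1 * `|sin (th * x 0 j) - w|.
      rewrite -[2^-1 in RHS]gtr0_norm ?invr_gt0// -normrM distrC; congr (`|_|).
      by rewrite /w /y; move: (sin _) ((k j)%:R / m%:R) => a b; lra.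
    have := ler_wpM2l (ltW L0) Hw; lra.
  have [/forallP small|] := boolP [forall j, `|x 0 j - x' 0 j| < dl].
    by rewrite distrC (le_trans (ltW (Hdl x x' xL small)))// lerDl.
  rewrite negb_forall => /existsP[j]; rewrite -leNgt => big.
  apply: (@le_trans _ _ (2 * C)).
    by rewrite (le_trans (ler_normB _ _))//; have := fC x; have := fC x'; rewrite -/(F k); lra.
  apply: (@le_trans _ _ (B * ((k j)%:R / m%:R - y x j) ^+ 2)); last first.
    rewrite -[leLHS]add0r lerD ?(ltW e2)// ler_wpM2l// (bigD1 j)//= lerDl.
    by rewrite sumr_ge0// => i _; exact: sqr_ge0.
  rewrite /B -mulrA -exprMn -[leLHS]mulr1 ler_wpM2l ?mulr_ge0//.
  rewrite -real_normK ?num_real// exprn_ege1// normrM.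
  rewrite (ger0_norm (_ : 0 <= 4 * L / dl)); last by rewrite !mulr_ge0 ?invr_ge0// ltW.
  rewrite mulrAC ler_pdivlMr// mul1r; exact: le_trans big (xx' j).
have := norm_multi_bernstein (m := m) (fun=> 0%N) isT (y01 x) B0 (enum_uniq 'I_n) H.
rewrite size_enum_ord big1 ?mulr0 ?addr0; last by move=> j; rewrite mem_enum.
by move=> /le_trans; apply; lra.
Qed.

End TrigApproximation.

(** * Convergence in law from convergence of cosine means *)

Definition row_of (R : realType) n (Om : Type) (V : 'I_n -> Om -> R) (w : Om) : 'rV[R]_n :=
  \row_j V j w.

Section TrigMeasurable.
Context d (Om : measurableType d) (R : realType) (P : probability Om R) (n : nat).
Variable V : 'I_n -> Om -> R.
Hypothesis mV : forall j, measurable_fun setT (V j).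

Lemma measurable_linear (t : 'I_n -> R) b :
  measurable_fun setT (fun w => \sum_j t j * V j w + b).
Proof.
apply: measurable_funD => //; apply: measurable_sum => j.
by apply: measurable_funM.
Qed.

Lemma trig_row_cos (t : 'I_n -> R) b w :
  cos (\sum_j t j * row_of V w 0 j + b) = cos (\sum_j t j * V j w + b).
Proof. by congr (cos (_ + _)); apply: eq_bigr => j _; rewrite mxE. Qed.

Lemma integr_trig g : trigpoly g -> integr P (fun w => g (row_of V w)).
Proof.
elim=> [t b|g1 g2 _ i1 _ i2|c g1 _ i1].
- under eq_fun do rewrite trig_row_cos.
  apply: (@integr_bounded _ _ _ _ _ 1) => [|w]; last exact: cos_max.
  by apply: measurable_cos_comp; exact: measurable_linear.
- exact: integrD.
- exact: integrZ.
Qed.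

(** [f] is the pointwise limit of trigonometric polynomials approximating it on growing cubes; this
    gives measurability directly, without a Borel structure on row vectors. *)
Lemma measurable_continuous_row (f : 'rV[R]_n -> R) C : continuous f ->
  (forall x, `|f x| <= C) -> measurable_fun setT (fun w => f (row_of V w)).
Proof.
move=> cf fC.
have approx (i : nat) : exists g, trigpoly g /\
    forall x : 'rV[R]_n, (forall j, `|x 0 j| <= i.+1%:R) -> `|g x - f x| <= i.+1%:R^-1.
  have i0 : 0 < i.+1%:R^-1 :> R by rewrite invr_gt0.
  by have [g [tg _ Hg]] := trig_approx cf fC (ltr0Sn R i) i0; exists g.
have [g Hg] := choice approx.
apply: (measurable_fun_cvg (h := fun i w => g i (row_of V w))).
  by move=> i; apply: integr_measurable; apply: integr_trig; exact: (Hg i).1.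
move=> w _; apply/cvgrPdist_le => e e0.
near=> i; rewrite distrC; apply: (le_trans ((Hg i).2 _ _)).
  move=> j; apply: (@le_trans _ _ (\sum_j `|row_of V w 0 j|)).
    by rewrite (bigD1 j)//= lerDl sumr_ge0.
  apply: (@le_trans _ _ i%:R); last by rewrite ler_nat.
  by near: i; exact: nbhs_infty_ger.
by rewrite ltW//; near: i; exact: (near_infty_natSinv_lt (PosNum e0)).
Unshelve. all: by end_near. Qed.

End TrigMeasurable.

Section WeakConvergence.
Variables (R : realType) (n : nat).
Variables (d : nat -> measure_display) (Om : forall N, measurableType (d N)).
Variables (P : forall N, probability (Om N) R) (X : forall N, 'I_n -> Om N -> R).
Variables (d' : measure_display) (Om' : measurableType d') (Q : probability Om' R).
Variables (Y : 'I_n -> Om' -> R) (B : R).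
Hypothesis mX : forall N j, measurable_fun setT (@X N j).
Hypothesis mY : forall j, measurable_fun setT (Y j).
Hypothesis X2 : forall N j, integr (P N) (fun w => X j w ^+ 2).
Hypothesis Y2 : forall j, integr Q (fun w => Y j w ^+ 2).
Hypothesis X2B : forall N j, mean (P N) (fun w => X j w ^+ 2) <= B.
Hypothesis Y2B : forall j, mean Q (fun w => Y j w ^+ 2) <= B.
Hypothesis cvg_cos : forall (t : 'I_n -> R) b,
  mean (P N) (fun w => cos (\sum_j t j * X j w + b)) @[N --> \oo] -->
  mean Q (fun w => cos (\sum_j t j * Y j w + b)).

Lemma cvg_mean_trig g : trigpoly g ->
  mean (P N) (fun w => g (row_of (@X N) w)) @[N --> \oo] --> mean Q (fun w => g (row_of Y w)).
Proof.
elim=> [t b|g1 g2 t1 c1 t2 c2|c g1 t1 c1].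
- have -> : (fun w => cos (\sum_j t j * row_of Y w 0 j + b)) = fun w => cos (\sum_j t j * Y j w + b).
    by apply/funext => w; exact: trig_row_cos.
  rewrite (_ : (fun N => _) = fun N => mean (P N) (fun w => cos (\sum_j t j * X j w + b)))//.
  by apply/funext => N; congr mean; apply/funext => w; exact: trig_row_cos.
- have iX N g' : trigpoly g' -> integr (P N) (fun w => g' (row_of (@X N) w)).
    exact: (integr_trig (P N) (@mX N)).
  have iY g' : trigpoly g' -> integr Q (fun w => g' (row_of Y w)).
    exact: (integr_trig Q mY).
  rewrite meanD; [|exact: iY|exact: iY].
  rewrite (_ : (fun N => _) = fun N => mean (P N) (fun w => g1 (row_of (@X N) w)) +
      mean (P N) (fun w => g2 (row_of (@X N) w))); first exact: cvgD.
  by apply/funext => N; rewrite meanD//; exact: iX.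
- rewrite meanZ; last exact: (integr_trig Q mY t1).
  rewrite (_ : (fun N => _) = fun N => c * mean (P N) (fun w => g1 (row_of (@X N) w))).
    by apply: cvgM => //; exact: cvg_cst.
  by apply/funext => N; rewrite meanZ//; exact: (integr_trig (P N) (@mX N) t1).
Qed.

(** Chebyshev: outside the cube the difference is at most [2 * C], hence at most [2 * C / L ^+ 2]
    times the sum of the squared coordinates. It is applied to the sequence and to its limit with
    the same [B]. *)
Lemma mean_tail d1 (O1 : measurableType d1) (P1 : probability O1 R) (V : 'I_n -> O1 -> R)
    (f g : 'rV[R]_n -> R) (C L e : R) :
  (forall j, measurable_fun setT (V j)) ->
  (forall j, integr P1 (fun w => V j w ^+ 2)) ->
  (forall j, mean P1 (fun w => V j w ^+ 2) <= B) ->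
  continuous f -> trigpoly g -> (forall x, `|f x| <= C) -> (forall x, `|g x| <= C) -> 0 < L ->
  0 <= e ->
  (forall x : 'rV[R]_n, (forall j, `|x 0 j| <= L) -> `|g x - f x| <= e) ->
  `|mean P1 (fun w => g (row_of V w)) - mean P1 (fun w => f (row_of V w))| <=
    e + 2 * C / L ^+ 2 * (n%:R * B).
Proof.
move=> mV V2 VB cf tg fC gC L0 e0 gf.
have C0 : 0 <= C by exact: le_trans (fC 0).
have ig := integr_trig P1 mV tg.
have iff : integr P1 (fun w => f (row_of V w)).
  apply: (@integr_bounded _ _ _ _ _ C) => [|w]; last exact: fC.
  exact: (measurable_continuous_row P1 mV cf fC).
have is2 : integr P1 (fun w => \sum_j V j w ^+ 2) by apply: integr_sum.
have K0 : 0 <= 2 * C / L ^+ 2 by apply: divr_ge0; [exact: mulr_ge0|exact: sqr_ge0].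
rewrite -meanB//; apply: (le_trans (le_norm_mean (integrB ig iff))).
apply: (@le_trans _ _ (mean P1 (fun w => e + 2 * C / L ^+ 2 * \sum_j V j w ^+ 2))).
  apply: le_mean.
  - exact/integr_norm/integrB.
  - by apply: integrD; [exact: integr_cst|exact: integrZ].
  move=> w; set x := row_of V w.
  have S0 : 0 <= \sum_j V j w ^+ 2 by apply: sumr_ge0 => j _; exact: sqr_ge0.
  have [/forallP small|] := boolP [forall j, `|x 0 j| <= L].
    by rewrite (le_trans (gf x small))// lerDl mulr_ge0.
  rewrite negb_forall => /existsP[j]; rewrite -ltNge => big.
  apply: (@le_trans _ _ (2 * C)).
    by rewrite (le_trans (ler_normB _ _))//; have := fC x; have := gC x; lra.
  rewrite -[leLHS]add0r lerD// -mulrA -[leLHS]mulr1 ler_wpM2l ?mulr_ge0//.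
  rewrite mulrC ler_pdivlMr ?exprn_gt0// mul1r.
  apply: (@le_trans _ _ (V j w ^+ 2)); last first.
    by rewrite (bigD1 j)//= lerDl sumr_ge0// => i _; exact: sqr_ge0.
  rewrite -[leRHS]real_normK ?num_real//; apply: lerXn2r; rewrite ?nnegrE ?(ltW L0)//.
  by move: big; rewrite mxE => /ltW.
rewrite meanD ?mean_cst ?meanZ//; last 2 first.
- exact: integr_cst.
- exact: integrZ.
rewrite lerD2l ler_wpM2l// mean_sum//.
apply: (@le_trans _ _ (\sum_(j < n) B)); first by apply: ler_sum.
by rewrite sumr_const card_ord mulr_natl.
Qed.

Lemma cvg_mean_continuous (f : 'rV[R]_n -> R) (C : R) : continuous f ->
  (forall x, `|f x| <= C) ->
  mean (P N) (fun w => f (row_of (@X N) w)) @[N --> \oo] --> mean Q (fun w => f (row_of Y w)).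
Proof.
move=> cf fC; apply/cvgrPdist_lt => e e0.
have C0 : 0 <= C by exact: le_trans (fC 0).
pose K := `|2 * C * (n%:R * B)|.
have K0 : 0 <= K by exact: normr_ge0.
(* Chosen so that [K / L ^+ 2 <= K / L <= e / 8]. *)
pose L := 1 + 8 * K / e.
have L1 : 1 <= L by rewrite lerDl; apply: divr_ge0; [exact: mulr_ge0|exact: ltW].
have L0 : 0 < L by lra.
have e8 : 0 < e / 8 by rewrite divr_gt0.
have [g [tg gC gf]] := trig_approx cf fC L0 e8.
have tail : 2 * C / L ^+ 2 * (n%:R * B) <= e / 8.
  rewrite mulrAC ler_pdivrMr ?exprn_gt0//.
  apply: (@le_trans _ _ K); first exact: ler_norm.
  apply: (@le_trans _ _ (e / 8 * L)).
    by rewrite /L mulrDr mulr1 -[leLHS]add0r lerD ?(ltW e8)// le_eqVlt; apply/orP; left; apply/eqP; field; rewrite gt_eqF.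
  by rewrite ler_wpM2l ?(ltW e8)// expr2 ler_peMl// ltW.
have HQ := mean_tail mY Y2 Y2B cf tg fC gC L0 (ltW e8) gf.
near=> N.
have HN := mean_tail (@mX N) (@X2 N) (@X2B N) cf tg fC gC L0 (ltW e8) gf.
have Hg : `|mean Q (fun w => g (row_of Y w)) - mean (P N) (fun w => g (row_of (@X N) w))| < e / 8.
  by near: N; exact: (cvgrPdist_lt _ _).1 (cvg_mean_trig tg) _ e8.
move: HQ HN Hg tail.
set t := 2 * C / _ * _; move: t => t.
rewrite !ltr_norml !ler_norml => /andP[? ?] /andP[? ?] /andP[? ?] ?; lra.
Unshelve. all: by end_near. Qed.

End WeakConvergence.

(** * Laws determined by cosine means *)

(** The open right rays are stable under intersection and generate the Borel sets, and those
    starting at [- n%:R] exhaust the line. *)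
Lemma measure_rays_unique (R : realType) (m1 m2 : {measure set R -> \bar R}) :
  (m1 setT < +oo)%E -> m1 setT = m2 setT ->
  (forall x : R, m1 `]x, +oo[%classic = m2 `]x, +oo[%classic) ->
  forall B, measurable B -> m1 B = m2 B.
Proof.
move=> m1oo m12T m12 B mB.
have mG : (measurable : set (set R)) = <<s @RGenOInfty.G R >>.
  exact: RGenOInfty.measurableE.
have IG : setI_closed (@RGenOInfty.G R).
  move=> _ _ [x ->] [y ->]; exists (Num.max x y).
  apply/seteqP; split => z /=; rewrite !in_itv/= !andbT gt_max.
    by move=> [-> ->].
  by move=> /andP[].
pose g n : set R := `](- (n%:R : R)), +oo[%classic.
have cov : \bigcup_k g k = setT.
  apply/seteqP; split => // x _; exists (Num.trunc `|x|).+1 => //=.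
  rewrite /g /= in_itv/= andbT ltrNl (le_lt_trans (ler_norm _))// normrN.
  exact: truncnS_gt.
apply: (measure_unique (@RGenOInfty.G R) g mG IG _ cov) => //.
- by move=> n; exists (- n%:R).
- by move=> _ [x ->].
- move=> n; apply: le_lt_trans m1oo; apply: le_measure; rewrite ?inE//.
  exact: measurable_itv.
Qed.

Section Clip.
Variable R : realType.

(** A continuous ramp, for [j > 0] equal to 0 up to [a] and to 1 from a + 1/j on. It tends to the
    indicator of a ray, so that bounded continuous tests determine a law. *)
Definition clip (a : R) (j : nat) (x : R) : R := Num.min 1 (Num.max 0 (j%:R * (x - a))).

Lemma clip_bound a j x : 0 <= clip a j x <= 1.
Proof. by rewrite /clip le_min ler01 le_max lexx ge_min lexx. Qed.

Lemma norm_clip a j x : `|clip a j x| <= 1.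
Proof. by have /andP[? ?] := clip_bound a j x; rewrite ger0_norm. Qed.

Lemma continuous_clip a j : continuous (clip a j).
Proof.
move=> x; apply: (@continuous_min _ _ (cst 1) (fun x => Num.max 0 (j%:R * (x - a)))).
  exact: cvg_cst.
apply: (@continuous_max _ _ (cst 0) (fun x => j%:R * (x - a))); first exact: cvg_cst.
apply: (@continuousM _ _ (cst j%:R) (fun x => x - a)); first exact: cvg_cst.
by apply: (@continuousB _ _ _ id (cst a)); [exact: cvg_id|exact: cvg_cst].
Qed.

Lemma measurable_clip a j : measurable_fun setT (clip a j).
Proof. by apply: continuous_measurable_fun; exact: continuous_clip. Qed.

Lemma cvg_clip a x : clip a j x @[j --> \oo] --> (\1_`]a, +oo[ x : R).
Proof.
rewrite indicE; have [xa|ax] := leP x a.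
  rewrite memNset /=; last by rewrite /= in_itv/= andbT ltNge xa.
  apply: cvg_near_cst; near=> j; rewrite /clip (max_idPl _) ?(min_idPr _)//.
  by rewrite mulr_ge0_le0// subr_le0.
rewrite mem_set /=; last by rewrite /= in_itv/= andbT.
apply: cvg_near_cst; near=> j; rewrite /clip.
have xa0 : 0 < x - a by rewrite subr_gt0.
have H : 1 <= j%:R * (x - a).
  rewrite -ler_pdivrMr//; near: j; exact: nbhs_infty_ger.
by rewrite (max_idPr _) ?(le_trans ler01 H)// (min_idPl _).
Unshelve. all: by end_near. Qed.

End Clip.

Lemma mean_dominated d (Om : measurableType d) (R : realType) (P : probability Om R)
    (F : nat -> Om -> R) (G H : Om -> R) :
  (forall j, measurable_fun setT (F j)) -> integr P H -> (forall j w, `|F j w| <= H w) ->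
  (forall w, F j w @[j --> \oo] --> G w) ->
  mean P (F j) @[j --> \oo] --> mean P G.
Proof.
move=> mF iH FH FG.
have mG : measurable_fun setT G by apply: (measurable_fun_cvg (h := F)) => // w _; exact: FG.
have GH w : `|G w| <= H w.
  have : `|F j w| @[j --> \oo] --> `|G w| by apply: cvg_norm; exact: FG.
  by move=> /cvg_lim <- //; apply: limr_le; [apply: cvgP; apply: cvg_norm; exact: FG|near=> j].
have [] := @dominated_convergence _ _ _ P setT measurableT (fun j w => (F j w)%:E)
   (fun w => (G w)%:E) (fun w => (H w)%:E).
- by move=> j; exact/measurable_EFinP.
- exact/measurable_EFinP.
- by apply: aeW => w _; apply: cvg_EFin; [near=> j|exact: FG].
- exact: iH.
- by apply: aeW => w j _; rewrite /= lee_fin.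
move=> _ _; rewrite /= => cvgH.
have -> : (fun j => mean P (F j)) = fine \o (fun j => \int[P]_w (F j w)%:E)%E by [].
apply: fine_cvg; rewrite -/(mean P G) -meanE//.
by apply: (le_integr mG iH) => w; rewrite (le_trans (GH w))// ler_norm.
Unshelve. all: by end_near. Qed.

Lemma mean_ray d (Om : measurableType d) (R : realType) (P : probability Om R)
    (X : {RV P >-> R}) (a : R) :
  mean P (fun w => clip a j (X w)) @[j --> \oo] --> fine (distribution P X `]a, +oo[%classic).
Proof.
have mXa : measurable (X @^-1` `]a, +oo[%classic).
  by rewrite -[Y in measurable Y]setTI; exact: measurable_funPT.
rewrite -[X in _ --> X]/(fine (P (X @^-1` `]a, +oo[%classic))) -mean_indic//.
apply: (@mean_dominated _ _ _ _ _ _ (fun=> 1)).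
- by move=> j; apply: (measurableT_comp (measurable_clip a j)).
- exact: integr_cst.
- by move=> j w; exact: norm_clip.
- move=> w; rewrite [X in _ --> X](_ : _ = \1_`]a, +oo[ (X w)); first exact: cvg_clip.
  by rewrite !indicE.
Qed.

Lemma law_eq_clip d (Om : measurableType d) (R : realType) (P : probability Om R)
    d' (Om' : measurableType d') (Q : probability Om' R)
    (X : {RV P >-> R}) (Y : {RV Q >-> R}) :
  (forall a j, mean P (fun w => clip a j (X w)) = mean Q (fun w => clip a j (Y w))) ->
  forall B, measurable B -> distribution P X B = distribution Q Y B.
Proof.
move=> H; apply: measure_rays_unique.
- apply: (le_lt_trans (_ : _ <= 1)%E); last exact: ltry.
  by have := probability_le1 P (@measurableT _ Om); rewrite -[X in P X](preimage_setT X).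
- have := probability_setT P; rewrite -[X in P X](preimage_setT X) => PT.
  have := probability_setT Q; rewrite -[X in Q X](preimage_setT Y) => QT.
  by rewrite -PT in QT.
move=> a; rewrite -[LHS]fineK ?fin_num_measure// -[RHS]fineK ?fin_num_measure//.
congr (_%:E); have := @mean_ray _ _ _ P X a; rewrite (eq_cvg _ _ (H a)).
by move=> /cvg_unique; apply => //; exact: mean_ray.
Qed.

(** Weak convergence applied to constant sequences: equal cosine means give equal means of the ramps
    [clip a j]. *)
Lemma cos_law_unique d (Om : measurableType d) (R : realType) (P : probability Om R)
    d' (Om' : measurableType d') (Q : probability Om' R)
    (X : {RV P >-> R}) (Y : {RV Q >-> R}) :
  integr P (fun w => X w ^+ 2) -> integr Q (fun w => Y w ^+ 2) ->
  (forall t b, mean P (fun w => cos (t * X w + b)) = mean Q (fun w => cos (t * Y w + b))) ->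
  forall B, measurable B -> distribution P X B = distribution Q Y B.
Proof.
move=> X2 Y2 HC; apply: law_eq_clip => a j.
pose B := Num.max (mean P (fun w => X w ^+ 2)) (mean Q (fun w => Y w ^+ 2)).
have XB : mean P (fun w => X w ^+ 2) <= B by rewrite le_max lexx.
have YB : mean Q (fun w => Y w ^+ 2) <= B by rewrite le_max lexx orbT.
have mf : continuous (fun x : 'rV[R]_1 => clip a j (x 0 0)).
  by move=> x; apply: continuous_comp; [exact: coord_continuous|exact: continuous_clip].
have mX j0 : measurable_fun setT ((fun=> X : Om -> R) (j0 : 'I_1)) by [].
have H : mean P (fun w => clip a j (row_of (fun _ : 'I_1 => X : Om -> R) w 0 0)) @[_ --> \oo] -->
    mean Q (fun w => clip a j (row_of (fun _ : 'I_1 => Y : Om' -> R) w 0 0)).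
  apply: (@cvg_mean_continuous R 1 (fun=> d) (fun=> Om) (fun=> P) (fun _ _ => X)
    d' Om' Q (fun=> Y) B _ _ _ _ _ _ _ (fun x => clip a j (x 0 0)) 1) => //.
  - move=> t b; rewrite (_ : (fun=> _) = fun=> mean P (fun w => cos (t 0 * X w + b))).
      rewrite HC; rewrite (_ : mean Q _ = mean Q (fun w => cos (\sum_j0 t j0 * Y w + b))).
        exact: cvg_cst.
      by congr mean; apply/funext => w; rewrite big_ord1.
    by apply/funext => _; congr mean; apply/funext => w; rewrite big_ord1.
  - by move=> x; exact: norm_clip.
rewrite [LHS](_ : _ = mean P (fun w => clip a j (row_of (fun _ : 'I_1 => X : Om -> R) w 0 0))).
  rewrite (cvg_unique _ (@cvg_cst _ _ _ _ _) H)//.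
  by congr mean; apply/funext => w; rewrite mxE.
by congr mean; apply/funext => w; rewrite mxE.
Qed.

(** * Gaussian sequences *)

Section NormalMoments.
Variables (R : realType) (s : R).
Hypothesis s0 : s != 0.
Notation mu := (@lebesgue_measure R).
Let nu : probability (measurableTypeR R) R := normal_prob 0 s.

Lemma integral_normal_prob (h : R -> R) : measurable_fun setT h ->
  (\int[nu]_x (h x)%:E = \int[mu]_x (h x * normal_pdf 0 s x)%:E)%E.
Proof.
move=> mh; have nuE B : measurable B ->
    (\int[mu]_w (\1_B w * normal_pdf 0 s w)%:E = nu B)%E.
  move=> mB; rewrite /nu /= /normal_prob [RHS]integral_mkcond.
  apply: eq_integral => x _; rewrite patchE indicE.
  by case: ifP => _; rewrite ?mul1r ?mul0r.
have D := @ge0_integral_density _ _ (measurableTypeR R) (measurableTypeR R) R mu nu id (normal_pdf 0 s)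
  (@measurable_id _ _ setT) (measurable_normal_pdf 0 s) (normal_pdf_ge0 0 s) nuE.
rewrite integralE [RHS]integralE; congr (_ - _)%E.
- rewrite (_ : (_ ^\+)%E = (fun x => (Num.max (h x) 0)%:E)); last first.
    by apply/funext => x; rewrite funeposE -EFin_max.
  rewrite -D; [|exact: measurable_maxr|by move=> x; rewrite le_max lexx orbT].
  apply: eq_integral => x _; rewrite funeposE -EFin_max.
  by rewrite maxr_pMl ?normal_pdf_ge0// mul0r.
- rewrite (_ : (_ ^\-)%E = (fun x => (Num.max (- h x) 0)%:E)); last first.
    by apply/funext => x; rewrite funenegE -EFinN -EFin_max.
  rewrite -D; [|apply: measurable_maxr => //; exact: measurableT_comp
    |by move=> x; rewrite le_max lexx orbT].
  apply: eq_integral => x _; rewrite funenegE -EFinN -EFin_max.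
  by rewrite maxr_pMl ?normal_pdf_ge0// mul0r mulNr.
Qed.

(* Completing the square reduces exponential moments to the total mass of a
   shifted normal law. *)
Lemma expR_normal_pdf (t x : R) : expR (t * x) * normal_pdf 0 s x =
  expR (t ^+ 2 * s ^+ 2 / 2) * normal_pdf (t * s ^+ 2) s x.
Proof.
rewrite !normal_pdfE// /normal_fun mulrCA [RHS]mulrCA -!expRD; congr (_ * expR _).
have -> : s ^+ 2 *+ 2 = 2 * s ^+ 2 by rewrite mulr_natl.
by field.
Qed.

Lemma integr_normal_expR (t : R) : integr nu (fun x => expR (t * x)).
Proof.
have mf : measurable_fun setT (fun x : R => expR (t * x)).
  by apply: (measurableT_comp (@measurable_expR R)); exact: measurable_funM.
apply/integrableP; split; first exact/measurable_EFinP.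
under eq_integral do rewrite /= ger0_norm ?expR_ge0//.
rewrite integral_normal_prob//; under eq_integral do rewrite expR_normal_pdf EFinM.
rewrite ge0_integralZl ?lee_fin ?expR_ge0//.
- by rewrite integral_normal_pdf mule1 ltry.
- by apply/measurable_EFinP; exact: measurable_normal_pdf.
- by move=> x _; rewrite lee_fin normal_pdf_ge0.
Qed.

Lemma expr_le_expR (x : R) m : `|x| ^+ m <= m`!%:R * (expR (1 * x) + expR ((- 1) * x)).
Proof.
have H (y : R) : 0 <= y -> y ^+ m <= m`!%:R * expR y.
  move=> y0; have f0 : 0 < m`!%:R :> R by rewrite ltr0n fact_gt0.
  case: m f0 => [|m] f0; first by rewrite expr0 fact0 mul1r -expR0 ler_expR.
  rewrite -ler_pdivrMl// mulrC; apply: le_trans (expR_ge1Dxn m y0); lra.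
rewrite mul1r mulN1r mulrDr; have := expR_ge0 x; have := expR_ge0 (- x) => e1 e2.
have f0 : 0 <= m`!%:R :> R by [].
have [x0|x0] := lerP 0 x.
  by rewrite (ger0_norm x0) (le_trans (H _ x0))// lerDl mulr_ge0.
rewrite (ltr0_norm x0) (le_trans (H _ _)) ?oppr_ge0 ?(ltW x0)// lerDr mulr_ge0//.
Qed.

Lemma integr_normal_expr m : integr nu (fun x => x ^+ m).
Proof.
apply: (@le_integr _ (measurableTypeR R) R nu (fun x : R => x ^+ m) (fun x : R => m`!%:R * (expR (1 * x) + expR ((- 1) * x)))).
- exact: measurable_funX.
- by apply: integrZ; apply: integrD; exact: integr_normal_expR.
- move=> x; rewrite normrX (le_trans (expr_le_expR x m))//; exact: ler_norm.
Qed.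

Lemma is_derive_normal_pdf (x : R) :
  is_derive x 1 (normal_pdf 0 s) (- (x / s ^+ 2) * normal_pdf 0 s x).
Proof.
pose c := - (s ^+ 2 *+ 2)^-1; pose g := c \*: ((@id R) ^+ 2).
have -> : normal_pdf 0 s = normal_peak s \*: (expR \o g).
  rewrite normal_pdfE//; apply/funext => y; rewrite /normal_fun subr0 /g /=.
  rewrite -[RHS]/(_ * expR (c * (y * y))) /c mulNr [X in - X]mulrC -mulNr.
  by rewrite -expr2.
have dg : is_derive x 1 g (c * (x *+ 2)).
  by apply: is_derive_eq; rewrite /GRing.scale /= mulr1 expr1 mulr_natl.
have de := @is_derive1_comp R expR g x (expR (g x)) _ (is_derive_expR _) dg.
apply: is_derive_eq; rewrite -[_ *: _]/(_ * _) -[(_ \*: _) x]/(_ * _) /=.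
have -> : c * (x *+ 2) = - (x / s ^+ 2).
  rewrite /c; have -> : s ^+ 2 *+ 2 = 2 * s ^+ 2 by rewrite mulr_natl.
  by rewrite -mulr_natr; field.
by ring.
Qed.

Lemma is_derive_expr_normal_pdf m (x : R) :
  is_derive x 1 (fun y => y ^+ m * normal_pdf 0 s y)
    ((m%:R * x ^+ m.-1 - x ^+ m.+1 / s ^+ 2) * normal_pdf 0 s x).
Proof.
have d1 := is_derive_normal_pdf x.
case: m => [|m].
  rewrite (_ : (fun y => _) = normal_pdf 0 s); last by apply/funext => y; rewrite mul1r.
  by apply: is_derive_eq; rewrite mul0r sub0r expr1.
have -> : (fun y => y ^+ m.+1 * normal_pdf 0 s y) = (@id R) ^+ m.+1 * normal_pdf 0 s.
  have expE k y : ((@id R) ^+ k) y = y ^+ k by elim: k => // k IHk; rewrite !exprS -IHk.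
  by apply/funext => y; rewrite -[RHS]/(_ * _) expE.
apply: is_derive_eq.
have expE k y : ((@id R) ^+ k) y = y ^+ k by elim: k => // k IHk; rewrite !exprS -IHk.
rewrite expE /GRing.scale /= mulr1 !exprS; ring.
Qed.

Lemma cvg_expr_normal_pdf m :
  n%:R ^+ m * normal_pdf 0 s n%:R @[n --> \oo] --> (0 : R).
Proof.
pose c : R := (s ^+ 2 *+ 2)^-1.
have c0 : 0 < c by rewrite invr_gt0 pmulrn_lgt0// exprn_even_gt0.
(* The exponential is bounded below by its Taylor term of order [m.+1], which leaves n^{m-2(m+1)},
   at most 1/n. *)
pose K := normal_peak s * ((m.+1)`!%:R / c ^+ m.+1).
have K0 : 0 <= K.
  by rewrite mulr_ge0 ?normal_peak_ge0// divr_ge0// exprn_ge0// ltW.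
rewrite -(cvg_shiftS (fun n : nat => n%:R ^+ m * normal_pdf 0 s n%:R)).
apply: (@squeeze_cvgr _ _ _ _ (fun=> 0) (fun n => K * n.+1%:R^-1)).
- near=> n; rewrite mulr_ge0 ?normal_pdf_ge0//= normal_pdfE// /normal_fun subr0.
  rewrite mulNr expRN mulrCA /K -mulrA; apply: ler_wpM2l; first exact: normal_peak_ge0.
  have := expR_ge1Dxn m (_ : 0 <= n.+1%:R ^+ 2 * c); rewrite mulr_ge0 ?(ltW c0)// => /(_ isT) h.
  have {}h : (n.+1%:R ^+ 2 * c) ^+ m.+1 / (m.+1)`!%:R <= expR (n.+1%:R ^+ 2 * c) by lra.
  have f0 : 0 < (m.+1)`!%:R :> R by rewrite ltr0n fact_gt0.
  rewrite ler_pdivrMr ?expR_gt0// mulrAC ler_pdivlMr ?ltr0Sn// -exprSr -ler_pdivrMl; last first.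
    by rewrite divr_gt0// exprn_gt0.
  apply: le_trans h; rewrite invf_div exprMn -exprM [leLHS]mulrC mulrA.
  rewrite ler_wpM2r ?invr_ge0 ?ler0n// ler_wpM2r ?exprn_ge0 ?(ltW c0)//.
  by apply: ler_weXn2l; rewrite ?ler1n//; lia.
- exact: cvg_cst.
- rewrite -[X in _ --> X](mulr0 K); apply: cvgM; first exact: cvg_cst.
  exact: cvg_harmonic.
Unshelve. all: by end_near. Qed.

(** Integration by parts: the integrand times the density is the derivative of [x ^+ m] times the
    density, whose boundary values on growing intervals tend to 0 by [cvg_expr_normal_pdf]. *)
Lemma mean_normal_recursion m :
  mean nu (fun x => m%:R * x ^+ m.-1 - x ^+ m.+1 / s ^+ 2) = 0.
Proof.
pose D (x : R) := m%:R * x ^+ m.-1 - x ^+ m.+1 / s ^+ 2; rewrite -/(mean nu D).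
pose F (y : R) := y ^+ m * normal_pdf 0 s y.
pose A n : set R := `[- (n.+1%:R : R), n.+1%:R]%classic.
have mD : measurable_fun setT D.
  by apply: measurable_funB; apply: measurable_funM => //; exact: measurable_funX.
have iD : integr nu D.
  apply: integrB; first by apply: integrZ; exact: integr_normal_expr.
  rewrite (_ : (fun w => _) = fun w : R => (s ^+ 2)^-1 * w ^+ m.+1).
    by apply: integrZ; exact: integr_normal_expr.
  by apply/funext => w; rewrite mulrC.
have cut n : mean nu (fun x : R => D x * \1_(A n) x) = F n.+1%:R - F (- n.+1%:R).
  rewrite /mean integral_normal_prob; last first.
    by apply: measurable_funM => //; apply: measurable_indic; exact: measurable_itv.
  rewrite (_ : (\int[mu]_x _)%E = (\int[mu]_(x in A n) (D x * normal_pdf 0 s x)%:E)%E); last first.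
    rewrite [RHS]integral_mkcond; apply: eq_integral => x _; rewrite patchE indicE.
    by case: ifP => _; rewrite ?mulr1 ?mulr0 ?mul0r.
  have dF (x : R) : is_derive x 1 F (D x * normal_pdf 0 s x) by exact: is_derive_expr_normal_pdf.
  have cF : continuous F.
    move=> x; apply: differentiable_continuous; apply/derivable1_diffP.
    by have [] := dF x.
  rewrite (@continuous_FTC2 _ (fun x => D x * normal_pdf 0 s x) F)//.
  - by rewrite -subr_gt0 opprK addr_gt0// ltr0Sn.
  - apply: continuous_subspaceT => x; apply: cvgM; last exact: continuous_normal_pdf.
    apply: cvgB; apply: cvgM; try exact: cvg_cst.
      exact: exprn_continuous.
    exact: exprn_continuous.
  - split; [by move=> x _; have [] := dF x|exact/cvg_at_right_filter/cF
      |exact/cvg_at_left_filter/cF].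
  - by move=> x _; rewrite derive1E; have [] := dF x.
have h0 : mean nu (fun x : R => D x * \1_(A n) x) @[n --> \oo] --> mean nu D.
  apply: (@mean_dominated _ (measurableTypeR R) R nu (fun n (x : R) => D x * \1_(A n) x)
    D (fun x : R => `|D x|)).
  - by move=> n; apply: measurable_funM => //; apply: measurable_indic; exact: measurable_itv.
  - exact: integr_norm.
  - move=> n x; rewrite indicE normrM; case: (_ \in _); rewrite ?normr1 ?mulr1//.
    by rewrite normr0 mulr0.
  - move=> x; apply: cvg_near_cst; near=> n; rewrite indicE mem_set ?mulr1//.
    rewrite /A /= in_itv/= -ler_norml; apply: (@le_trans _ _ n%:R); last by rewrite ler_nat.
    by near: n; exact: nbhs_infty_ger.
have Fl : F n.+1%:R @[n --> \oo] --> (0 : R).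
  by rewrite (cvg_shiftS (fun n : nat => F n%:R)); exact: cvg_expr_normal_pdf.
have FN (x : R) : F (- x) = (-1) ^+ m * F x.
  have -> : F (- x) = (- x) ^+ m * normal_pdf 0 s x.
    by rewrite /F !normal_pdfE// /normal_fun !subr0 sqrrN.
  by rewrite (exprNn x) -mulrA.
suff h1 : mean nu (fun x : R => D x * \1_(A n) x) @[n --> \oo] --> (0 : R).
  exact: (cvg_unique _ h0 h1).
rewrite (_ : (fun n => _) = fun n => F n.+1%:R - (-1) ^+ m * F n.+1%:R); last first.
  by apply/funext => n; rewrite cut FN.
rewrite [X in _ --> X](_ : 0 = 0 - (-1) ^+ m * 0); last by rewrite mulr0 subr0.
by apply: cvgB => //; apply: cvgM => //; exact: cvg_cst.
Unshelve. all: by end_near. Qed.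

Lemma mean_normal_expr m : mean nu (fun x => x ^+ m) = gaussian_moment (s ^+ 2) m.
Proof.
(* For [k = 0] this says that the mean is 0: the truncated predecessor comes with the factor 0. *)
have E k : mean nu (fun x => x ^+ k.+1) = k%:R * s ^+ 2 * mean nu (fun x => x ^+ k.-1).
  have := mean_normal_recursion k; have i0 := integr_normal_expr k.-1.
  have i2 := integr_normal_expr k.+1.
  rewrite (_ : (fun x => _) = fun x : measurableTypeR R =>
     (k%:R * x ^+ k.-1 - (s ^+ 2)^-1 * x ^+ k.+1)); last first.
    by apply/funext => x; rewrite [X in _ - X]mulrC.
  rewrite meanB; [|exact: integrZ|exact: integrZ].
  rewrite !meanZ// => /eqP; rewrite subr_eq0 => /eqP H.
  by rewrite mulrAC H mulrAC mulVf ?mul1r// expf_neq0.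
suff [] : mean nu (fun x => x ^+ m) = gaussian_moment (s ^+ 2) m /\
  mean nu (fun x => x ^+ m.+1) = gaussian_moment (s ^+ 2) m.+1 by [].
elim: m => [|m [IH0 IH1]]; last by split => //; rewrite E gaussian_momentSS IH0.
split; first by under eq_fun do rewrite expr0; rewrite mean_cst.
by rewrite E !mul0r.
Qed.

End NormalMoments.

(** * Splitting a uniform number by its binary digits *)

Lemma sum_nat_mul (R : nmodType) (F : nat -> R) n q :
  \sum_(i < n * q) F i = \sum_(i < n) \sum_(r < q) F (i * q + r)%N.
Proof.
elim: n => [|n IHn]; first by rewrite !big_ord0.
rewrite [RHS]big_ord_recr /= -IHn mulSn addnC -!(big_mkord xpredT F).
rewrite (@big_cat_nat _ _ _ (n * q))//=; last exact: leq_addr.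
congr (_ + _); rewrite -{1}[(n * q)%N]add0n big_addn addnC addnK big_mkord.
by apply: eq_bigr => i _; rewrite addnC.
Qed.

(* [even_digits m n] and [odd_digits m n] are the numbers whose [m] binary
   digits are the digits of even, resp. odd, rank among the [2 m] digits of [n]. *)
Fixpoint even_digits (m n : nat) : nat :=
  if m is m'.+1 then (2 * even_digits m' (n %/ 4) + n %% 4 %/ 2)%N else 0%N.

Fixpoint odd_digits (m n : nat) : nat :=
  if m is m'.+1 then (2 * odd_digits m' (n %/ 4) + n %% 2)%N else 0%N.

(** Separating digits is a bijection from the numbers below 4^m onto the pairs of numbers below 2^m;
    a base-4 digit [r] splits into [r %/ 2] and [r %% 2]. *)
Lemma sum_digits (R : nmodType) (F : nat -> nat -> R) m :
  \sum_(n < 4 ^ m) F (even_digits m n) (odd_digits m n) =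
  \sum_(i < 2 ^ m) \sum_(j < 2 ^ m) F i j.
Proof.
elim: m F => [|m IHm] F; first by rewrite !big_ord1.
rewrite !expnSr (sum_nat_mul (fun n => F (even_digits m.+1 n) (odd_digits m.+1 n))).
rewrite (sum_nat_mul (fun i => \sum_(j < _) F i j)).
pose G i j := \sum_(r < 4) F (2 * i + r %/ 2)%N (2 * j + r %% 2)%N.
transitivity (\sum_(n < 4 ^ m) G (even_digits m n) (odd_digits m n)).
  apply: eq_bigr => n _; apply: eq_bigr => r _ /=.
  have r4 := ltn_ord r.
  have -> : ((n * 4 + r) %/ 4 = n)%N by lia.
  have -> : ((n * 4 + r) %% 4 = r)%N by lia.
  by have -> : ((n * 4 + r) %% 2 = r %% 2)%N by lia.
rewrite IHm; apply: eq_bigr => i _.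
under [RHS]eq_bigr do rewrite (sum_nat_mul (F _)).
rewrite [RHS]exchange_big /=; apply: eq_bigr => j _.
rewrite /G !big_ord_recl !big_ord0 /= !addr0 !addn0 !addrA.
by rewrite /bump /= ![(2 * _)%N]mulnC !addn0.
Qed.

Lemma even_digits_lt m n : (even_digits m n < 2 ^ m)%N.
Proof.
elim: m n => //= m IHm n; rewrite expnS; have := IHm (n %/ 4)%N.
have : (n %% 4 %/ 2 < 2)%N by rewrite ltn_divLR// ltn_mod.
by move: (_ %/ 2)%N (even_digits _ _) (2 ^ m)%N; lia.
Qed.

Lemma odd_digits_lt m n : (odd_digits m n < 2 ^ m)%N.
Proof.
elim: m n => //= m IHm n; rewrite expnS; have := IHm (n %/ 4)%N.
have : (n %% 2 < 2)%N by rewrite ltn_mod.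
by move: (_ %% 2)%N (odd_digits _ _) (2 ^ m)%N; lia.
Qed.

Section Uniform.
Variable R : realType.
Notation V := (measurableTypeR R).

Definition uniform01 : probability V R := uniform_prob (@ltr01 R).
Notation P := uniform01.

Lemma uniform01_itv (s t : bool) (u v : R) : 0 <= u -> u <= v -> v <= 1 ->
  P [set` Interval (BSide s u) (BSide t v)] = (v - u)%:E.
Proof.
move=> u0 uv v1; rewrite /P /= /uniform_prob.
rewrite (eq_integral (fun=> 1%:E)); last first.
  move=> x /set_mem; rewrite /= in_itv => /andP[/lteifW ux /lteifW xv].
  by rewrite /uniform_pdf subr0 invr1 (le_trans u0 ux) (le_trans xv v1).
rewrite integral_cst//= mul1e lebesgue_measure_itv/= lte_fin.
case: ltP => [uv'|vu]; first by rewrite -EFinD.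
by rewrite (@le_anti _ _ u v) ?uv// subrr.
Qed.

Lemma uniform01_setI (s t : bool) (B : set V) : measurable B ->
  P B = P (B `&` [set` Interval (BSide s 0) (BSide t 1)]).
Proof.
pose I := [set` Interval (BSide s (0 : R)) (BSide t 1)].
move=> mB; have mI : measurable (I : set V) by exact: measurable_itv.
rewrite (measureDI P mB mI) -[RHS]add0e; congr (_ + _)%E.
apply: (@subset_measure0 _ _ _ P _ (~` I)).
- exact: measurableD.
- exact: measurableC.
- by move=> x [].
- have := @probability_setC _ _ _ P _ mI.
  by rewrite uniform01_itv// subr0 subee// => ->.
Qed.

(** Not the fractional part: points outside [0, 1[, a null set for the uniform law, are sent to 0 so
    that every real number has digits. *)
Definition frac01 (x : R) : R := x * \1_`[0, 1[ x.

Lemma frac01_itv x : 0 <= frac01 x < 1.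
Proof.
rewrite /frac01 indicE; case: (boolP (x \in _)) => [|_].
  by rewrite inE/= in_itv/= mulr1.
by rewrite mulr0 lexx ltr01.
Qed.

Lemma frac01_id x : 0 <= x < 1 -> frac01 x = x.
Proof. by move=> x01; rewrite /frac01 indicE mem_set ?mulr1//= in_itv. Qed.

Lemma measurable_frac01 : measurable_fun setT frac01.
Proof. by apply: measurable_funM => //; apply: measurable_indic; exact: measurable_itv. Qed.

(** The first [m] base-4 digits, that is 2m binary digits, read as an integer. *)
Definition digits m (x : R) : nat := Num.trunc (4 ^+ m * frac01 x).

Lemma scaled_frac01_ge0 m x : 0 <= 4 ^+ m * frac01 x.
Proof. by have /andP[? _] := frac01_itv x; rewrite mulr_ge0// exprn_ge0. Qed.

Lemma digits_lt m x : (digits m x < 4 ^ m)%N.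
Proof.
have /andP[_ x1] := frac01_itv x.
by rewrite truncn_lt_nat ?scaled_frac01_ge0// natrX gtr_pMr// exprn_gt0.
Qed.

Lemma digitsS m x : (digits m.+1 x %/ 4)%N = digits m x.
Proof.
have h0 := scaled_frac01_ge0 m x; have h1 := scaled_frac01_ge0 m.+1 x.
have /andP[l1 u1] := truncn_itv h1; rewrite -/(digits m.+1 x) in l1 u1.
apply/esym/eqP; rewrite /digits truncn_eq//.
set q := (digits m.+1 x %/ 4)%N.
have qE : (digits m.+1 x = q * 4 + digits m.+1 x %% 4)%N by exact: divn_eq.
have r4 : (digits m.+1 x %% 4 < 4)%N by rewrite ltn_mod.
have E : 4 ^+ m.+1 * frac01 x = 4 * (4 ^+ m * frac01 x) by rewrite exprS mulrA.
have q1 : (q * 4)%:R <= (digits m.+1 x)%:R :> R by rewrite ler_nat qE leq_addr.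
have q2 : (digits m.+1 x).+1%:R <= (q.+1 * 4)%:R :> R by rewrite ler_nat; lia.
rewrite natrM in q1; rewrite natrM in q2; rewrite E in l1 u1.
by apply/andP; split; lra.
Qed.

Lemma measurable_digits_eq m n : measurable [set x : V | digits m x = n].
Proof.
have mf : measurable_fun setT (fun x => 4 ^+ m * frac01 x).
  by apply: measurable_funM => //; exact: measurable_frac01.
rewrite (_ : [set x | _] = setT `&` (fun x => 4 ^+ m * frac01 x) @^-1` `[n%:R, n.+1%:R[%classic).
  by apply: mf => //; exact: measurable_itv.
rewrite setTI; apply/seteqP; split => x /=; rewrite in_itv/=.
  by move=> <-; apply: truncn_itv; exact: scaled_frac01_ge0.
by move=> h; apply: truncn_def.
Qed.

Lemma prob_digits_eq m n : (n < 4 ^ m)%N ->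
  fine (P [set x : V | digits m x = n]) = (4 ^+ m)^-1.
Proof.
move=> nm; have p0 : 0 < 4 ^+ m :> R by rewrite exprn_gt0.
rewrite (uniform01_setI true true); last exact: measurable_digits_eq.
rewrite (_ : _ `&` _ = `[n%:R / 4 ^+ m, n.+1%:R / 4 ^+ m[%classic).
  rewrite uniform01_itv.
  - by rewrite /= -mulrBl -natr1 addrAC subrr add0r mul1r.
  - by rewrite divr_ge0// ltW.
  - by rewrite ler_pM2r ?invr_gt0// ler_nat.
  - by rewrite ler_pdivrMr// mul1r -natrX ler_nat.
have key x : 0 <= x < 1 -> (digits m x == n) = (n%:R / 4 ^+ m <= x < n.+1%:R / 4 ^+ m).
  move=> x01; have := scaled_frac01_ge0 m x; rewrite /digits (frac01_id x01) => h0.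
  by rewrite truncn_eq// ler_pdivrMr// ltr_pdivlMr// mulrC.
apply/seteqP; split => x /=; rewrite !in_itv/=.
  by move=> [/eqP h x01]; rewrite -key.
move=> h; have x01 : 0 <= x < 1.
  move: h => /andP[h1 h2]; apply/andP; split.
    by apply: le_trans h1; rewrite divr_ge0// ltW.
  by apply: (lt_le_trans h2); rewrite ler_pdivrMr// mul1r -natrX ler_nat.
by split => //; apply/eqP; rewrite key.
Qed.

Lemma digits_indic m (f : nat -> R) x :
  f (digits m x) = \sum_(n < 4 ^ m) f n * \1_[set y : V | digits m y = n] x.
Proof.
rewrite (bigD1 (Ordinal (digits_lt m x)))//= big1 => [|i ix].
  by rewrite addr0 indicE mem_set// mulr1.
rewrite indicE memNset ?mulr0// => /= h; move/eqP: ix; apply.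
by apply/val_inj; rewrite /= -h.
Qed.

Lemma measurable_digits m (f : nat -> R) : measurable_fun setT (fun x : V => f (digits m x)).
Proof.
rewrite (_ : (fun x => _) = fun x : V =>
    \sum_(n < 4 ^ m) f n * \1_[set y : V | digits m y = n] x); last first.
  by apply/funext => x; exact: digits_indic.
apply: measurable_sum => n; apply: measurable_funM => //.
by apply: measurable_indic; exact: measurable_digits_eq.
Qed.

Lemma mean_digits m (f : nat -> R) :
  mean P (fun x => f (digits m x)) = (4 ^+ m)^-1 * \sum_(n < 4 ^ m) f n.
Proof.
have mI n : integr P (fun x : V => f n * \1_[set y : V | digits m y = n] x).
  apply: integrZ; apply: (@integr_bounded _ _ _ _ _ 1).
    by apply: measurable_indic; exact: measurable_digits_eq.
  by move=> w; rewrite indicE; case: (_ \in _); rewrite ?normr1 ?normr0.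
rewrite (_ : (fun x => _) = fun x : V =>
    \sum_(n < 4 ^ m) f n * \1_[set y : V | digits m y = n] x); last first.
  by apply/funext => x; exact: digits_indic.
rewrite mean_sum => [|n _]; last exact: mI.
rewrite mulr_sumr; apply: eq_bigr => n _; rewrite meanZ.
  by rewrite mean_indic ?prob_digits_eq//; [rewrite mulrC|exact: measurable_digits_eq].
apply: (@integr_bounded _ _ _ _ _ 1).
  by apply: measurable_indic; exact: measurable_digits_eq.
by move=> w; rewrite indicE; case: (_ \in _); rewrite ?normr1 ?normr0.
Qed.

End Uniform.

Section DigitLimit.
Variables (R : realType) (e : nat -> nat -> nat) (c : nat -> nat).
Hypothesis eS : forall m n, e m.+1 n = (2 * e m (n %/ 4) + c n)%N.
Hypothesis e_lt : forall m n, (e m n < 2 ^ m)%N.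
Notation V := (measurableTypeR R).

Definition binary_approx (m : nat) (x : R) : R := (e m (digits m x))%:R / 2 ^+ m.

Definition binary_limit (x : R) : R := limn (fun m => binary_approx m x).

Lemma cvg_binary_approx x : binary_approx m x @[m --> \oo] --> binary_limit x.
Proof.
apply: nondecreasing_is_cvgn.
  apply/nondecreasing_seqP => m; rewrite /binary_approx eS digitsS exprS.
  rewrite ler_pdivlMr ?mulr_gt0 ?exprn_gt0// mulrCA mulfVK ?expf_neq0//.
  by rewrite natrD natrM lerDl.
exists 1 => _ [m _ <-]; rewrite ler_pdivrMr ?exprn_gt0// mul1r -natrX ler_nat.
exact/ltnW/e_lt.
Qed.

Lemma measurable_binary_approx m : measurable_fun setT (binary_approx m : V -> R).
Proof. exact: (measurable_digits m (fun n => (e m n)%:R / 2 ^+ m)). Qed.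

Lemma measurable_binary_limit : measurable_fun setT (binary_limit : V -> R).
Proof.
apply: (measurable_fun_cvg (h := fun m => binary_approx m : V -> R)).
  by move=> m; exact: measurable_binary_approx.
by move=> x _; exact: cvg_binary_approx.
Qed.

End DigitLimit.

Section Split.
Variable R : realType.
Notation V := (measurableTypeR R).
Notation P := (uniform01 R).

Definition even_part : R -> R := binary_limit even_digits.
Definition odd_part : R -> R := binary_limit odd_digits.

Lemma cvg_even_part x : binary_approx even_digits m x @[m --> \oo] --> even_part x.
Proof.
exact: (@cvg_binary_approx R even_digits (fun n => n %% 4 %/ 2)%N _ even_digits_lt).
Qed.

Lemma cvg_odd_part x : binary_approx odd_digits m x @[m --> \oo] --> odd_part x.
Proof.
exact: (@cvg_binary_approx R odd_digits (fun n => n %% 2)%N _ odd_digits_lt).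
Qed.

Lemma measurable_even_part : measurable_fun setT (even_part : V -> R).
Proof.
exact: (@measurable_binary_limit R even_digits (fun n => n %% 4 %/ 2)%N _ even_digits_lt).
Qed.

Lemma measurable_odd_part : measurable_fun setT (odd_part : V -> R).
Proof.
exact: (@measurable_binary_limit R odd_digits (fun n => n %% 2)%N _ odd_digits_lt).
Qed.

(** Riemann sum of [h] over [0, 1] with step 2^{-m}. *)
Definition dyadic_mean (h : R -> R) (m : nat) : R :=
  (2 ^+ m)^-1 * \sum_(i < 2 ^ m) h (i%:R / 2 ^+ m).

Lemma mean_approx2 (h k : R -> R) m :
  mean P (fun x => h (binary_approx even_digits m x) * k (binary_approx odd_digits m x)) =
  dyadic_mean h m * dyadic_mean k m.
Proof.
rewrite (mean_digits m (fun n => h ((even_digits m n)%:R / 2 ^+ m) * k ((odd_digits m n)%:R / 2 ^+ m))).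
rewrite (sum_digits (fun i j => h (i%:R / 2 ^+ m) * k (j%:R / 2 ^+ m))).
rewrite /dyadic_mean mulrACA -invfM -exprMn -natrM; congr (_ * _).
by rewrite mulr_suml; apply: eq_bigr => i _; rewrite mulr_sumr.
Qed.

Section Test.
Variables h k : R -> R.
Hypotheses (ch : continuous h) (ck : continuous k).
Hypotheses (h1 : forall x, `|h x| <= 1) (k1 : forall x, `|k x| <= 1).

Lemma cvg_mean_test (F G : nat -> R -> R) (f g : R -> R) :
  (forall m, measurable_fun setT (F m : V -> R)) ->
  (forall m, measurable_fun setT (G m : V -> R)) ->
  (forall x, F m x @[m --> \oo] --> f x) -> (forall x, G m x @[m --> \oo] --> g x) ->
  mean P (fun x => h (F m x) * k (G m x)) @[m --> \oo] --> mean P (fun x => h (f x) * k (g x)).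
Proof.
move=> mF mG Ff Gg.
apply: (@mean_dominated _ V R P (fun m x => h (F m x) * k (G m x)) _ (fun=> 1)).
- move=> m; apply: measurable_funM.
    exact: (measurableT_comp (continuous_measurable_fun ch) (mF m)).
  exact: (measurableT_comp (continuous_measurable_fun ck) (mG m)).
- exact: integr_cst.
- by move=> m x; rewrite normrM mulr_ile1.
- move=> x; apply: cvgM.
    by apply: (cvg_comp _ h (Ff x)); exact: ch.
  by apply: (cvg_comp _ k (Gg x)); exact: ck.
Qed.

End Test.

(** Convergence comes from the even part, the Riemann sums being the means of [h] over its
    approximations. The value of the limit comes from the subsequence of even ranks, where they are
    also means over all the digits. *)
Lemma cvg_dyadic_mean (h : R -> R) : continuous h -> (forall x, `|h x| <= 1) ->
  dyadic_mean h m @[m --> \oo] --> mean P (h \o frac01 (R := R)).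
Proof.
move=> ch h1; pose k : R -> R := cst 1.
have ck : continuous k by move=> x; exact: cvg_cst.
have k1 x : `|k x| <= 1 by rewrite normr1.
have kE m : dyadic_mean k m = 1.
  by rewrite /dyadic_mean sumr_const card_ord natrX mulVf// gt_eqF// exprn_gt0.
have A : dyadic_mean h m @[m --> \oo] --> mean P (fun x => h (even_part x) * k (odd_part x)).
  rewrite (_ : (fun m => _) = fun m => mean P (fun x =>
    h (binary_approx even_digits m x) * k (binary_approx odd_digits m x))); last first.
    by apply/funext => m; rewrite mean_approx2 kE mulr1.
  exact: (cvg_mean_test ch ck h1 k1 (@measurable_binary_approx R even_digits)
    (@measurable_binary_approx R odd_digits) cvg_even_part cvg_odd_part).
pose u m (x : R) : R := (digits m x)%:R / 4 ^+ m.
have mu m : measurable_fun setT (u m : V -> R).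
  exact: (measurable_digits m (fun n => n%:R / 4 ^+ m)).
have cu x : u m x @[m --> \oo] --> frac01 x.
  apply/cvgrPdist_le => e e0; near=> m.
  have p0 : 0 < 4 ^+ m :> R by rewrite exprn_gt0.
  have /andP[l1 u1] := truncn_itv (scaled_frac01_ge0 m x).
  rewrite -/(digits m x) in l1 u1; rewrite /u.
  have E : frac01 x = 4 ^+ m * frac01 x / 4 ^+ m by rewrite mulrAC divff ?mul1r// gt_eqF.
  rewrite E -mulrBl normrM [`|_^-1|]gtr0_norm ?invr_gt0// ler_pdivrMr//.
  rewrite ger0_norm ?subr_ge0//; apply: (@le_trans _ _ 1).
    by rewrite lerBlDr addrC natr1 ltW.
  rewrite -ler_pdivrMl// mulr1.
  apply: (@le_trans _ _ m%:R); first by near: m; exact: nbhs_infty_ger.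
  by rewrite -natrX ler_nat ltnW// ltn_expl.
have B : dyadic_mean h (2 * m) @[m --> \oo] --> mean P (fun x => h (frac01 x) * k (frac01 x)).
  rewrite (_ : (fun m => _) = fun m => mean P (fun x => h (u m x) * k (u m x))).
    exact: (cvg_mean_test ch ck h1 k1 mu mu cu cu).
  apply/funext => m; rewrite (mean_digits m (fun n => h (n%:R / 4 ^+ m) * k (n%:R / 4 ^+ m))).
  have e1 : 2 ^+ (2 * m) = 4 ^+ m :> R by rewrite exprM -natrX.
  have e2 : (2 ^ (2 * m) = 4 ^ m)%N by rewrite expnM.
  by rewrite /dyadic_mean e1 e2; congr (_ * _); apply: eq_bigr => i _; rewrite mulr1.
have C : dyadic_mean h (2 * m) @[m --> \oo] --> mean P (fun x => h (even_part x) * k (odd_part x)).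
  apply: (cvg_comp _ _ _ A) => S [n _ nS]; exists n => // m /= nm; apply: nS => /=.
  by rewrite (leq_trans nm)// leq_pmull.
rewrite [X in _ --> X](_ : _ = mean P (fun x => h (frac01 x) * k (frac01 x))).
  by rewrite (cvg_unique _ B C).
by congr mean; apply/funext => x; rewrite /k /= mulr1.
Unshelve. all: by end_near. Qed.

Lemma mean_split (h k : R -> R) : continuous h -> continuous k ->
  (forall x, `|h x| <= 1) -> (forall x, `|k x| <= 1) ->
  mean P (fun x => h (even_part x) * k (odd_part x)) =
  mean P (h \o frac01 (R := R)) * mean P (k \o frac01 (R := R)).
Proof.
move=> ch ck h1 k1.
have := cvg_mean_test ch ck h1 k1 (@measurable_binary_approx R even_digits)
 (@measurable_binary_approx R odd_digits) cvg_even_part cvg_odd_part.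
rewrite (_ : (fun m => _) = fun m => dyadic_mean h m * dyadic_mean k m); last first.
  by apply/funext => m; exact: mean_approx2.
move=> H; apply: (cvg_unique _ H) => //.
by apply: cvgM; exact: cvg_dyadic_mean.
Qed.

Lemma mean_frac01 (h : R -> R) : measurable_fun setT h -> (forall x, `|h x| <= 1) ->
  mean P (h \o frac01 (R := R)) = mean P h.
Proof.
move=> mh h1; have mf := measurableT_comp mh (measurable_frac01 (R := R)).
rewrite /mean; congr fine; apply: ae_eq_integral => //.
- by apply/measurable_EFinP.
- by apply/measurable_EFinP.
exists (~` `[0, 1[%classic); split.
- by apply: measurableC; exact: measurable_itv.
- have mI : measurable (`[0, 1[%classic : set V) by exact: measurable_itv.
  by have := @probability_setC _ _ _ P _ mI; rewrite uniform01_itv// subr0 subee// => ->.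
- move=> x /=; apply: contra_not => /= x01 _; rewrite frac01_id//.
Qed.

End Split.

Definition random_var d (Om : measurableType d) (R : realType) (P : probability Om R)
  (F : Om -> R) (mF : measurable_fun setT F) : {RV P >-> R} :=
  HB.pack F (isMeasurableFun.Build _ _ _ _ F mF).

Section PairIndependence.
Context d (Om : measurableType d) (R : realType) (P : probability Om R).
Variables X Y : {RV P >-> R}.

Let mXpre (B : set R) : measurable B -> measurable (X @^-1` B).
Proof. by move=> mB; rewrite -[Z in measurable Z]setTI; exact: measurable_funPT. Qed.

Let mYpre (B : set R) : measurable B -> measurable (Y @^-1` B).
Proof. by move=> mB; rewrite -[Z in measurable Z]setTI; exact: measurable_funPT. Qed.

Hypothesis XY : forall a b : R, P (X @^-1` `]a, +oo[ `&` Y @^-1` `]b, +oo[) =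
  (P (X @^-1` `]a, +oo[) * P (Y @^-1` `]b, +oo[))%E.

(** For fixed [D] both sides are finite measures of [A] that agree on rays. It is applied to each
    variable in turn, an event of the other one being frozen in [D]. *)
Lemma half_independent (Z : {RV P >-> R}) (D : set Om) : measurable D ->
  (forall a : R, P (Z @^-1` `]a, +oo[ `&` D) = (P (Z @^-1` `]a, +oo[) * P D)%E) ->
  forall A, measurable A -> P (Z @^-1` A `&` D) = (P (Z @^-1` A) * P D)%E.
Proof.
move=> mD H A mA.
have PD0 : 0 <= fine (P D) by rewrite fine_ge0.
pose m1 := pushforward (mrestr P mD) Z.
pose m2 := mscale (NngNum PD0) (distribution P Z).
have m1E B : m1 B = P (Z @^-1` B `&` D) by [].
have m2E B : m2 B = (P (Z @^-1` B) * P D)%E.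
  by rewrite /m2 /mscale /= fineK ?fin_num_measure// muleC.
have m1T : (m1 setT < +oo)%E.
  by rewrite m1E; apply: le_lt_trans (ltry 1); rewrite preimage_setT setTI; exact: probability_le1.
have m12T : m1 setT = m2 setT.
  by rewrite m1E m2E preimage_setT setTI probability_setT mul1e.
have m12 a : m1 `]a, +oo[%classic = m2 `]a, +oo[%classic by rewrite m1E m2E.
by rewrite -m1E -m2E; exact: (measure_rays_unique m1T m12T m12).
Qed.

Lemma independent_of_rays A B : measurable A -> measurable B ->
  P (X @^-1` A `&` Y @^-1` B) = (P (X @^-1` A) * P (Y @^-1` B))%E.
Proof.
move=> mA mB; apply: half_independent => // [|a]; first exact: mYpre.
rewrite setIC muleC; apply: half_independent => // [|b].
  by apply: mXpre; exact: measurable_itv.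
by rewrite setIC muleC.
Qed.

End PairIndependence.

Section PairMean.
Context d (Om : measurableType d) (R : realType) (P : probability Om R).
Variables X Y : {RV P >-> R}.

Lemma independent_of_clip :
  (forall a j b l, mean P (fun w => clip a j (X w) * clip b l (Y w)) =
     mean P (fun w => clip a j (X w)) * mean P (fun w => clip b l (Y w))) ->
  forall A B, measurable A -> measurable B ->
  P (X @^-1` A `&` Y @^-1` B) = (P (X @^-1` A) * P (Y @^-1` B))%E.
Proof.
move=> H; apply: independent_of_rays => a b.
have mX : measurable (X @^-1` `]a, +oo[).
  by rewrite -[Z in measurable Z]setTI; exact: measurable_funPT.
have mY : measurable (Y @^-1` `]b, +oo[).
  by rewrite -[Z in measurable Z]setTI; exact: measurable_funPT.
rewrite -[LHS]fineK ?fin_num_measure//; last exact: measurableI.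
rewrite -[X in (X * _)%E]fineK ?fin_num_measure// -[X in (_ * X)%E]fineK ?fin_num_measure//.
rewrite -EFinM; congr (_%:E).
have mXY := measurableI _ _ mX mY.
have h1 : mean P (fun w => clip a j (X w) * clip b j (Y w)) @[j --> \oo] -->
    fine (P (X @^-1` `]a, +oo[ `&` Y @^-1` `]b, +oo[)).
  rewrite -mean_indic//; apply: (@mean_dominated _ _ _ _ _ _ (fun=> 1)).
  - by move=> j; apply: measurable_funM; apply: (measurableT_comp (measurable_clip _ j)).
  - exact: integr_cst.
  - by move=> j w; rewrite normrM mulr_ile1 ?norm_clip.
  - move=> w; rewrite [Z in _ --> Z](_ : _ = \1_`]a, +oo[ (X w) * \1_`]b, +oo[ (Y w)).
      by apply: cvgM; exact: cvg_clip.
    by rewrite indicI /= !indicE.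
have h2 : mean P (fun w => clip a j (X w) * clip b j (Y w)) @[j --> \oo] -->
    fine (P (X @^-1` `]a, +oo[)) * fine (P (Y @^-1` `]b, +oo[)).
  rewrite (_ : (fun j => _) = fun j =>
    mean P (fun w => clip a j (X w)) * mean P (fun w => clip b j (Y w))); last first.
    by apply/funext => j; exact: H.
  by apply: cvgM; exact: mean_ray.
exact: (cvg_unique _ h1 h2).
Qed.

Hypothesis XY : forall A B, measurable A -> measurable B ->
  P (X @^-1` A `&` Y @^-1` B) = (P (X @^-1` A) * P (Y @^-1` B))%E.

Lemma pair_mutually_independent :
  mutually_independent P [set: bool]%SET (fun i : bool => if i then X : Om -> R else Y).
Proof.
move=> J B _ mB.
(* Indices outside [J] get the whole line, so every [J] reduces to the formula for both
   variables. *)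
pose B' i := if i \in J then B i else setT.
have mB' i : measurable (B' i) by rewrite /B'; case: ifP => // iJ; exact: mB.
have -> : \bigcap_(i in [set` J]) (if i then X : Om -> R else Y) @^-1` B i =
    X @^-1` B' true `&` Y @^-1` B' false.
  apply/seteqP; split => w /=.
    move=> h; rewrite /B'; split; case: ifP => // iJ.
      exact: (h true iJ).
    exact: (h false iJ).
  by move=> [h1 h2] [] /= iJ; [move: h1|move: h2]; rewrite /B' iJ.
rewrite XY// (_ : \prod_(i in J) _ = \prod_(i : bool)
   fine (P ((if i then X : Om -> R else Y) @^-1` B' i))); last first.
  rewrite big_mkcond; apply: eq_bigr => i _; rewrite /B'; case: ifP => // _.
  by rewrite preimage_setT probability_setT.
rewrite big_bool /= EFinM !fineK ?fin_num_measure//.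
- by rewrite -[Z in measurable Z]setTI; exact: measurable_funPT.
- by rewrite -[Z in measurable Z]setTI; exact: measurable_funPT.
Qed.

Lemma independent_meanM (F G : R -> R) : measurable_fun setT F -> measurable_fun setT G ->
  integr P (fun w => F (X w)) -> integr P (fun w => G (Y w)) ->
  integr P (fun w => F (X w) * G (Y w)) /\
  mean P (fun w => F (X w) * G (Y w)) =
  mean P (fun w => F (X w)) * mean P (fun w => G (Y w)).
Proof.
move=> mF mG iF iG.
pose Z (i : bool) : {RV P >-> R} := if i then X else Y.
have indZ : mutually_independent P [set: bool]%SET (fun i => Z i : Om -> R).
  rewrite (_ : (fun i => Z i : Om -> R) = fun i : bool => if i then X : Om -> R else Y).
    exact: pair_mutually_independent.
  by apply/funext; case.
pose h (i : bool) := if i then F else G.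
have mh i : measurable_fun setT (h i) by case: i.
have ih i : integr P (fun w => h i (Z i w)) by case: i.
have := independent_mean_prod indZ mh ih.
rewrite (_ : (fun w => _) = fun w => F (X w) * G (Y w)); last first.
  apply/funext => w; rewrite (eq_bigl xpredT); last by move=> i; rewrite inE.
  by rewrite big_bool.
rewrite (eq_bigl xpredT); last by move=> i; rewrite inE.
by rewrite big_bool.
Qed.

End PairMean.

Section LawTransfer.
Context d (Om : measurableType d) d' (Om' : measurableType d') (R : realType).
Variables (P : probability Om R) (Q : probability Om' R).
Variables (X : {RV P >-> R}) (Y : {RV Q >-> R}).
Hypothesis XY : forall B, measurable B -> distribution P X B = distribution Q Y B.

Let ge0_transfer (h : R -> R) : measurable_fun setT h -> (forall x, 0 <= h x) ->
  (\int[P]_w (h (X w))%:E = \int[Q]_w (h (Y w))%:E)%E.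
Proof.
move=> mh h0.
have mE : measurable_fun setT (EFin \o h) by exact/measurable_EFinP.
have h0' y : (0 <= (EFin \o h) y)%E by rewrite lee_fin.
have EX := ge0_integral_distribution X mE h0'.
have EY := ge0_integral_distribution Y mE h0'.
rewrite -[LHS]EX -[RHS]EY; apply: eq_measure_integral => A mA _; exact: XY.
Qed.

Lemma law_integr (h : R -> R) : measurable_fun setT h ->
  integr Q (fun w => h (Y w)) -> integr P (fun w => h (X w)).
Proof.
move=> mh /integrableP[_ ih]; apply/integrableP; split.
  by apply/measurable_EFinP; exact: (measurableT_comp mh).
rewrite /= (ge0_transfer (h := fun x => `|h x|))//; exact: measurableT_comp.
Qed.

Lemma law_mean (h : R -> R) : measurable_fun setT h ->
  mean P (fun w => h (X w)) = mean Q (fun w => h (Y w)).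
Proof.
move=> mh; rewrite /mean; congr fine; rewrite integralE [RHS]integralE; congr (_ - _)%E.
  rewrite (_ : (_ ^\+)%E = (fun w => (Num.max (h (X w)) 0)%:E)); last first.
    by apply/funext => x; rewrite funeposE -EFin_max.
  rewrite (ge0_transfer (h := fun x => Num.max (h x) 0)); last 2 first.
  - exact: measurable_maxr.
  - by move=> x; rewrite le_max lexx orbT.
  by congr (integral _ _ _); apply/funext => x; rewrite funeposE -EFin_max.
rewrite (_ : (_ ^\-)%E = (fun w => (Num.max (- h (X w)) 0)%:E)); last first.
  by apply/funext => x; rewrite funenegE -EFinN -EFin_max.
rewrite (ge0_transfer (h := fun x => Num.max (- h x) 0)); last 2 first.
- by apply: measurable_maxr => //; exact: measurableT_comp.
- by move=> x; rewrite le_max lexx orbT.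
by congr (integral _ _ _); apply/funext => x; rewrite funenegE -EFinN -EFin_max.
Qed.

End LawTransfer.

Lemma measurable_fun_rays d (T : measurableType d) (R : realType) (f : T -> R) :
  (forall x, measurable (f @^-1` `]x, +oo[%classic)) -> measurable_fun setT f.
Proof.
move=> h; apply: (measurability _ (RGenOInfty.measurableE R)) => //.
by move=> _ [_ [x ->] <-]; rewrite setTI.
Qed.

(** * Realisation of a law by its quantile function *)

Section Quantile.
Context d (Om : measurableType d) (R : realType) (P : probability Om R).
Variable X : {RV P >-> R}.
Notation V := (measurableTypeR R).

Let Phi (x : R) : R := fine (cdf X x).

(** Generalised inverse of the distribution function. Off ]0, 1[ the infimum may be taken over an
    empty or unbounded set; the value there concerns a null set for the uniform law. *)
Definition quantile (u : R) : R := if 0 < u < 1 then inf [set x | u <= Phi x] else 0.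

Let Phi_nd x y : x <= y -> Phi x <= Phi y.
Proof. by move=> xy; rewrite fine_le ?fin_num_measure//; exact: cdf_nondecreasing. Qed.

(** The infimum is attained because the distribution function is right-continuous; hence, within ]0,
    1[, preimages of rays are intervals. *)
Let quantile_gt u x : 0 < u < 1 -> (x < quantile u) = (Phi x < u).
Proof.
move=> u01; have /andP[u0 u1] := u01; rewrite /quantile u01 ltNge [RHS]ltNge; congr (~~ _).
have ne : [set x | u <= Phi x] !=set0.
  have : Phi y @[y --> +oo%R] --> (1 : R) by apply/fine_cvg/cvg_cdfy1.
  move=> /cvgr_gt /(_ _ u1) [M [_ h]]; exists (M + 1) => /=; apply/ltW/h.
  by rewrite ltrDl.
have lb : has_lbound [set x | u <= Phi x].
  have : Phi y @[y --> -oo%R] --> (0 : R) by apply/fine_cvg/cvg_cdfNy0.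
  move=> /cvgr_lt /(_ _ u0) [M [_ h]]; exists (M - 1) => y /= uy.
  rewrite leNgt; apply/negP => yM.
  have := h (M - 1); rewrite gtrBl ltr01 => /(_ isT); rewrite ltNge => /negP; apply.
  by rewrite (le_trans uy)// Phi_nd// ltW.
apply/idP/idP => [qx|]; last by move=> ux; apply: ge_inf.
have : Phi y @[y --> x^'+] --> Phi x.
  by apply: fine_cvg; rewrite fineK ?fin_num_measure//; exact: cdf_right_continuous.
move=> h; rewrite -(cvg_lim _ h)//; apply: limr_ge; first by apply/cvg_ex; exists (Phi x).
near=> y; have xy : x < y by near: y; exact: nbhs_right_gt.
have [s us sy] := inf_lt ne (le_lt_trans qx xy).
by rewrite (le_trans us)// Phi_nd// ltW.
Unshelve. all: by end_near. Qed.

Let quantile_rayI x : quantile @^-1` `]x, +oo[%classic `&` `]0, 1[%classic = `]Phi x, 1[%classic.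
Proof.
apply/seteqP; split => u /=; rewrite !in_itv/= ?andbT.
  by move=> [h u01]; rewrite -quantile_gt// h/=; case/andP: u01.
move=> /andP[xu u1]; have u01 : 0 < u < 1.
  by rewrite u1 andbT (le_lt_trans _ xu)// fine_ge0.
by rewrite quantile_gt.
Qed.

Lemma measurable_quantile : measurable_fun setT (quantile : V -> R).
Proof.
have mI : measurable (`]0, 1[%classic : set V) by exact: measurable_itv.
apply: measurable_fun_rays => x.
rewrite -[Z in measurable Z](setUIDK _ (`]0, 1[%classic : set V)) quantile_rayI.
apply: measurableU; first exact: measurable_itv.
rewrite (_ : _ `\` _ = if 0 \in `]x, +oo[ then ~` `]0, 1[%classic else set0).
  by case: ifP => _ //; exact: measurableC.
apply/seteqP; split => u /=.
  move=> [+ u01]; rewrite /quantile; case: ifP => [h|_ h]; first by case: u01; rewrite in_itv.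
  by rewrite h.
case: ifP => // x0 u01; split => //; rewrite /quantile.
by case: ifP => // h; case: u01; rewrite /= in_itv.
Qed.

Lemma law_quantile B : measurable B ->
  distribution (uniform01 R) (random_var (uniform01 R) measurable_quantile) B = distribution P X B.
Proof.
have D0 (B' : set R) : distribution (uniform01 R) (random_var (uniform01 R) measurable_quantile) B' =
  uniform01 R (quantile @^-1` B') by [].
have T1 : (distribution (uniform01 R) (random_var (uniform01 R) measurable_quantile) setT < +oo)%E.
  by rewrite D0 preimage_setT probability_setT ltry.
have T2 : distribution (uniform01 R) (random_var (uniform01 R) measurable_quantile) setT =
    distribution P X setT.
  by rewrite D0 preimage_setT probability_setT; have := probability_setT (distribution P X).
suff T3 x : distribution (uniform01 R) (random_var (uniform01 R) measurable_quantile) `]x, +oo[%classic =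
    distribution P X `]x, +oo[%classic by exact: (measure_rays_unique T1 T2 T3).
rewrite D0 (uniform01_setI false true); last first.
  by rewrite -[Z in measurable Z]setTI; exact: measurable_quantile.
rewrite quantile_rayI uniform01_itv ?fine_ge0//; last first.
  by rewrite -lee_fin fineK ?fin_num_measure//; exact: cdf_le1.
have mx : measurable (X @^-1` `]-oo, x]%classic).
  by rewrite -[Z in measurable Z]setTI; exact: measurable_funPT.
rewrite EFinB fineK ?fin_num_measure// -probability_setC//.
by rewrite setCitvl.
Qed.

End Quantile.

Lemma gaussian_momentZ (R : realType) (a v : R) m :
  gaussian_moment (a ^+ 2 * v) m = a ^+ m * gaussian_moment v m.
Proof.
suff [] : gaussian_moment (a ^+ 2 * v) m = a ^+ m * gaussian_moment v m /\
  gaussian_moment (a ^+ 2 * v) m.+1 = a ^+ m.+1 * gaussian_moment v m.+1 by [].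
elim: m => [|m [IH0 IH1]]; first by rewrite /gaussian_moment expr0 mulr1 mulr0.
by split => //; rewrite !gaussian_momentSS IH0 (exprD a 2 m); ring.
Qed.

(** The cosine mean is read off from the moments: [cvg_mean_cos] is applied to a constant
    sequence. *)
Lemma mean_normal_cos (R : realType) (s t b : R) : s != 0 ->
  mean (normal_prob 0 s : probability (measurableTypeR R) R) (fun x => cos (t * x + b)) =
  cos b * expR (- (t * s) ^+ 2 / 2).
Proof.
move=> s0; pose nu : probability (measurableTypeR R) R := normal_prob 0 s.
have iX m : integr nu (fun x : measurableTypeR R => (t * x) ^+ m).
  under eq_fun do rewrite exprMn.
  by apply: integrZ; exact: integr_normal_expr.
have mX m : mean nu (fun x : measurableTypeR R => (t * x) ^+ m) @[_ --> \oo] -->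
    gaussian_moment (t ^+ 2 * s ^+ 2) m.
  rewrite gaussian_momentZ -mean_normal_expr// -meanZ; last exact: integr_normal_expr.
  rewrite [X in _ --> X](_ : _ = mean nu (fun x : measurableTypeR R => (t * x) ^+ m)).
    exact: cvg_cst.
  by congr mean; apply/funext => x; rewrite exprMn.
have := @cvg_mean_cos R _ (fun=> _) (fun=> measurableTypeR R) (fun=> nu) (fun _ x => t * x)
  (fun _ => iX) mX b.
by rewrite exprMn; apply: cvg_unique => //; exact: cvg_cst.
Qed.

(** * Independent normal variables from one uniform number *)

Section GaussianSequence.
Variable R : realType.
Notation V := (measurableTypeR R).
Notation P := (uniform01 R).

Lemma split_independent (A B : set R) : measurable A -> measurable B ->
  P ((even_part (R := R)) @^-1` A `&` (odd_part (R := R)) @^-1` B) =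
  (P ((even_part (R := R)) @^-1` A) * P ((odd_part (R := R)) @^-1` B))%E.
Proof.
pose X := random_var P (@measurable_even_part R).
pose Y := random_var P (@measurable_odd_part R).
(* Testing one part against the constant 1 yields the marginal law of the other. *)
pose k : R -> R := cst 1.
have ck : continuous k by move=> x; exact: cvg_cst.
have k1 x : `|k x| <= 1 by rewrite normr1.
apply: (@independent_of_clip _ _ _ _ X Y) => a j b l.
have -> : mean P (fun w => clip a j (X w)) = mean P (clip a j \o frac01 (R := R)).
  have := mean_split (@continuous_clip R a j) ck (norm_clip a j) k1.
  rewrite (_ : k \o _ = cst 1)// mean_cst mulr1 => <-.
  by congr mean; apply/funext => w; rewrite mulr1.
have -> : mean P (fun w => clip b l (Y w)) = mean P (clip b l \o frac01 (R := R)).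
  have := mean_split ck (@continuous_clip R b l) k1 (norm_clip b l).
  rewrite (_ : k \o _ = cst 1)// mean_cst mul1r => <-.
  by congr mean; apply/funext => w; rewrite mul1r.
exact: (mean_split (@continuous_clip R a j) (@continuous_clip R b l)
  (norm_clip a j) (norm_clip b l)).
Qed.

Lemma law_even_part B : measurable B ->
  distribution P (random_var P (@measurable_even_part R)) B =
  distribution P (random_var P (@measurable_id _ V setT)) B.
Proof.
pose k : R -> R := cst 1.
have ck : continuous k by move=> x; exact: cvg_cst.
have k1 x : `|k x| <= 1 by rewrite normr1.
apply: law_eq_clip => a j.
rewrite -[RHS](mean_frac01 (@measurable_clip R a j) (norm_clip a j)).
have := mean_split (@continuous_clip R a j) ck (norm_clip a j) k1.
rewrite (_ : k \o _ = cst 1)// mean_cst mulr1 => <-.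
by congr mean; apply/funext => w; rewrite mulr1.
Qed.

Lemma law_odd_part B : measurable B ->
  distribution P (random_var P (@measurable_odd_part R)) B =
  distribution P (random_var P (@measurable_id _ V setT)) B.
Proof.
pose k : R -> R := cst 1.
have ck : continuous k by move=> x; exact: cvg_cst.
have k1 x : `|k x| <= 1 by rewrite normr1.
apply: law_eq_clip => a j.
rewrite -[RHS](mean_frac01 (@measurable_clip R a j) (norm_clip a j)).
have := mean_split ck (@continuous_clip R a j) k1 (norm_clip a j).
rewrite (_ : k \o _ = cst 1)// mean_cst mul1r => <-.
by congr mean; apply/funext => w; rewrite mul1r.
Qed.

Section SplitMean.
Variables F G : R -> R.
Hypotheses (mF : measurable_fun setT F) (mG : measurable_fun setT G).
Hypotheses (iF : integr P (F : V -> R)) (iG : integr P (G : V -> R)).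

Lemma integr_even_part : integr P (fun x : V => F (even_part x)).
Proof. exact: (law_integr law_even_part mF iF). Qed.

Lemma integr_odd_part : integr P (fun x : V => G (odd_part x)).
Proof. exact: (law_integr law_odd_part mG iG). Qed.

Lemma mean_even_part : mean P (fun x : V => F (even_part x)) = mean P (F : V -> R).
Proof. exact: (law_mean law_even_part mF). Qed.

Lemma mean_odd_part : mean P (fun x : V => G (odd_part x)) = mean P (G : V -> R).
Proof. exact: (law_mean law_odd_part mG). Qed.

Lemma mean_even_odd : integr P (fun x : V => F (even_part x) * G (odd_part x)) /\
  mean P (fun x : V => F (even_part x) * G (odd_part x)) =
  mean P (F : V -> R) * mean P (G : V -> R).
Proof.
rewrite -mean_even_part -mean_odd_part.
exact: (@independent_meanM _ _ _ _ (random_var P (@measurable_even_part R))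
  (random_var P (@measurable_odd_part R)) split_independent _ _ mF mG
  integr_even_part integr_odd_part).
Qed.

End SplitMean.

End GaussianSequence.

Section GaussianSequence.
Variable R : realType.
Notation V := (measurableTypeR R).
Notation P := (uniform01 R).

Let nu : probability V R := normal_prob 0 1.
Let id_nu : {RV nu >-> R} := random_var nu (@measurable_id _ V setT).

Definition gauss0 : R -> R := quantile id_nu.

Lemma measurable_gauss0 : measurable_fun setT (gauss0 : V -> R).
Proof. exact: measurable_quantile. Qed.

Lemma law_gauss0 B : measurable B ->
  distribution P (random_var P measurable_gauss0) B = distribution nu id_nu B.
Proof. exact: law_quantile. Qed.

Lemma integr_gauss0 m : integr P (fun x : V => gauss0 x ^+ m).
Proof.
apply: (law_integr law_gauss0 (h := fun y => y ^+ m)); first exact: measurable_funX.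
by apply: integr_normal_expr; rewrite oner_neq0.
Qed.

Lemma mean_gauss0 m : mean P (fun x : V => gauss0 x ^+ m) = gaussian_moment 1 m.
Proof.
rewrite (law_mean law_gauss0 (h := fun y => y ^+ m)); last exact: measurable_funX.
by rewrite mean_normal_expr ?oner_neq0// expr1n.
Qed.

Lemma mean_cos_gauss0 t b :
  mean P (fun x : V => cos (t * gauss0 x + b)) = cos b * expR (- t ^+ 2 / 2).
Proof.
rewrite (law_mean law_gauss0 (h := fun y => cos (t * y + b))).
  by rewrite mean_normal_cos ?oner_neq0// mulr1.
by apply: measurable_cos_comp; apply: measurable_funD => //; exact: measurable_funM.
Qed.

(* [even_part] and [odd_part] turn one uniform number into two independent ones;
   iterating on the second yields a sequence. *)
Definition gauss (j : nat) (x : R) : R := gauss0 (even_part (iter j (odd_part (R := R)) x)).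

Definition gauss_sum (n : nat) (c : nat -> R) (x : R) : R := \sum_(j < n) c j * gauss j x.

Lemma gauss_sumS n c x :
  gauss_sum n.+1 c x = c 0%N * gauss0 (even_part x) + gauss_sum n (c \o S) (odd_part x).
Proof.
rewrite /gauss_sum big_ord_recl; congr (_ + _); apply: eq_bigr => j _.
by rewrite /= /gauss iterSr.
Qed.

Lemma measurable_gauss_sum n c : measurable_fun setT (gauss_sum n c : V -> R).
Proof.
elim: n c => [|n IHn] c.
  rewrite (_ : gauss_sum 0 c = cst 0); first exact: measurable_cst.
  by apply/funext => x; rewrite /gauss_sum big_ord0.
rewrite (_ : gauss_sum n.+1 c = fun x => c 0%N * gauss0 (even_part x) +
   gauss_sum n (c \o S) (odd_part x)); last by apply/funext => x; exact: gauss_sumS.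
apply: measurable_funD.
  apply: measurable_funM => //.
  exact: (measurableT_comp measurable_gauss0 (@measurable_even_part R)).
exact: (measurableT_comp (IHn (c \o S)) (@measurable_odd_part R)).
Qed.

(** The induction treats all phases at once: the addition formula splits off the first variable, its
    sines being cosines of shifted phase, and the term with the sine of that variable vanishes
    because [cos (pi / 2) = 0]. *)
Lemma mean_cos_gauss_sum n c b :
  mean P (fun x : V => cos (gauss_sum n c x + b)) =
  cos b * expR (- (\sum_(j < n) c j ^+ 2) / 2).
Proof.
elim: n c b => [|n IHn] c b.
  under eq_fun do rewrite /gauss_sum big_ord0 add0r.
  by rewrite mean_cst big_ord0 oppr0 mul0r expR0 mulr1.
pose F s x : R := cos (c 0%N * gauss0 x + s).
pose G s x : R := cos (gauss_sum n (c \o S) x + s).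
have mF s : measurable_fun setT (F s : V -> R).
  apply: measurable_cos_comp; apply: measurable_funD => //; apply: measurable_funM => //.
  exact: measurable_gauss0.
have mG s : measurable_fun setT (G s : V -> R).
  by apply: measurable_cos_comp; apply: measurable_funD => //; exact: measurable_gauss_sum.
have iF s : integr P (F s : V -> R).
  by apply: (@integr_bounded _ _ _ _ _ 1) => // x; exact: cos_max.
have iG s : integr P (G s : V -> R).
  by apply: (@integr_bounded _ _ _ _ _ 1) => // x; exact: cos_max.
have [i1 e1] := mean_even_odd (mF 0) (mG b) (iF 0) (iG b).
have [i2 e2] := mean_even_odd (mF (- (pi / 2))) (mG (b - pi / 2)) (iF _) (iG _).
rewrite (_ : (fun x => _) = fun x : V => F 0 (even_part x) * G b (odd_part x) -
   F (- (pi / 2)) (even_part x) * G (b - pi / 2) (odd_part x)); last first.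
  apply/funext => x; rewrite gauss_sumS /F /G.
  move: (c 0%N * _) (gauss_sum _ _ _) => A S.
  by rewrite -addrA (cosD A) addr0 cosBpihalf (addrA S b) cosBpihalf.
rewrite meanB// e1 e2 /F /G !IHn !mean_cos_gauss0 cosN cos_pihalf cos0 !mul0r subr0 mul1r.
rewrite mulrCA -expRD big_ord_recl /=; congr (_ * expR _).
by rewrite -mulrDl -opprD.
Qed.

(** The claims are proved together: separating the cross terms requires integrability of the shorter
    sums, and they vanish because [gauss0] is centred. *)
Lemma integr_gauss_sum n c c' : integr P (fun x : V => gauss_sum n c x * gauss_sum n c' x) /\
  (integr P (gauss_sum n c : V -> R) /\ mean P (gauss_sum n c : V -> R) = 0) /\
  mean P (fun x : V => gauss_sum n c x * gauss_sum n c' x) = \sum_(j < n) c j * c' j.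
Proof.
elim: n c c' => [|n IHn] c c'.
  rewrite (_ : gauss_sum 0 c = fun=> 0); last by apply/funext => x; rewrite /gauss_sum big_ord0.
  rewrite (_ : (fun x => _) = fun=> 0); last by apply/funext => x; rewrite mul0r.
  by rewrite mean_cst big_ord0; split; [exact: integr_cst|split => //; split => //; exact: integr_cst].
have [iSS [[iS mS] mSS]] := IHn (c \o S) (c' \o S).
have [_ [[iS' mS'] _]] := IHn (c' \o S) (c \o S).
have i1 : integr P (gauss0 : V -> R) by have := integr_gauss0 1; under eq_fun do rewrite expr1.
have m1 : mean P (gauss0 : V -> R) = 0 by have := mean_gauss0 1; under eq_fun do rewrite expr1.
have i2 : integr P (fun x : V => gauss0 x ^+ 2) by exact: integr_gauss0.
have m2 : mean P (fun x : V => gauss0 x ^+ 2) = 1 by rewrite mean_gauss0 /gaussian_moment !mul1r.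
have mg := measurable_gauss0.
have mg2 : measurable_fun setT (fun x : V => gauss0 x ^+ 2) by exact: measurable_funX.
have mT e := measurable_gauss_sum n e.
have mSS' : measurable_fun setT (fun x : V => gauss_sum n (c \o S) x * gauss_sum n (c' \o S) x).
  exact: measurable_funM.
have [iA eA] := mean_even_odd mg (mT (c \o S)) i1 iS.
have [iB eB] := mean_even_odd mg (mT (c' \o S)) i1 iS'.
have ie := integr_even_part mg i1; have ie2 := integr_even_part mg2 i2.
have io := integr_odd_part (mT (c \o S)) iS; have ioo := integr_odd_part mSS' iSS.
have eqS : gauss_sum n.+1 c = fun x => c 0%N * gauss0 (even_part x) +
   gauss_sum n (c \o S) (odd_part x) by apply/funext => x; exact: gauss_sumS.
pose H x := c 0%N * c' 0%N * gauss0 (even_part x) ^+ 2 +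
  (c 0%N * (gauss0 (even_part x) * gauss_sum n (c' \o S) (odd_part x)) +
   (c' 0%N * (gauss0 (even_part x) * gauss_sum n (c \o S) (odd_part x)) +
    gauss_sum n (c \o S) (odd_part x) * gauss_sum n (c' \o S) (odd_part x))).
rewrite (_ : (fun x : V => gauss_sum n.+1 c x * gauss_sum n.+1 c' x) = H); last first.
  by apply/funext => x; rewrite !gauss_sumS /H; ring.
have j1 : integr P (fun x : V => c 0%N * c' 0%N * gauss0 (even_part x) ^+ 2) by exact: integrZ.
have j2 : integr P (fun x : V => c 0%N * (gauss0 (even_part x) * gauss_sum n (c' \o S) (odd_part x))).
  exact: integrZ.
have j3 : integr P (fun x : V => c' 0%N * (gauss0 (even_part x) * gauss_sum n (c \o S) (odd_part x))).
  exact: integrZ.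
have j4 := integrD j3 ioo; have j5 := integrD j2 j4.
split; [exact: integrD|split; [split|]].
- by rewrite eqS; apply: integrD => //; exact: integrZ.
- rewrite eqS (meanD (integrZ _ ie) io) (meanZ _ ie) (mean_even_part mg).
  by rewrite (mean_odd_part (mT (c \o S))) m1 mS mulr0 addr0.
- rewrite /H (meanD j1 j5) (meanD j2 j4) (meanD j3 ioo).
  rewrite (meanZ _ ie2) (meanZ _ iB) (meanZ _ iA) eA eB m1 (mean_odd_part mSS') mSS.
  by rewrite (mean_even_part mg2) m2 big_ord_recl !mul0r !mulr0 !add0r mulr1.
Qed.

End GaussianSequence.

(** * Cholesky factorisation *)

Section Cholesky.
Variable R : realType.
Implicit Types (K : nat -> nat -> R) (s : seq (R * nat)).

(* Vectors are lists of (coefficient, index) pairs, repetitions allowed, so that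
   adding a multiple of a basis vector is a [cons]. *)
Definition quadratic_form K s := \sum_(x <- s) \sum_(y <- s) x.1 * y.1 * K x.2 y.2.

Definition positive_kernel K :=
  (forall k l, K k l = K l k) /\ forall s, 0 <= quadratic_form K s.

Definition linear_form K s j := \sum_(x <- s) x.1 * K j x.2.

Lemma quadratic_form_cons K s a j : (forall k l, K k l = K l k) ->
  quadratic_form K ((a, j) :: s) =
  a ^+ 2 * K j j + 2 * a * linear_form K s j + quadratic_form K s.
Proof.
move=> sK; rewrite /quadratic_form big_cons big_cons /=.
under [X in _ + X = _]eq_bigr do rewrite big_cons /=.
rewrite big_split /= -/(quadratic_form K s).
have -> : \sum_(y <- s) a * y.1 * K j y.2 = a * linear_form K s j.
  by rewrite mulr_sumr; apply: eq_bigr => y _; rewrite mulrA.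
have -> : \sum_(x <- s) x.1 * a * K x.2 j = a * linear_form K s j.
  by rewrite mulr_sumr; apply: eq_bigr => y _; rewrite mulrA sK [_ * a]mulrC.
by ring.
Qed.

Lemma positive_kernel_diag K j : positive_kernel K -> 0 <= K j j.
Proof.
move=> [sK pK]; have := pK [:: (1, j)]; rewrite quadratic_form_cons//.
by rewrite /linear_form /quadratic_form !big_nil expr1n mul1r mulr0 !addr0.
Qed.

Lemma positive_kernel_schwarz K s j : positive_kernel K ->
  linear_form K s j ^+ 2 <= quadratic_form K s * K j j.
Proof.
move=> pK; have Kj := positive_kernel_diag j pK; move: pK => [sK pK].
set L := linear_form K s j; set F := quadratic_form K s.
have H a : 0 <= a ^+ 2 * K j j + 2 * a * L + F by rewrite -quadratic_form_cons.
have [K0|K0] := eqVneq (K j j) 0.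
  rewrite K0 mulr0; have [->|L0] := eqVneq L 0; first by rewrite expr0n.
  (* With a zero diagonal entry the bound [H] is affine in [a], and this value of [a] would make it
     -1. *)
  have := H (- (F + 1) / (2 * L)); rewrite K0 mulr0 add0r.
  have -> : 2 * (- (F + 1) / (2 * L)) * L = - (F + 1) by field.
  by move=> ?; exfalso; lra.
have Kp : 0 < K j j by rewrite lt_neqAle eq_sym K0.
(* The minimiser of the quadratic polynomial in [H]. *)
have := H (- L / K j j).
have -> : (- L / K j j) ^+ 2 * K j j + 2 * (- L / K j j) * L + F = F - L ^+ 2 / K j j by field.
by rewrite subr_ge0 ler_pdivrMr.
Qed.

(* A zero pivot forces a zero column by the Cauchy-Schwarz inequality, so the
   convention [x / 0 = 0] gives the right entries here and in [cholesky]. *)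
Fixpoint schur K (j : nat) : nat -> nat -> R :=
  if j is j'.+1 then
    fun k l => schur K j' k l - schur K j' k j' * schur K j' l j' / schur K j' j' j'
  else K.

(** The form of the complement is the old one minus the squared [linear_form] over the pivot,
    non-negative by the Cauchy-Schwarz inequality. Each elimination clears row [j] and keeps the
    rows cleared before. *)
Lemma schurP K j : positive_kernel K ->
  positive_kernel (schur K j) /\ forall i l, (i < j)%N -> schur K j i l = 0.
Proof.
move=> pK; elim: j => [|j [pS S0]]; first by split.
have Sj := positive_kernel_diag j pS.
have sz k : schur K j j j = 0 -> schur K j j k = 0.
  move=> Sj0; have := positive_kernel_schwarz [:: (1, k)] j pS.
  rewrite Sj0 mulr0 /linear_form big_seq1 mul1r => h.
  by apply/eqP; rewrite -sqrf_eq0 eq_le h sqr_ge0.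
have sS := pS.1; split; last first.
  move=> i l; rewrite ltnS leq_eqVlt => /orP[/eqP ->|ij] /=; last first.
    by rewrite (S0 i l ij) (S0 i j ij) !mul0r subrr.
  have [h|h] := eqVneq (schur K j j j) 0; first by rewrite (sz l h) h !mul0r subr0.
  by rewrite (sS l j) mulrAC divff// mul1r subrr.
split=> [k l|s] /=.
  by rewrite (sS k l) [X in _ - X / _]mulrC.
have -> : quadratic_form (schur K j.+1) s =
   quadratic_form (schur K j) s - linear_form (schur K j) s j ^+ 2 / schur K j j j.
  rewrite /quadratic_form /linear_form expr2 !mulr_suml -sumrB; apply: eq_bigr => x _.
  rewrite mulr_sumr mulr_suml -sumrB; apply: eq_bigr => y _ /=.
  by rewrite (sS j x.2) (sS j y.2); ring.
have [h|h] := eqVneq (schur K j j j) 0.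
  by rewrite h invr0 mulr0 subr0; exact: pS.2.
rewrite subr_ge0 ler_pdivrMr ?lt_neqAle 1?eq_sym ?h//.
exact: positive_kernel_schwarz.
Qed.

Definition cholesky K k j := schur K j k j / Num.sqrt (schur K j j j).

Lemma cholesky0 K k j : positive_kernel K -> (k < j)%N -> cholesky K k j = 0.
Proof. by move=> pK kj; rewrite /cholesky (schurP j pK).2// mul0r. Qed.

(** The sum telescopes: each rank-one term is what one elimination step subtracts, and row [k] is
    cleared after [n > k] steps. *)
Lemma choleskyP K k l n : positive_kernel K -> (k < n)%N ->
  \sum_(j < n) cholesky K k j * cholesky K l j = K k l.
Proof.
move=> pK kn.
suff -> : \sum_(j < n) cholesky K k j * cholesky K l j = K k l - schur K n k l.
  by rewrite (schurP n pK).2// subr0.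
elim: n {kn} => [|n IHn]; first by rewrite big_ord0 subrr.
rewrite big_ord_recr /= IHn /cholesky mulrACA -invfM -expr2 sqr_sqrtr.
  by ring.
exact: positive_kernel_diag (schurP n pK).1.
Qed.

End Cholesky.

(** * Convergence of the fluctuations *)

Lemma gauss_sum_widen (R : realType) m n (c : nat -> R) x : (m <= n)%N ->
  (forall j, (m <= j)%N -> c j = 0) -> gauss_sum m c x = gauss_sum n c x.
Proof.
move=> mn c0; rewrite /gauss_sum -!(big_mkord xpredT (fun j => c j * gauss j x)).
rewrite [RHS](@big_cat_nat _ _ _ m)//= [X in _ = _ + X]big_nat_cond.
rewrite [X in _ = _ + X]big1 ?addr0// => j /andP[/andP[mj _] _].
by rewrite c0// mul0r.
Qed.

(** Cosine means identify the law when the variance is positive; otherwise all coefficients vanish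
    and the law is Dirac. *)
Lemma gaussian_gauss_sum (R : realType) n (c : nat -> R) :
  gaussian (uniform01 R) (gauss_sum n c : measurableTypeR R -> R).
Proof.
split; first exact: measurable_gauss_sum.
pose v := \sum_(j < n) c j ^+ 2.
have v0 : 0 <= v by apply: sumr_ge0 => j _; exact: sqr_ge0.
exists 0, (Num.sqrt v) => B mB; rewrite /gaussian_law sqrtr_eq0.
have [vle|vgt] := leP v 0.
  have cz (j : 'I_n) : c j = 0.
    have /eqP := le_anti (introT andP (conj vle v0)).
    by rewrite psumr_eq0 => [/allP/(_ j (mem_index_enum _))/=|i _]; rewrite ?sqrf_eq0 ?sqr_ge0// => /eqP.
  rewrite (_ : gauss_sum n c = cst 0); last first.
    by apply/funext => x; rewrite /gauss_sum big1// => j _; rewrite cz mul0r.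
  rewrite preimage_cst diracE; case: ifP => _ /=.
    exact: probability_setT.
  exact: measure0.
have s0 : Num.sqrt v != 0 by rewrite sqrtr_eq0 -ltNge.
pose nu : probability (measurableTypeR R) R := normal_prob 0 (Num.sqrt v).
pose X := random_var (uniform01 R) (measurable_gauss_sum n c).
pose Y := random_var nu (@measurable_id _ (measurableTypeR R) setT).
apply: (@cos_law_unique _ _ _ _ _ _ _ X Y) => //.
- have := (integr_gauss_sum n c c).1.
  by rewrite (_ : (fun x => _) = fun x : measurableTypeR R => gauss_sum n c x ^+ 2).
- exact: integr_normal_expr.
move=> t b; rewrite (mean_normal_cos _ _ s0) exprMn sqr_sqrtr//.
have -> : t ^+ 2 * v = \sum_(j < n) (t * c j) ^+ 2.
  by rewrite mulr_sumr; apply: eq_bigr => j _; rewrite exprMn.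
rewrite -(mean_cos_gauss_sum n (fun j => t * c j)); congr mean; apply/funext => x.
rewrite /= /gauss_sum mulr_sumr; congr (cos (_ + _)).
by apply: eq_bigr => j _; rewrite mulrA.
Qed.

Section Limit.
Variables (R : realType) (p : nat).
Hypothesis hp : (2 <= p)%N.
Variables (d : nat -> measure_display) (Om : forall N, measurableType (d N)).
Variable P : forall N, probability (Om N) R.
Variable T : forall N, p.-tuple 'I_N -> {RV (P N) >-> R}.
Variable M : nat -> R.
Hypothesis hT : heavy_wigner T M.
Variable M2 : R.
Hypothesis M2_gt0 : 0 < M2.

Notation Z k := (trace_fluctuation T M2 k).

Lemma integr_trace_fluctuation N k m : (0 < k)%N ->
  integr (P N.+1) (fun w => Z k w ^+ m).
Proof.
move=> k0; have := integr_fluctuation_comb hT M2 (k := fun _ : 'I_1 => k) (fun=> 1)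
  (fun=> k0) N m.
rewrite (_ : (fun w => _) = fun w => Z k w ^+ m)//.
by apply/funext => w; rewrite /fluctuation_comb big_ord1 mul1r.
Qed.

Lemma measurable_trace_fluctuation N k : (0 < k)%N ->
  measurable_fun setT (@trace_fluctuation R p d Om P T M2 N.+1 k).
Proof.
move=> k0; have := integr_measurable (integr_trace_fluctuation N 1 k0).
by under eq_fun do rewrite expr1.
Qed.

Lemma integr_trace_fluctuationM N k l : (0 < k)%N -> (0 < l)%N ->
  integr (P N.+1) (fun w => Z k w * Z l w).
Proof.
move=> k0 l0.
apply: (le_integr (G := fun w => Z k w ^+ 2 + Z l w ^+ 2)).
- by apply: measurable_funM; exact: measurable_trace_fluctuation.
- by apply: integrD; exact: integr_trace_fluctuation.
move=> w; move: (Z k w) (Z l w) => x y.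
rewrite [leRHS]ger0_norm ?addr_ge0 ?sqr_ge0// ler_norml; nra.
Qed.

Section Comb.
Variables (J : nat) (k : 'I_J -> nat) (tc : 'I_J -> R).
Hypothesis k_gt0 : forall j, (0 < k j)%N.

Definition comb_variance := \sum_i \sum_j tc i * tc j * cycle_covariance T M2 (k i) (k j).

Lemma cvg_mean_comb2 :
  mean (P N.+1) (fun w => fluctuation_comb T M2 k tc w ^+ 2) @[N --> \oo] --> comb_variance.
Proof.
rewrite (_ : (fun N => _) = fun N => \sum_i \sum_j tc i * tc j *
   mean (P N.+1) (fun w => Z (k i) w * Z (k j) w)).
  apply: cvg_sumr => i _; apply: cvg_sumr => j _; apply: cvgM; first exact: cvg_cst.
  exact: (cvg_covariance hp hT).
apply/funext => N.
have iM i j : integr (P N.+1) (fun w => Z (k i) w * Z (k j) w).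
  exact: integr_trace_fluctuationM.
rewrite (_ : (fun w => _) = fun w => \sum_i \sum_j tc i * tc j * (Z (k i) w * Z (k j) w)).
  rewrite mean_sum => [|i _]; last by apply: integr_sum => j _; exact: integrZ.
  apply: eq_bigr => i _; rewrite mean_sum => [|j _]; last exact: integrZ.
  by apply: eq_bigr => j _; rewrite meanZ.
apply/funext => w; rewrite /fluctuation_comb expr2 mulr_suml; apply: eq_bigr => i _.
by rewrite mulr_sumr; apply: eq_bigr => j _; rewrite mulrACA.
Qed.

Lemma cvg_mean_cos_comb b :
  mean (P N.+1) (fun w => cos (fluctuation_comb T M2 k tc w + b)) @[N --> \oo] -->
  cos b * expR (- comb_variance / 2).
Proof.
apply: (@cvg_mean_cos R comb_variance (fun N => d N.+1) (fun N => Om N.+1) (fun N => P N.+1)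
  (fun N w => fluctuation_comb T M2 k tc w)).
  by move=> N m; exact: (integr_fluctuation_comb hT).
apply: (@gaussian_moment_cvg R
  (fun N m => mean (P N.+1) (fun w => fluctuation_comb T M2 k tc w ^+ m))).
- by move=> N; under eq_fun do rewrite expr0; exact: mean_cst.
- by move=> N; under eq_fun do rewrite expr1; exact: (mean_fluctuation_comb hT).
- exact: cvg_mean_comb2.
- by move=> m; exact: (fluctuation_moment_recursion hp hT).
Qed.

End Comb.

(** Shifted by one: rows of the factorisation are numbered from 0, whereas cycle lengths start at
    1. *)
Definition covariance_kernel (k l : nat) : R := cycle_covariance T M2 k.+1 l.+1.

Lemma positive_covariance_kernel : positive_kernel covariance_kernel.
Proof.
split=> [k l|s].
  have h1 := cvg_covariance hp hT (ltn0Sn k) (ltn0Sn l) M2_gt0.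
  have h2 := cvg_covariance hp hT (ltn0Sn l) (ltn0Sn k) M2_gt0.
  apply: (cvg_unique _ h1) => //; rewrite (_ : (fun N => _) = fun N => mean (P N.+1)
    (fun w => Z l.+1 w * Z k.+1 w))//.
  by apply/funext => N; congr mean; apply/funext => w; rewrite mulrC.
pose t (i : 'I_(size s)) := tnth (in_tuple s) i.
have h := @cvg_mean_comb2 _ (fun i => (t i).2.+1) (fun i => (t i).1) (fun=> isT).
move: (h); rewrite /comb_variance.
have <- : quadratic_form covariance_kernel s = \sum_i \sum_j (t i).1 * (t j).1 *
   cycle_covariance T M2 (t i).2.+1 (t j).2.+1.
  rewrite /quadratic_form big_tnth; apply: eq_bigr => i _.
  by rewrite big_tnth; apply: eq_bigr => j _.
move=> /cvg_lim <-//; apply: limr_ge.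
  by apply/cvg_ex; eexists; exact: h.
by near=> N; apply: mean_ge0 => w; exact: sqr_ge0.
Unshelve. all: by end_near. Qed.

Definition limit_coef (k j : nat) : R := cholesky covariance_kernel k.-1 j.

Lemma limit_coef0 k j : (0 < k)%N -> (k <= j)%N -> limit_coef k j = 0.
Proof.
by move=> k0 kj; apply: cholesky0; rewrite ?prednK//; exact: positive_covariance_kernel.
Qed.

Lemma limit_coefP k l n : (0 < k)%N -> (0 < l)%N -> (k <= n)%N ->
  \sum_(j < n) limit_coef k j * limit_coef l j = cycle_covariance T M2 k l.
Proof.
move=> k0 l0 kn; rewrite /limit_coef choleskyP ?prednK//.
  by rewrite /covariance_kernel !prednK.
exact: positive_covariance_kernel.
Qed.

(** The factor is lower triangular, so row [val k] minus one involves only the first [val k] normal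
    variables and a finite sum suffices. *)
Definition limit_process (k : posnat) : {RV (uniform01 R) >-> R} :=
  random_var (uniform01 R) (measurable_gauss_sum (val k) (limit_coef (val k))).

Lemma limit_process_widen (k : posnat) n x : (val k <= n)%N ->
  limit_process k x = gauss_sum n (limit_coef (val k)) x.
Proof.
move=> kn; apply: gauss_sum_widen => // j; apply: limit_coef0; exact: valP k.
Qed.

Lemma mean_limit_processM (k l : posnat) :
  integr (uniform01 R) (fun x => limit_process k x * limit_process l x) /\
  mean (uniform01 R) (fun x => limit_process k x * limit_process l x) =
  cycle_covariance T M2 (val k) (val l).
Proof.
pose n := maxn (val k) (val l).
have [i [_ e]] := integr_gauss_sum n (limit_coef (val k)) (limit_coef (val l)).
rewrite (_ : (fun x => _) = fun x : measurableTypeR R =>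
   gauss_sum n (limit_coef (val k)) x * gauss_sum n (limit_coef (val l)) x).
  split=> //; rewrite e limit_coefP ?(valP k) ?(valP l)//; exact: leq_maxl.
by apply/funext => x; rewrite !(@limit_process_widen _ n) ?leq_maxl ?leq_maxr.
Qed.

(** Widening all the sums to a common length makes the combination a single [gauss_sum], which
    yields both its normality and its cosine means. *)
Lemma limit_process_comb J (i : 'I_J -> posnat) (t : 'I_J -> R) : exists n (c : nat -> R),
  (forall x, \sum_j t j * limit_process (i j) x = gauss_sum n c x) /\
  \sum_(m < n) c m ^+ 2 = comb_variance (fun j => val (i j)) t.
Proof.
pose n := \max_j val (i j).
have le_n j : (val (i j) <= n)%N by exact: (leq_bigmax j).
exists n, (fun m => \sum_j t j * limit_coef (val (i j)) m); split.
  move=> x; under eq_bigr do rewrite (limit_process_widen _ (le_n _)) mulr_sumr.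
  rewrite exchange_big; apply: eq_bigr => m _; rewrite mulr_suml.
  by apply: eq_bigr => j _; rewrite mulrA.
transitivity (\sum_(m < n) \sum_j \sum_l t j * t l *
    (limit_coef (val (i j)) m * limit_coef (val (i l)) m)).
  apply: eq_bigr => m _; rewrite expr2 mulr_suml; apply: eq_bigr => j _.
  by rewrite mulr_sumr; apply: eq_bigr => l _; rewrite mulrACA.
rewrite exchange_big; apply: eq_bigr => j _; rewrite exchange_big; apply: eq_bigr => l _.
by rewrite -mulr_sumr limit_coefP ?(valP (i j)) ?(valP (i l)).
Qed.

Lemma fdd_cvg_limit_process : fdd_cvg P (uniform01 R)
  (fun N (k : posnat) => @trace_fluctuation R p d Om P T M2 N (val k))
  (fun k => limit_process k : measurableTypeR R -> R).
Proof.
move=> n i f cf [C fC].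
pose X N j : Om N.+1 -> R := Z (val (i j)).
pose Y j : measurableTypeR R -> R := limit_process (i j).
have k0 j : (0 < val (i j))%N by exact: valP (i j).
have mX N j : measurable_fun setT (@X N j) by exact: measurable_trace_fluctuation.
have mY j : measurable_fun setT (Y j) by exact: measurable_funPT.
have X2 N j : integr (P N.+1) (fun w => X N j w ^+ 2) by exact: integr_trace_fluctuation.
have Y2 j : integr (uniform01 R) (fun w => Y j w ^+ 2) by exact: (mean_limit_processM _ _).1.
(* The second moments converge, hence are bounded in [N]. *)
have bX j : exists B, forall N, mean (P N.+1) (fun w => X N j w ^+ 2) <= B.
  have h := cvg_covariance hp hT (k0 j) (k0 j) M2_gt0.
  have [B [_ hB]] := cvg_seq_bounded (cvgP _ h).
  exists (B + 1) => N; apply: le_trans (ler_norm _) _.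
  by apply: (hB (B + 1)) => //; rewrite ltrDl.
have {bX}[Bf hBf] := choice bX.
pose B := \sum_j (`|Bf j| + `|mean (uniform01 R) (fun w => Y j w ^+ 2)|).
have hB j : `|Bf j| + `|mean (uniform01 R) (fun w => Y j w ^+ 2)| <= B.
  by rewrite /B (bigD1 j)//= lerDl; apply: sumr_ge0 => l _; rewrite addr_ge0.
(* Dimension 0 is dropped, the estimates being stated in dimension [N.+1]. *)
rewrite -cvg_shiftS.
have iX N : integr (P N.+1) (fun w => f (row_of (@X N) w)).
  apply: (@integr_bounded _ _ _ _ _ C) => [|w]; last exact: fC.
  exact: (measurable_continuous_row (P N.+1) (mX N) cf fC).
have iY : integr (uniform01 R) (fun w => f (row_of Y w)).
  apply: (@integr_bounded _ _ _ _ _ C) => [|w]; last exact: fC.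
  exact: (measurable_continuous_row (uniform01 R) mY cf fC).
rewrite (expectation_mean iY).
rewrite (_ : (fun N => _) = fun N => (mean (P N.+1) (fun w => f (row_of (@X N) w)))%:E); last first.
  by apply/funext => N; rewrite -(expectation_mean (iX N)).
apply: cvg_EFin; first by near=> N.
apply: (@cvg_mean_continuous R n (fun N => d N.+1) (fun N => Om N.+1) (fun N => P N.+1) X
  _ _ (uniform01 R) Y B mX mY X2 Y2 _ _ _ f C cf fC).
- move=> N j; apply: le_trans (hBf j N) (le_trans _ (hB j)).
  by rewrite (le_trans (ler_norm _))// lerDl.
- by move=> j; rewrite (le_trans _ (hB j))// (le_trans (ler_norm _))// lerDr.
move=> t b; have [m [c [cE c2]]] := limit_process_comb i t.
rewrite (_ : mean (uniform01 R) _ = cos b * expR (- comb_variance (fun j => val (i j)) t / 2)).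
  exact: (@cvg_mean_cos_comb _ (fun j => val (i j)) t k0 b).
by rewrite -c2 -mean_cos_gauss_sum; congr mean; apply/funext => x; rewrite -cE.
Unshelve. all: by end_near. Qed.

End Limit.

Theorem theorem1p12 (R : realType) (p : nat) (hp : (2 <= p)%N)
    (d : nat -> measure_display) (Om : forall N : nat, measurableType (d N))
    (P : forall N : nat, probability (Om N) R)
    (T : forall N : nat, p.-tuple 'I_N -> {RV (P N) >-> R})
    (M : nat -> R) (hT : heavy_wigner T M) (hM2 : 0 < M 2%N) :
  (* the limits defining the covariance exist *)
  (forall (k1 k2 : nat), (1 <= k1)%N -> (1 <= k2)%N ->
     forall (pi1 : vpartition (hvert (hcycle p k1)))
            (pi2 : vpartition (hvert (hcycle p k2)))
            (sigma : vpartition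
               (hvert (hunion (hquotient pi1) (hquotient pi2)))),
     edge_gluing sigma ->
     cvg (mean_trace0 T (hquotient sigma) N @[N --> \oo])) /\
  exists (d' : measure_display) (Om' : measurableType d')
         (Q : probability Om' R) (z : posnat -> {RV Q >-> R}),
    [/\ gaussian_process Q (fun k => z k : Om' -> R),
        (forall k : posnat, 'E_Q[z k] = 0)%E,
        (forall k1 k2 : posnat,
           'E_Q[fun w => (z k1 w * z k2 w)%R] =
           (cycle_covariance T (M 2%N) (val k1) (val k2))%:E)%E &
        fdd_cvg P Q
          (fun (N : nat) (k : posnat) =>
             @trace_fluctuation R p d Om P T (M 2%N) N (val k))
          (fun k => z k : Om' -> R)].
Proof.
split=> [k1 k2 k10 k20 pi1 pi2 sigma gl|]; first exact: (glued_mean_trace0_cvg hp hT).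
exists _, (measurableTypeR R), (uniform01 R), (limit_process T (M 2%N)).
split.
- move=> n i c; have [m [e [eE _]]] := limit_process_comb hp hT hM2 i c.
  rewrite (_ : (fun w => _) = gauss_sum m e); first exact: gaussian_gauss_sum.
  by apply/funext => x; exact: eE.
- move=> k; have [_ [[i e] _]] := integr_gauss_sum (val k) (limit_coef T (M 2%N) (val k))
    (limit_coef T (M 2%N) (val k)).
  by rewrite (expectation_mean i) e.
- move=> k l; have [i e] := mean_limit_processM hp hT hM2 k l.
  by rewrite (expectation_mean i) e.
- exact: (fdd_cvg_limit_process hp hT hM2).
Qed.
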